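(* Let $g:\mathbb{R}^d\to\mathbb{C}$ be a continuous symbol function whose real part satisfies $g_R\ge\kappa$ for some $\kappa>0$, let $X\in\mathscr{V}'(\mathbb{R}^d\times\mathbb{R})\cap(\mathscr{V}(\mathbb{R}^d)\widehat{\boxtimes}C_{FD}(\mathbb{R}))'$ and let $U_0\in\mathscr{V}'(\mathbb{R}^d)$. Let $U^\infty$ be the unique solution in $\mathscr{V}'(\mathbb{R}^d\times\mathbb{R})$ of $\frac{\partial U}{\partial t}+\mathcal{L}_gU=X$, with càdlàg-in-time representation $(U^\infty_t)_{t\in\mathbb{R}}$, and let $U$ be the unique solution, with càdlàg-in-time representation $(U_t)_{t\in\mathbb{R}^+}$, of the Cauchy problem $$\frac{\partial U}{\partial t}+\mathcal{L}_gU=\mathbf{1}_{\mathbb{R}^d\times\mathbb{R}^+}X\ \text{ over }\mathbb{R}^d\times\mathbb{R}^+,\qquad U|_{t=0}=U_0.$$ Then for every $\epsilon>0$ and for every $\varphi\in\mathscr{V}(\mathbb{R}^d)$ there exists $t_{\epsilon,\varphi}\in\mathbb{R}^+$ such that $$|\langle U^\infty_t-U_t,\phi\rangle|<\epsilon\quad\text{for all }t\ge t_{\epsilon,\varphi}\text{ and all }\phi\in\mathscr{V}(\mathbb{R}^d)\text{ that are translations of }\varphi.$$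
   Context: Here $d\ge1$, $\mathbb{R}^+=[0,\infty)$, $\mathbb{N}=\{0,1,2,\dots\}$; $(x,t)$ are physical space-time variables and $(\xi,\omega)$ the dual frequency variables. A translation of $\varphi$ is a function $x\mapsto\varphi(x-h)$ with $h\in\mathbb{R}^d$. A symbol function is a measurable, polynomially bounded function $g:\mathbb{R}^d\to\mathbb{C}$ that is Hermitian (real part $g_R$ even, imaginary part odd). For $n\ge1$, $\mathscr{M}_{SG}(\mathbb{R}^n)\subset\mathscr{S}'(\mathbb{R}^n)$ is the space of slow-growing measures: complex Radon measures ($\sigma$-additive complex functions on bounded Borel sets) with $\int(1+|x|^2)^{-N}d|\mu|(x)<\infty$ for some $N\in\mathbb{N}$. $\mathscr{M}_{SG}(\mathbb{R}^d\times\mathbb{R}^+)$ is the set of $\mu\in\mathscr{M}_{SG}(\mathbb{R}^d\times\mathbb{R})$ with support in $\mathbb{R}^d\times\mathbb{R}^+$. For measurable polynomially bounded $f$, $f\mu$ is the measure $A\mapsto\int_Af\,d\mu$. $C_{FD}(\mathbb{R}^n)$: continuous $\varphi:\mathbb{R}^n\to\mathbb{C}$ with $\sup_x|(1+|x|^2)^N\varphi(x)|<\infty$ for all $N\in\mathbb{N}$. With $\mathscr{F}(\varphi)(\xi)=(2\pi)^{-n/2}\int e^{-i\xi^Tx}\varphi(x)dx$ (extended to tempered distributions by duality; on $\mathbb{R}^d\times\mathbb{R}$ it is the full space-time Fourier transform), $\mathscr{V}(\mathbb{R}^n)=\mathscr{F}(C_{FD}(\mathbb{R}^n))$, with dual $\mathscr{V}'(\mathbb{R}^n)=\mathscr{F}(\mathscr{M}_{SG}(\mathbb{R}^n))$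 (used with $n=d$ and $n=d+1$). $\mathscr{F}_S$ is the Fourier transform in the space variable only, $\mathscr{F}_S(\psi)(\xi,t)=(2\pi)^{-d/2}\int_{\mathbb{R}^d}e^{-i\xi^Tx}\psi(x,t)dx$ (extended by duality). As spaces of tempered distributions on $\mathbb{R}^d\times\mathbb{R}$: $(\mathscr{V}(\mathbb{R}^d)\widehat{\boxtimes}C_{FD}(\mathbb{R}))'=\mathscr{F}_S(\mathscr{M}_{SG}(\mathbb{R}^d\times\mathbb{R}))$ and $(\mathscr{V}(\mathbb{R}^d)\widehat{\boxtimes}C_{FD}(\mathbb{R}^+))'=\mathscr{F}_S(\mathscr{M}_{SG}(\mathbb{R}^d\times\mathbb{R}^+))$. $\mathcal{L}_g=\mathscr{F}_S^{-1}(g\,\mathscr{F}_S(\cdot))$, and on $\mathscr{V}'(\mathbb{R}^d\times\mathbb{R})$ the operator $\frac{\partial}{\partial t}+\mathcal{L}_g$ is $\mathscr{F}^{-1}((i\omega+g(\xi))\mathscr{F}(\cdot))$. $\mathbf{1}_{\mathbb{R}^d\times\mathbb{R}^+}X:=\mathscr{F}_S^{-1}(\mathbf{1}_{\mathbb{R}^d\times\mathbb{R}^+}\mathscr{F}_S(X))\in(\mathscr{V}(\mathbb{R}^d)\widehat{\boxtimes}C_{FD}(\mathbb{R}^+))'$. Càdlàg-in-time representation: $T\in(\mathscr{V}(\mathbb{R}^d)\widehat{\boxtimes}C_{FD}(\mathbb{R}))'$ has the (necessarily unique) càdlàg-in-time representation $(T_t)_{t\in\mathbb{R}}\subset\mathscr{V}'(\mathbb{R}^d)$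 if for all $\varphi\in\mathscr{V}(\mathbb{R}^d)$ the function $t\mapsto\langle T_t,\varphi\rangle$ is càdlàg and defines (as a density) a slow-growing measure over $\mathbb{R}$, and $\langle T,\varphi\boxtimes\theta\rangle=\int_{\mathbb{R}}\langle T_t,\varphi\rangle\theta(t)dt$ for all $\varphi\in\mathscr{V}(\mathbb{R}^d)$, $\theta\in C_{FD}(\mathbb{R})$, where $(\varphi\boxtimes\theta)(x,t)=\varphi(x)\theta(t)$. The distribution $U^\infty$ is $\mathscr{F}^{-1}\left(\frac{1}{i\omega+g(\xi)}\mathscr{F}(X)\right)$; it lies in $(\mathscr{V}(\mathbb{R}^d)\widehat{\boxtimes}C_{FD}(\mathbb{R}))'$ and its càdlàg-in-time representation is $$\langle U^\infty_t,\varphi\rangle=\int_{\mathbb{R}^d\times(-\infty,t]}e^{-(t-s)g(\xi)}\mathscr{F}_S^{-1}(\varphi)(\xi)\,d\mathscr{F}_S(X)(\xi,s),\quad\varphi\in\mathscr{V}(\mathbb{R}^d),\ t\in\mathbb{R}.$$ The solution $U$ of the Cauchy problem is the unique $U\in(\mathscr{V}(\mathbb{R}^d)\widehat{\boxtimes}C_{FD}(\mathbb{R}^+))'$ having a càdlàg-in-time representation whose evaluation at $t=0$ is $U_0$ and satisfying $\langle\frac{\partial U}{\partial t}+\mathcal{L}_gU,\psi\rangle=\langle\mathbf{1}_{\mathbb{R}^d\times\mathbb{R}^+}X,\psi\rangle$ for all $\psi\in\mathscr{S}(\mathbb{R}^d\times\mathbb{R})$ with $\mathrm{supp}(\psi)\subset\mathbb{R}^d\times\mathbb{R}^+$;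 its representation is $$\langle U_t,\varphi\rangle=\int_{\mathbb{R}^d}e^{-tg(\xi)}\mathscr{F}_S^{-1}(\varphi)(\xi)\,d\mathscr{F}_S(U_0)(\xi)+\int_{\mathbb{R}^d\times(0,t]}e^{-(t-s)g(\xi)}\mathscr{F}_S^{-1}(\varphi)(\xi)\,d\mathscr{F}_S(X)(\xi,s),\quad t\in\mathbb{R}^+,$$ where $\mathscr{F}_S$ applied to objects on $\mathbb{R}^d$ alone is the ordinary Fourier transform on $\mathbb{R}^d$. *)

(* Defs.v *)
From HB Require Import structures.
From mathcomp Require Import all_boot all_order all_algebra.
From mathcomp Require Import all_classical all_reals all_analysis.
From mathcomp Require Import complex.
Set Implicit Arguments.
Unset Strict Implicit.
Unset Printing Implicit Defensive.
Import Order.TTheory GRing.Theory Num.Theory.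
Import numFieldNormedType.Exports.

Local Open Scope classical_set_scope.
Local Open Scope ring_scope.
Local Open Scope complex_scope.

(* R^n is 'rV[R]_n, with its Borel sigma-algebra.
   R^d x R is 'rV[R]_(d + 1), the last coordinate being time (or omega).
   R[i] carries no topology over R in the libraries: continuity, limits,
   derivatives and integrals of R[i]-valued functions are taken on the real and
   imaginary parts. *)

Local Notation re := complex.Re.
Local Notation im := complex.Im.
Local Notation normc := ComplexField.Normc.normc.

HB.instance Definition _ (R : realType) (n : nat) :=
  Measurable.copy 'rV[R]_n (g_sigma_algebraType (@open 'rV[R]_n)).

Section Basics.
Context {R : realType}.
Implicit Types (n d : nat).

(* e^{i theta} *)
Definition expi (theta : R) : R[i] := cos theta +i* sin theta.

Definition dotv n (x y : 'rV[R]_n) : R := \sum_(i < n) x 0 i * y 0 i.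

Definition sqnorm n (x : 'rV[R]_n) : R := \sum_(i < n) x 0 i ^+ 2.

Definition space d (z : 'rV[R]_(d + 1)) : 'rV[R]_d := lsubmx z.
Definition time d (z : 'rV[R]_(d + 1)) : R := rsubmx z 0 0.
Definition spacetime d (x : 'rV[R]_d) (t : R) : 'rV[R]_(d + 1) :=
  row_mx x (t%:M : 'rV[R]_1).

Definition ccontinuous n (f : 'rV[R]_n -> R[i]) : Prop :=
  continuous (fun x => re (f x)) /\ continuous (fun x => im (f x)).

Definition cmeasurable n (f : 'rV[R]_n -> R[i]) : Prop :=
  measurable_fun setT (fun x => re (f x)) /\
  measurable_fun setT (fun x => im (f x)).

Definition poly_bounded n (f : 'rV[R]_n -> R[i]) : Prop :=
  exists (N : nat) (M : R), forall x, normc (f x) <= M * (1 + sqnorm x) ^+ N.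

Definition symbol_function n (g : 'rV[R]_n -> R[i]) : Prop :=
  [/\ cmeasurable g, poly_bounded g
    & forall x, re (g (- x)) = re (g x) /\ im (g (- x)) = - im (g x)].

End Basics.

Section Integration.
Context {R : realType}.

(* The integral of a real (resp. complex) function against a nonnegative set
   function. *)
Definition rint (dsp : measure_display) (T : measurableType dsp)
    (m : set T -> \bar R) (D : set T) (f : T -> R) : R :=
  fine (\int[m]_(x in D) (f x)%:E)%E.

Definition lint (dsp : measure_display) (T : measurableType dsp)
    (m : set T -> \bar R) (D : set T) (f : T -> R[i]) : R[i] :=
  rint m D (fun x => re (f x)) +i* rint m D (fun x => im (f x)).

(* Lebesgue measure on R^n, as an iterated product measure. *)
Fixpoint leb (n : nat) : set 'rV[R]_n -> \bar R :=
  match n with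
  | 0 => fun A => \d_(0 : 'rV[R]_0) A
  | n'.+1 => pushforward ((@lebesgue_measure R) \x leb (n := n'))%E
      (fun p : R * 'rV[R]_n' => row_mx (p.1%:M : 'rV[R]_1) p.2 : 'rV[R]_n'.+1)
  end.

End Integration.
Arguments leb : clear implicits.

Section SlowGrowingMeasures.
Context {R : realType}.
Implicit Types (n d : nat).

Definition borel_bounded n (A : set 'rV[R]_n) : Prop :=
  measurable A /\ bounded_set A.

(* Only the values of mu on bounded Borel sets are meaningful. *)
Definition complex_radon n (mu : set 'rV[R]_n -> R[i]) : Prop :=
  forall F : nat -> set 'rV[R]_n,
    (forall k, measurable (F k)) -> trivIset setT F ->
    bounded_set (\bigcup_k F k) ->
    (\sum_(0 <= k < N) re (mu (F k))) @[N --> \oo] --> re (mu (\bigcup_k F k))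
    /\
    (\sum_(0 <= k < N) im (mu (F k))) @[N --> \oo] --> im (mu (\bigcup_k F k)).

(* The total variation measure |mu|. *)
Definition tvar n (mu : set 'rV[R]_n -> R[i]) (A : set 'rV[R]_n) : \bar R :=
  ereal_sup [set e | exists (k : nat) (B : 'I_k -> set 'rV[R]_n),
    [/\ forall i, borel_bounded (B i) /\ B i `<=` A, trivIset setT B
      & e = (\sum_(i < k) normc (mu (B i)))%:E]].

(* The positive part r^+ in the Jordan decomposition of a real-valued r. *)
Definition pvar n (r : set 'rV[R]_n -> R) (A : set 'rV[R]_n) : \bar R :=
  ereal_sup [set (r B)%:E | B in [set B | borel_bounded B /\ B `<=` A]].

Definition sint n (r : set 'rV[R]_n -> R) (D : set 'rV[R]_n)
    (f : 'rV[R]_n -> R) : R :=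
  rint (pvar r) D f - rint (pvar (fun A => - r A)) D f.

(* The integral of f over D with respect to the complex Radon measure mu. *)
Definition cint n (mu : set 'rV[R]_n -> R[i]) (D : set 'rV[R]_n)
    (f : 'rV[R]_n -> R[i]) : R[i] :=
  let mr A := re (mu A) in let mi A := im (mu A) in
  let fr x := re (f x) in let fi x := im (f x) in
  (sint mr D fr - sint mi D fi) +i* (sint mi D fr + sint mr D fi).

Definition slow_growing n (mu : set 'rV[R]_n -> R[i]) : Prop :=
  complex_radon mu /\
  exists N : nat,
    (\int[tvar mu]_x (((1 + sqnorm x) ^+ N)^-1)%:E < +oo)%E.

Definition mmul n (f : 'rV[R]_n -> R[i]) (mu : set 'rV[R]_n -> R[i]) :
    set 'rV[R]_n -> R[i] :=
  fun A => cint mu A f.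

Definition msupport n (mu : set 'rV[R]_n -> R[i]) : set 'rV[R]_n :=
  ~` \bigcup_(O in [set O : set 'rV[R]_n | open O /\
       forall A, borel_bounded A -> A `<=` O -> mu A = 0]) O.

Definition future d : set 'rV[R]_(d + 1) := [set z | 0 <= time z].

End SlowGrowingMeasures.
Arguments future {R} d.

Section Fourier.
Context {R : realType}.
Implicit Types (n d : nat).

Definition fourier n (f : 'rV[R]_n -> R[i]) : 'rV[R]_n -> R[i] := fun xi =>
  ((Num.sqrt (2 * pi))^-1 ^+ n)%:C *
  lint (leb R n) setT (fun x => expi (- dotv xi x) * f x).

Definition ifourier n (f : 'rV[R]_n -> R[i]) : 'rV[R]_n -> R[i] := fun x =>
  ((Num.sqrt (2 * pi))^-1 ^+ n)%:C *
  lint (leb R n) setT (fun xi => expi (dotv xi x) * f xi).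

Definition fourierS d (f : 'rV[R]_(d + 1) -> R[i]) : 'rV[R]_(d + 1) -> R[i] :=
  fun z => fourier (fun x => f (spacetime x (time z))) (space z).

Definition ifourierS d (f : 'rV[R]_(d + 1) -> R[i]) : 'rV[R]_(d + 1) -> R[i] :=
  fun z => ifourier (fun xi => f (spacetime xi (time z))) (space z).

(* pderiv [:: i1; ...; ik] f is the iterated partial derivative
   d_i1 ... d_ik f. *)
Definition pderiv n (s : seq 'I_n) (f : 'rV[R]_n -> R) : 'rV[R]_n -> R :=
  foldr (fun i (h : 'rV[R]_n -> R) (x : 'rV[R]_n) => 'D_('e_i) h x) f s.

Definition rschwartz n (f : 'rV[R]_n -> R) : Prop :=
  forall s : seq 'I_n,
    [/\ continuous (pderiv s f),
        forall i x, derivable (pderiv s f) x 'e_i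
      & forall N : nat, exists M : R, forall x,
          (1 + sqnorm x) ^+ N * `|pderiv s f x| <= M].

Definition schwartz n (f : 'rV[R]_n -> R[i]) : Prop :=
  rschwartz (fun x => re (f x)) /\ rschwartz (fun x => im (f x)).

Definition CFD n (f : 'rV[R]_n -> R[i]) : Prop :=
  ccontinuous f /\
  forall N : nat, exists M : R, forall x, (1 + sqnorm x) ^+ N * normc (f x) <= M.

(* C_FD(R) for functions of a real variable. *)
Definition CFD1 (theta : R -> R[i]) : Prop :=
  CFD (fun v : 'rV[R]_1 => theta (v 0 0)).

Definition Vspace n (phi : 'rV[R]_n -> R[i]) : Prop :=
  exists2 chi, CFD chi & phi = fourier chi.

(* The inverse of the bijection F : C_FD(R^n) -> V(R^n); a function of V(R^n)
   need not be integrable, so that ifourier may not apply to it. *)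
Definition Vifourier n (phi : 'rV[R]_n -> R[i]) : 'rV[R]_n -> R[i] :=
  xget (fun=> 0) [set chi | CFD chi /\ fourier chi = phi].

End Fourier.

Section Distributions.
Context {R : realType}.
Implicit Types (n d : nat).

(* A tempered distribution is a functional of which only the restriction to
   Schwartz functions matters, whence the equality deq. All the distributions
   considered below are deq to a Fourier transform (full or in space) of a
   slow-growing measure, and so are linear and continuous on Schwartz
   functions. *)
Definition tempdist n : Type := ('rV[R]_n -> R[i]) -> R[i].

Definition deq n (S T : tempdist n) : Prop := forall psi, schwartz psi -> S psi = T psi.

Definition dist_of n (mu : set 'rV[R]_n -> R[i]) : tempdist n :=
  fun psi => cint mu setT psi.

Definition fourierD n (T : tempdist n) : tempdist n := fun psi => T (fourier psi).
Definition ifourierD n (T : tempdist n) : tempdist n := fun psi => T (ifourier psi).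
Definition fourierSD d (T : tempdist (d + 1)) : tempdist (d + 1) :=
  fun psi => T (fourierS psi).
Definition ifourierSD d (T : tempdist (d + 1)) : tempdist (d + 1) :=
  fun psi => T (ifourierS psi).

(* The slow-growing measure with which the tempered distribution T is
   identified, if there is one. *)
Definition measure_of n (T : tempdist n) : set 'rV[R]_n -> R[i] :=
  xget (fun=> 0) [set mu | slow_growing mu /\ deq T (dist_of mu)].

(* V'(R^n) *)
Definition Vdual n (T : tempdist n) : Prop :=
  exists2 mu, slow_growing mu & deq T (fourierD (dist_of mu)).

(* (V(R^d) [x] C_FD(R))' *)
Definition VCdual d (T : tempdist (d + 1)) : Prop :=
  exists2 mu, slow_growing mu & deq T (fourierSD (dist_of mu)).

(* (V(R^d) [x] C_FD(R^+))' *)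
Definition VCdual_future d (T : tempdist (d + 1)) : Prop :=
  exists mu, [/\ slow_growing mu, msupport mu `<=` future d
    & deq T (fourierSD (dist_of mu))].

(* <T, phi> for T in V'(R^n) and phi in V(R^n), i.e. <F(T), F^{-1}(phi)>. *)
Definition Vpair n (T : tempdist n) (phi : 'rV[R]_n -> R[i]) : R[i] :=
  cint (measure_of (fourierD T)) setT (Vifourier phi).

(* <T, phi [x] theta> for T in (V(R^d) [x] C_FD(R))', phi in V(R^d) and theta
   in C_FD(R), i.e. <F_S(T), F_S^{-1}(phi [x] theta)>, where
   F_S^{-1}(phi [x] theta) = F^{-1}(phi) [x] theta. *)
Definition VCpair d (T : tempdist (d + 1)) (phi : 'rV[R]_d -> R[i])
    (theta : R -> R[i]) : R[i] :=
  cint (measure_of (fourierSD T)) setT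
    (fun z => Vifourier phi (space z) * theta (time z)).

End Distributions.
Arguments tempdist : clear implicits.

Section Equations.
Context {R : realType}.
Implicit Types (n d : nat).

Definition dt d (psi : 'rV[R]_(d + 1) -> R[i]) : 'rV[R]_(d + 1) -> R[i] :=
  fun z => 'D_(spacetime 0 1) (fun y => re (psi y)) z
        +i* 'D_(spacetime 0 1) (fun y => im (psi y)) z.

Definition dtD d (T : tempdist R (d + 1)) : tempdist R (d + 1) := fun psi => - T (dt psi).

(* L_g = F_S^{-1}(g F_S(.)) on (V(R^d) [x] C_FD(R))' *)
Definition Lop d (g : 'rV[R]_d -> R[i]) (T : tempdist R (d + 1)) : tempdist R (d + 1) :=
  ifourierSD (dist_of
    (mmul (fun z => g (space z)) (measure_of (fourierSD T)))).

(* d/dt + L_g = F^{-1}((i omega + g(xi)) F(.)) on V'(R^d x R) *)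
Definition evolution_op d (g : 'rV[R]_d -> R[i]) (T : tempdist R (d + 1)) :
    tempdist R (d + 1) :=
  ifourierD (dist_of
    (mmul (fun z => 0 +i* time z + g (space z)) (measure_of (fourierD T)))).

(* 1_{R^d x R^+} T *)
Definition restrict_future d (T : tempdist R (d + 1)) : tempdist R (d + 1) :=
  ifourierSD (dist_of
    (mmul (fun z => (\1_(future d) z)%:C) (measure_of (fourierSD T)))).

Definition rcadlag (D : set R) (f : R -> R) : Prop :=
  forall t, D t ->
    f s @[s --> t^'+] --> f t /\
    ((exists2 s, D s & s < t) -> cvg (f s @[s --> t^'-])).

(* Left limits are only required at the t in D that D accumulates at from the
   left; D is meant to be R or R^+. *)
Definition cadlag (D : set R) (f : R -> R[i]) : Prop :=
  rcadlag D (fun t => re (f t)) /\ rcadlag D (fun t => im (f t)).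

(* The measure 1_D(t) f(t) dt on R = R^1. *)
Definition density (D : set R) (f : R -> R[i]) : set 'rV[R]_1 -> R[i] :=
  fun A => lint (@lebesgue_measure R) (D `&` [set t | A (t%:M)]) f.

(* (Tt t) for t in D is the cadlag-in-time representation of T; D is R, or R^+
   if T is supported there in time. *)
Definition cadlag_representation d (D : set R) (T : tempdist R (d + 1))
    (Tt : R -> tempdist R d) : Prop :=
  [/\ VCdual T,
      forall t, D t -> Vdual (Tt t)
    & forall phi, Vspace phi ->
      [/\ cadlag D (fun t => Vpair (Tt t) phi),
          slow_growing (density D (fun t => Vpair (Tt t) phi))
        & forall theta, CFD1 theta ->
          VCpair T phi theta =
          lint (@lebesgue_measure R) D (fun t => Vpair (Tt t) phi * theta t)]].

Definition solves_evolution d (g : 'rV[R]_d -> R[i]) (X U : tempdist R (d + 1)) :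
    Prop :=
  Vdual U /\ deq (evolution_op g U) X.

Definition solves_cauchy d (g : 'rV[R]_d -> R[i]) (X : tempdist R (d + 1))
    (U0 : tempdist R d) (U : tempdist R (d + 1)) (Ut : R -> tempdist R d) : Prop :=
  [/\ VCdual_future U,
      cadlag_representation [set t | 0 <= t] U Ut,
      deq (Ut 0) U0
    & forall psi, schwartz psi ->
        closure [set z | psi z != 0] `<=` future d ->
        dtD U psi + Lop g U psi = restrict_future X psi].

Definition translation_of n (phi phi' : 'rV[R]_n -> R[i]) : Prop :=
  exists h : 'rV[R]_n, phi' = fun x => phi (x - h).

End Equations.

(* Main.v *)
Require Import Defs.
From HB Require Import structures.
From mathcomp Require Import all_boot all_order all_algebra.
From mathcomp Require Import all_classical all_reals all_analysis.
From mathcomp Require Import complex measurable_realfun.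
From mathcomp Require Import ring lra.
Require Import Defs.
Set Implicit Arguments.
Unset Strict Implicit.
Unset Printing Implicit Defensive.
Import Order.TTheory GRing.Theory Num.Theory.
Import numFieldNormedType.Exports.
Local Open Scope classical_set_scope.
Local Open Scope ring_scope.
Local Open Scope complex_scope.

(** On the frequency side the two solutions are slow-growing measures in
    [(xi, t)] that solve the same transport equation for [t > 0]: for [Uinf]
    because the Fourier transform in time turns [i omega] into [d/dt], for [U]
    by definition. Their difference [L] thus satisfies
    [L(chi * (- theta' + g theta)) = 0] for every decaying [chi] in [xi] and
    every smooth [theta] with compact support in [t > 0]; integrating this in
    time gives [L(chi * theta(. - T)) = L(exp(- T g) chi * theta)]. When
    [theta] concentrates at [0] from the right, right continuity turns it into
    [<Uinf_T - U_T, F chi> = <Uinf_0 - U_0, F (exp(- T g) chi)>], which is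
    [O(exp(- kappa T))] with a constant depending on [|chi|] only. A translation
    of [F chi] multiplies [chi] by a character, hence does not change [|chi|].

    Test functions are products of bumps: two measures that agree on them agree
    on boxes, so identities extend to all decaying [chi]. Fourier inversion is
    obtained one coordinate at a time, from gaussian mollification. *)

(** Three obstacles shape the proof. The equations are known on Schwartz functions only, whereas [g]
    is merely continuous, so neither [g chi] nor [exp (- T g) chi] may be inserted directly: density
    is therefore taken in the space variable alone, with the factor in time kept smooth. [Uinf]
    comes with two separately chosen measures, one for its full and one for its spatial transform;
    they are linked only through the transform in time, and the factor [g] has to be carried across
    that link by density as well. Finally, the distribution at a fixed time is not a slice of the
    space-time measure: it is reached only as a right limit, so the transport is carried out on
    smeared times first. The integration in time does not differentiate under the measures. An
    increment over a step [h], corrected by [h] times an expression on which [L] vanishes, has a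
    pointwise weighted bound [O(h^2)], and such increments add up to nothing. *)

Local Notation re := complex.Re.
Local Notation im := complex.Im.
Local Notation normc := ComplexField.Normc.normc.

(** * Borel sets and Lebesgue measure on R^n *)

Section BorelRow.
Context {R : realType}.
Implicit Types n d : nat.

Lemma open_measurable_row n (A : set 'rV[R]_n) : open A -> measurable A.
Proof. by move=> oA; exact: sub_sigma_algebra. Qed.

Lemma continuous_measurable_row n (f : 'rV[R]_n -> R) :
  continuous f -> measurable_fun setT f.
Proof.
move=> cf; apply: (measurability _ (RGenOpens.measurableE R)) => _ [_ [a [b ->] <-]].
rewrite setTI; apply: open_measurable_row.
by apply: open_comp => [x _|]; [exact: cf|exact: interval_open].
Qed.

Lemma measurable_coord n (i : 'I_n) : measurable_fun setT (fun x : 'rV[R]_n => x 0 i).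
Proof. by apply: continuous_measurable_row; exact: coord_continuous. Qed.

(** Open sets generate the Borel sets, so checking measurability coordinate by coordinate requires a
    countable family: balls of radius 1/(k+1) with rational centre. Indices whose ball leaves [O]
    contribute the empty set, which keeps the index type independent of [O]. *)
Lemma open_row_bigcup n (O : set 'rV[R]_n) : open O ->
  O = \bigcup_(qk : 'rV[rat]_n * nat)
        (if `[< ball (map_mx ratr qk.1 : 'rV[R]_n) (qk.2.+1%:R^-1 : R) `<=` O >]
         then ball (map_mx ratr qk.1 : 'rV[R]_n) (qk.2.+1%:R^-1 : R) else set0).
Proof.
move=> oO; apply/seteqP; split => [x Ox|x [[q k] _ /=]]; last first.
  by case: ifPn => // /asboolP qO; exact: qO.
have /nbhs_ballP[e /= e0 eO] : nbhs x O by exact: open_nbhs_nbhs.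
have [k ke] : exists k : nat, k.+1%:R^-1 < e / 2.
  exists (Num.truncn (e / 2)^-1); rewrite invf_plt ?posrE ?divr_gt0// ?truncnS_gt//.
have k0 : 0 < k.+1%:R^-1 :> R by rewrite invr_gt0.
have [q qP] : exists q : 'rV[rat]_n, ball x (k.+1%:R^-1 : R) (map_mx ratr q).
  have /choice[q qP] : forall i, exists q : rat, ball (x 0 i) (k.+1%:R^-1 : R) (ratr q).
    move=> i; have xx : x 0 i - k.+1%:R^-1 < x 0 i + k.+1%:R^-1 by rewrite ltrBlDr -addrA ltrDl addr_gt0.
    have [q] := rat_in_itvoo xx; rewrite in_itv/= => /andP[q1 q2].
    by exists q; rewrite /ball/= ltr_distlC q1 q2.
  exists (\row_i q i); split => // i j; rewrite ord1 !mxE; exact: qP.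
exists (q, k) => //=; rewrite ifT; first exact: ball_sym.
apply/asboolP => y qy; apply: eO.
apply: (@le_ball _ _ _ (k.+1%:R^-1 + k.+1%:R^-1)).
  by rewrite [leRHS]splitr ltW// ltrD.
exact: ball_triangle qP qy.
Qed.

Lemma measurable_fun_row (dsp : measure_display) (T : measurableType dsp) n (f : T -> 'rV[R]_n) :
  (forall i, measurable_fun setT (fun t => f t 0 i)) -> measurable_fun setT f.
Proof.
move=> mf; apply: (@measurability _ _ T 'rV[R]_n setT f (@open 'rV[R]_n)) => [//|_ [A oA <-]].
rewrite setTI (open_row_bigcup oA) preimage_bigcup.
apply: countable_bigcupT_measurable => [|[q k]] /=; first exact: countableP.
case: ifPn => _; last by rewrite preimage_set0.
rewrite [X in measurable X](_ : _ = \bigcap_(i in [set: 'I_n])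
   ((fun t => f t 0 i) @^-1` (ball (ratr (q 0 i) : R) (k.+1%:R^-1 : R)))); last first.
  apply/seteqP; split => [t [_ H] i _|t H].
    by have := H 0 i; rewrite !mxE.
  by split => [|i j]; [rewrite invr_gt0|rewrite ord1 mxE; exact: H].
apply: fin_bigcap_measurable => // i _.
rewrite -[X in measurable X]setTI; apply: mf => //; exact: measurable_ball.
Qed.

(** The same [row_mx] as in [leb], so that [lebE] holds by conversion at each dimension. *)
Definition consv n (y : R) (x : 'rV[R]_n) : 'rV[R]_n.+1 := row_mx (y%:M : 'rV[R]_1) x.

Lemma consv0 n y (x : 'rV[R]_n) : consv y x 0 ord0 = y.
Proof.
transitivity (row_mx (y%:M : 'rV[R]_1) x 0 (lshift n ord0)).
  by congr (row_mx _ _ _ _); exact/val_inj.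
by rewrite row_mxEl mxE eqxx mulr1n.
Qed.

Lemma consvS n y (x : 'rV[R]_n) i : consv y x 0 (lift ord0 i) = x 0 i.
Proof.
transitivity (row_mx (y%:M : 'rV[R]_1) x 0 (rshift 1 i)).
  by congr (row_mx _ _ _ _); exact/val_inj.
by rewrite row_mxEr.
Qed.

Lemma rowS n (z : 'rV[R]_n.+1) : z = consv (z 0 ord0) (\row_i z 0 (lift ord0 i)).
Proof.
apply/rowP => i; case: (unliftP ord0 i) => [j ->|->]; first by rewrite consvS mxE.
by rewrite consv0.
Qed.

Lemma measurable_consv n :
  measurable_fun setT (fun p : R * 'rV[R]_n => consv p.1 p.2).
Proof.
apply: measurable_fun_row => i; case: (unliftP ord0 i) => [j ->|->].
  under eq_fun do rewrite consvS.
  exact: (measurableT_comp (@measurable_coord n j) (@measurable_snd _ _ _ _)).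
by under eq_fun do rewrite consv0; exact: measurable_fst.
Qed.

Lemma space_coord d (z : 'rV[R]_(d + 1)) i : space z 0 i = z 0 (lshift 1 i).
Proof. by rewrite /space mxE. Qed.

Lemma time_coord d (z : 'rV[R]_(d + 1)) : time z = z 0 (rshift d ord0).
Proof. by rewrite /time mxE. Qed.

Lemma measurable_space d : measurable_fun setT (@space R d).
Proof.
apply: measurable_fun_row => i; under eq_fun do rewrite space_coord.
exact: measurable_coord.
Qed.

Lemma measurable_time d : measurable_fun setT (@time R d).
Proof.
rewrite (_ : @time R d = fun z => z 0 (rshift d ord0)); first exact: measurable_coord.
by apply/funext => z; rewrite time_coord.
Qed.

End BorelRow.

Section LebesgueRow.
Context {R : realType}.
Implicit Types n d : nat.

Section step.
Context n (m : {sigma_finite_measure set 'rV[R]_n -> \bar R}).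

Definition leb_step : set 'rV[R]_n.+1 -> \bar R :=
  pushforward ((@lebesgue_measure R) \x m)%E (fun p : R * 'rV[R]_n => consv p.1 p.2).

Let leb_step0 : leb_step set0 = 0%E.
Proof. by rewrite /leb_step /pushforward preimage_set0 measure0. Qed.

Let leb_step_ge0 A : (0 <= leb_step A)%E.
Proof. by rewrite /leb_step /pushforward. Qed.

Let leb_step_sigma_additive : semi_sigma_additive leb_step.
Proof.
move=> F mF tF mUF; rewrite /leb_step /pushforward preimage_bigcup.
have mc B : measurable B -> measurable ((fun p : R * 'rV[R]_n => consv p.1 p.2) @^-1` B).
  by move=> mB; rewrite -[X in measurable X]setTI; exact: measurable_consv.
apply: measure_semi_sigma_additive => [k||].
- exact: mc.
- apply/trivIsetP => /= i j _ _ ij; rewrite -preimage_setI.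
  by move/trivIsetP : tF => /(_ _ _ _ _ ij) ->//; rewrite preimage_set0.
- by rewrite -preimage_bigcup; exact: mc.
Qed.

HB.instance Definition _ := isMeasure.Build _ _ _
  leb_step leb_step0 leb_step_ge0 leb_step_sigma_additive.

Let leb_step_sigma_finite : sigma_finite setT leb_step.
Proof.
(* An increasing exhaustion is taken so that a point is caught at the maximum of two indices, one
   for its first coordinate and one for the others. *)
have [F [TF ndF mF]] := (sigma_finiteP _ _).1 (sigma_finiteT m).
exists (fun k => [set z : 'rV[R]_n.+1 | `[- k%:R, k%:R]%classic (z 0 ord0) /\ F k (\row_i z 0 (lift ord0 i))]).
  apply/seteqP; split => // z _.
  have : setT (\row_i z 0 (lift ord0 i)) by [].
  rewrite TF => -[k _ Fk].
  pose N := maxn k (Num.truncn `|z 0 ord0|).+1.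
  exists N => //; split.
    rewrite /= in_itv/= -ler_norml.
    apply: (le_trans (ltW (truncnS_gt _))).
    by rewrite ler_nat leq_maxr.
  by have /subsetPset := ndF _ _ (leq_maxl k (Num.truncn `|z 0 ord0|).+1); apply.
move=> k; split.
  have -> : [set z : 'rV[R]_n.+1 | `[- k%:R, k%:R]%classic (z 0 ord0) /\
       F k (\row_i z 0 (lift ord0 i))] =
    ((fun z : 'rV[R]_n.+1 => z 0 ord0) @^-1` `[- k%:R, k%:R]) `&`
    ((fun z : 'rV[R]_n.+1 => \row_i z 0 (lift ord0 i)) @^-1` F k) by [].
  apply: measurableI; rewrite -[X in measurable X]setTI.
    exact: measurable_coord.
  have H : measurable_fun setT (fun z : 'rV[R]_n.+1 => (\row_i z 0 (lift ord0 i) : 'rV[R]_n)).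
    apply: measurable_fun_row => i; under eq_fun do rewrite mxE; exact: measurable_coord.
  by apply: H => //; exact: (mF k).1.
rewrite /leb_step /pushforward.
rewrite [X in (_ \x _)%E X](_ : _ = `[- k%:R, k%:R]%classic `*` F k); last first.
  apply/seteqP; split => [[y x] /=|[y x] /=].
    rewrite consv0 => -[? H]; split => //; move: H.
    by congr (F k _); apply/rowP => i; rewrite mxE consvS.
  rewrite consv0 => -[? H]; split => //; move: H.
  by congr (F k _); apply/rowP => i; rewrite mxE consvS.
rewrite product_measure1E//; last exact: (mF k).1.
rewrite lte_mul_pinfty//.
- have := @lebesgue_measure_itv R `[- k%:R, k%:R].
  by rewrite /= => ->; case: ifPn.
- exact: (mF k).2.
Qed.

HB.instance Definition _ := @Measure_isSigmaFinite.Build _ _ _ leb_step leb_step_sigma_finite.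

End step.

(** [leb] together with its structure of sigma-finite measure, which product measures and Fubini ask
    for. *)
Fixpoint lebm n : {sigma_finite_measure set 'rV[R]_n -> \bar R} :=
  match n with
  | 0 => @dirac _ 'rV[R]_0 0 R
  | n'.+1 => leb_step (lebm n')
  end.

Lemma lebE n : leb R n = lebm n.
Proof.
elim: n => [//|n IH] /=; rewrite IH; reflexivity.
Qed.

End LebesgueRow.

(** * Integrals of complex functions *)

Section ComplexAux.
Context {R : realType}.
Implicit Types (z w : R[i]) (t : R).

Lemma eqC z w : re z = re w -> im z = im w -> z = w.
Proof. by case: z => a b; case: w => c d /= -> ->. Qed.

Lemma re_mul z w : re (z * w) = re z * re w - im z * im w.
Proof. by case: z; case: w. Qed.

Lemma im_mul z w : im (z * w) = re z * im w + im z * re w.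
Proof. by case: z; case: w. Qed.

Lemma re_add z w : re (z + w) = re z + re w. Proof. by case: z; case: w. Qed.
Lemma im_add z w : im (z + w) = im z + im w. Proof. by case: z; case: w. Qed.
Lemma re_opp z : re (- z) = - re z. Proof. by case: z. Qed.
Lemma im_opp z : im (- z) = - im z. Proof. by case: z. Qed.

Definition reimE := (re_mul, im_mul, re_add, im_add, re_opp, im_opp).

Lemma normc_ge0 z : 0 <= normc z. Proof. by case: z => a b; exact: sqrtr_ge0. Qed.

Lemma normc_ge_re z : `|re z| <= normc z.
Proof.
case: z => a b; rewrite -sqrtr_sqr /= ler_wsqrtr// lerDl; exact: sqr_ge0.
Qed.

Lemma normc_ge_im z : `|im z| <= normc z.
Proof.
case: z => a b; rewrite -sqrtr_sqr /= ler_wsqrtr// lerDr; exact: sqr_ge0.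
Qed.

Lemma normc_le z : normc z <= `|re z| + `|im z|.
Proof.
case: z => a b /=; rewrite -[leRHS]ger0_norm ?addr_ge0// -sqrtr_sqr ler_wsqrtr//.
rewrite sqrrD !real_normK ?num_real// -addrA [X in _ <= _ + X]addrC lerD2l lerDl.
by rewrite mulrn_wge0// mulr_ge0.
Qed.

Lemma normcR t : normc t%:C = `|t|.
Proof. by rewrite /= expr0n/= addr0 sqrtr_sqr. Qed.

Lemma normc_expi t : normc (expi t) = 1.
Proof. by rewrite /expi/= cos2Dsin2 sqrtr1. Qed.

Lemma expiD t s : expi (t + s) = expi t * expi s.
Proof. by apply: eqC; rewrite /expi ?reimE /= ?cosD ?sinD//; ring. Qed.

Lemma expi0 : expi 0 = 1 :> R[i].
Proof. by rewrite /expi cos0 sin0. Qed.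

Lemma normc_sum (I : Type) (s : seq I) (F : I -> R[i]) :
  normc (\sum_(i <- s) F i) <= \sum_(i <- s) normc (F i).
Proof.
elim: s => [|a s IH]; first by rewrite !big_nil ComplexField.Normc.normc0.
by rewrite !big_cons; apply: (le_trans (le_normcD _ _)); rewrite lerD2l.
Qed.

End ComplexAux.

Section RealIntegral.
Context (dsp : measure_display) (T : measurableType dsp) {R : realType}.
Variable mu : {measure set T -> \bar R}.
Implicit Types f g : T -> R.

Definition itg f := mu.-integrable setT (EFin \o f).

Lemma itg_meas f : itg f -> measurable_fun setT f.
Proof. by case/integrableP => /measurable_EFinP. Qed.

Lemma itg_le f g : measurable_fun setT f -> itg g -> (forall x, `|f x| <= g x) -> itg f.
Proof.
move=> mf ig fg; apply: (le_integrable _ _ _ ig) => //; first exact/measurable_EFinP.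
by move=> x _ /=; rewrite lee_fin (le_trans (fg x))// ler_norm.
Qed.

Lemma itgD f g : itg f -> itg g -> itg (fun x => f x + g x).
Proof. by move=> fi gi; exact: (integrableD _ fi gi). Qed.

Lemma itgB f g : itg f -> itg g -> itg (fun x => f x - g x).
Proof. by move=> fi gi; exact: (integrableB _ fi gi). Qed.

Lemma itgZ (k : R) f : itg f -> itg (fun x => k * f x).
Proof. by move=> fi; exact: (integrableZl _ k fi). Qed.

Lemma itg0 : itg (fun=> 0). Proof. exact: integrable0. Qed.

Lemma itg_norm f : itg f -> itg (fun x => `|f x|).
Proof. exact: integrable_norm. Qed.

Lemma rintD f g : itg f -> itg g -> rint mu setT (fun x => f x + g x) = rint mu setT f + rint mu setT g.
Proof. by move=> fi gi; exact: RintegralD. Qed.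

Lemma rintB f g : itg f -> itg g -> rint mu setT (fun x => f x - g x) = rint mu setT f - rint mu setT g.
Proof. by move=> fi gi; exact: RintegralB. Qed.

Lemma rintZ (k : R) f : itg f -> rint mu setT (fun x => k * f x) = k * rint mu setT f.
Proof. by move=> fi; exact: RintegralZl. Qed.

Lemma rintN f : itg f -> rint mu setT (fun x => - f x) = - rint mu setT f.
Proof.
move=> fi; rewrite -mulN1r -rintZ//; congr rint; apply/funext => x; by rewrite mulN1r.
Qed.

Lemma rint0 : rint mu setT (fun=> 0) = 0.
Proof. by rewrite /rint integral0. Qed.

Lemma ler_rint f g : itg f -> itg g -> (forall x, f x <= g x) -> rint mu setT f <= rint mu setT g.
Proof. by move=> fi gi h; apply: le_Rintegral. Qed.

Lemma rint_ge0 f : (forall x, 0 <= f x) -> 0 <= rint mu setT f.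
Proof. by move=> h; exact: Rintegral_ge0. Qed.

Lemma ler_norm_rint f : itg f -> `|rint mu setT f| <= rint mu setT (fun x => `|f x|).
Proof. by move=> fi; exact: le_normr_Rintegral. Qed.

Lemma rintE f : itg f -> (\int[mu]_x (f x)%:E)%E = (rint mu setT f)%:E.
Proof. by move=> fi; rewrite /rint fineK//; exact: (integrable_fin_num _ fi). Qed.

Lemma rint_dominated (f_ : nat -> T -> R) f g :
  (forall n, measurable_fun setT (f_ n)) -> measurable_fun setT f -> itg g ->
  (forall x, f_ n x @[n --> \oo] --> f x) -> (forall n x, `|f_ n x| <= g x) ->
  rint mu setT (f_ n) @[n --> \oo] --> rint mu setT f.
Proof.
move=> mf_ mf ig cf fg.
have := @dominated_convergence _ _ _ mu setT measurableT (fun n x => (f_ n x)%:E)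
  (fun x => (f x)%:E) (fun x => (g x)%:E).
case.
- by move=> n; exact/measurable_EFinP.
- exact/measurable_EFinP.
- by apply/aeW => x _; apply/fine_cvgP; split; [exact: nearW|exact: cf].
- exact: ig.
- by apply/aeW => x n _; rewrite lee_fin.
move=> fi _; rewrite rintE//; move/fine_cvgP => [_]; exact.
Qed.

End RealIntegral.

Section ComplexIntegral.
Context (dsp : measure_display) (T : measurableType dsp) {R : realType}.
Variable mu : {measure set T -> \bar R}.
Implicit Types f g : T -> R[i].

Definition cmeas f := measurable_fun setT (fun x => re (f x)) /\
  measurable_fun setT (fun x => im (f x)).

Definition citg f := itg mu (fun x => re (f x)) /\ itg mu (fun x => im (f x)).

Lemma cmeas_real (f : T -> R) : measurable_fun setT f -> cmeas (fun x => (f x)%:C).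
Proof. by move=> mf; split => //=; exact: measurable_cst. Qed.

Lemma cmeas_cst (z : R[i]) : cmeas (fun=> z).
Proof. by split; exact: measurable_cst. Qed.

Lemma cmeasD f g : cmeas f -> cmeas g -> cmeas (fun x => f x + g x).
Proof.
move=> [f1 f2] [g1 g2]; split.
- under eq_fun do rewrite re_add; exact: measurable_funD.
- under eq_fun do rewrite im_add; exact: measurable_funD.
Qed.

Lemma cmeasM f g : cmeas f -> cmeas g -> cmeas (fun x => f x * g x).
Proof.
move=> [f1 f2] [g1 g2]; split.
- under eq_fun do rewrite re_mul; apply: measurable_funB; exact: measurable_funM.
- under eq_fun do rewrite im_mul; apply: measurable_funD; exact: measurable_funM.
Qed.

Lemma cmeasN f : cmeas f -> cmeas (fun x => - f x).
Proof.
move=> [f1 f2]; split.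
- under eq_fun do rewrite re_opp; exact: measurableT_comp.
- under eq_fun do rewrite im_opp; exact: measurableT_comp.
Qed.

Lemma cmeas_normc f : cmeas f -> measurable_fun setT (fun x => normc (f x)).
Proof.
move=> [f1 f2]; rewrite (_ : (fun x => _) =
  Num.sqrt \o (fun x => re (f x) ^+ 2 + im (f x) ^+ 2)); last first.
  by apply/funext => x /=; case: (f x).
apply: measurableT_comp.
  apply: continuous_measurable_fun; exact: sqrt_continuous.
by apply: measurable_funD; exact: measurable_funX.
Qed.

Lemma cmeas_expi (f : T -> R) : measurable_fun setT f -> cmeas (fun x => expi (f x)).
Proof.
move=> mf; split => /=; apply: measurableT_comp => //; apply: continuous_measurable_fun.
  exact: continuous_cos.
exact: continuous_sin.
Qed.

Lemma citg_meas f : citg f -> cmeas f.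
Proof. by case=> /itg_meas ? /itg_meas. Qed.

Lemma citg_normc f : citg f -> itg mu (fun x => normc (f x)).
Proof.
move=> [f1 f2]; have [m1 m2] := citg_meas (conj f1 f2).
apply: (itg_le _ (itgD (itg_norm f1) (itg_norm f2))); first exact: cmeas_normc.
by move=> x; rewrite ger0_norm ?normc_ge0// normc_le.
Qed.

Lemma citg_le f (g : T -> R) : cmeas f -> itg mu g -> (forall x, normc (f x) <= g x) -> citg f.
Proof.
move=> [m1 m2] ig fg; split; apply: (itg_le _ ig) => // x; apply: (le_trans _ (fg x)).
  exact: normc_ge_re.
exact: normc_ge_im.
Qed.

Lemma citg_real (f : T -> R) : itg mu f -> citg (fun x => (f x)%:C).
Proof. by move=> fi; split => //=; exact: itg0. Qed.

Lemma citgD f g : citg f -> citg g -> citg (fun x => f x + g x).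
Proof.
move=> [f1 f2] [g1 g2]; split.
- under eq_fun do rewrite re_add; exact: itgD.
- under eq_fun do rewrite im_add; exact: itgD.
Qed.

Lemma citgZ (z : R[i]) f : citg f -> citg (fun x => z * f x).
Proof.
move=> [f1 f2]; split.
- under eq_fun do rewrite re_mul; apply: itgB; exact: itgZ.
- under eq_fun do rewrite im_mul; apply: itgD; exact: itgZ.
Qed.

Lemma citgN f : citg f -> citg (fun x => - f x).
Proof.
move=> /(citgZ (-1)); rewrite (_ : (fun x => -1 * _) = (fun x => - f x))//.
by apply/funext => x; rewrite mulN1r.
Qed.

Lemma re_lint f : re (lint mu setT f) = rint mu setT (fun x => re (f x)).
Proof. by []. Qed.

Lemma im_lint f : im (lint mu setT f) = rint mu setT (fun x => im (f x)).
Proof. by []. Qed.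

Lemma lintD f g : citg f -> citg g ->
  lint mu setT (fun x => f x + g x) = lint mu setT f + lint mu setT g.
Proof.
move=> [f1 f2] [g1 g2]; apply: eqC; rewrite ?reimE !(re_lint, im_lint) -rintD//; congr rint;
  by apply/funext => x; rewrite reimE.
Qed.

Lemma lintZ (z : R[i]) f : citg f -> lint mu setT (fun x => z * f x) = z * lint mu setT f.
Proof.
move=> [f1 f2]; apply: eqC; rewrite ?reimE !(re_lint, im_lint) -!rintZ//.
- by rewrite -rintB; [congr rint; apply/funext => x; rewrite reimE|exact: itgZ..].
- by rewrite -rintD; [congr rint; apply/funext => x; rewrite reimE|exact: itgZ..].
Qed.

Lemma lintN f : citg f -> lint mu setT (fun x => - f x) = - lint mu setT f.
Proof.
by move=> fi; rewrite -mulN1r -lintZ//; congr lint; apply/funext => x; rewrite mulN1r.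
Qed.

Lemma lintB f g : citg f -> citg g ->
  lint mu setT (fun x => f x - g x) = lint mu setT f - lint mu setT g.
Proof. by move=> fi gi; rewrite lintD// ?lintN//; exact: citgN. Qed.

Lemma lint0 : lint mu setT (fun=> 0) = 0.
Proof. by apply: eqC; rewrite !(re_lint, im_lint) /= rint0. Qed.

Lemma lint_real (f : T -> R) : lint mu setT (fun x => (f x)%:C) = (rint mu setT f)%:C.
Proof. by apply: eqC; rewrite !(re_lint, im_lint) /= ?rint0. Qed.

(** The factor 2 comes from bounding real and imaginary parts separately. The sharp constant 1 would
    bring nothing, since all later estimates are up to constants or tend to 0. *)
Lemma normc_lint f : citg f -> normc (lint mu setT f) <= 2 * rint mu setT (fun x => normc (f x)).
Proof.
move=> fi; have [f1 f2] := fi; have fn := citg_normc fi.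
apply: (le_trans (normc_le _)); rewrite re_lint im_lint mulr2n mulrDl mul1r lerD//.
  apply: (le_trans (ler_norm_rint f1)); apply: ler_rint => //; first exact: itg_norm.
  by move=> x; exact: normc_ge_re.
apply: (le_trans (ler_norm_rint f2)); apply: ler_rint => //; first exact: itg_norm.
by move=> x; exact: normc_ge_im.
Qed.

Lemma normc_lint_le f (g : T -> R) : cmeas f -> itg mu g -> (forall x, normc (f x) <= g x) ->
  normc (lint mu setT f) <= 2 * rint mu setT g.
Proof.
move=> mf ig fg; have fi := citg_le mf ig fg; apply: (le_trans (normc_lint fi)).
by rewrite ler_pM2l//; apply: ler_rint => //; exact: citg_normc.
Qed.

Lemma lint_dominated (f_ : nat -> T -> R[i]) f (g : T -> R) :
  (forall n, cmeas (f_ n)) -> cmeas f -> itg mu g ->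
  (forall x, normc (f_ n x - f x) @[n --> \oo] --> (0 : R)) ->
  (forall n x, normc (f_ n x) <= g x) ->
  normc (lint mu setT (f_ n) - lint mu setT f) @[n --> \oo] --> (0 : R).
Proof.
move=> mf_ mf ig cf fg.
have cv (p : R[i] -> R) (x : T) : (forall z, `|p z| <= normc z) -> (forall z w, p (z - w) = p z - p w) ->
    p (f_ n x) @[n --> \oo] --> p (f x).
  move=> hp pB; apply/cvgrPdist_le => e e0.
  have /cvgrPdist_le/(_ _ e0) := cf x; apply: filterS => n.
  by rewrite sub0r normrN ger0_norm ?normc_ge0// distrC -pB; apply: le_trans.
have rB z w : re (z - w) = re z - re w :> R by rewrite re_add re_opp.
have iB z w : im (z - w) = im z - im w :> R by rewrite im_add im_opp.
have c1 : rint mu setT (fun x => re (f_ n x)) @[n --> \oo] --> rint mu setT (fun x => re (f x)).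
  apply: (@rint_dominated _ _ _ _ _ _ g) => //.
  - by move=> n; have [] := mf_ n.
  - by have [] := mf.
  - by move=> x; apply: cv; [exact: normc_ge_re|].
  - by move=> n x; exact: (le_trans (normc_ge_re _)).
have c2 : rint mu setT (fun x => im (f_ n x)) @[n --> \oo] --> rint mu setT (fun x => im (f x)).
  apply: (@rint_dominated _ _ _ _ _ _ g) => //.
  - by move=> n; have [] := mf_ n.
  - by have [] := mf.
  - by move=> x; apply: cv; [exact: normc_ge_im|].
  - by move=> n x; exact: (le_trans (normc_ge_im _)).
apply: (@squeeze_cvgr _ _ _ _ (fun=> 0) (fun n =>
  `|rint mu setT (fun x => re (f_ n x)) - rint mu setT (fun x => re (f x))| +
  `|rint mu setT (fun x => im (f_ n x)) - rint mu setT (fun x => im (f x))|)).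
- apply: nearW => n; apply/andP; split; first exact: normc_ge0.
  by apply: (le_trans (normc_le _)); rewrite rB iB; exact: lexx.
- exact: cvg_cst.
- rewrite [X in _ --> X](_ : 0 = `|0 : R| + `|0 : R|); last by rewrite normr0 addr0.
  have h (u : nat -> R) (l : R) : u n @[n --> \oo] --> l -> `|u n - l| @[n --> \oo] --> `|0 : R|.
    move=> ul; rewrite -[X in `|X|](subrr l); apply: cvg_norm.
    by apply: cvgB => //; exact: cvg_cst.
  by apply: cvgD; exact: h.
Qed.

End ComplexIntegral.

Section FubiniC.
Context (d1 d2 : measure_display) (T1 : measurableType d1) (T2 : measurableType d2) {R : realType}.
Variables (m1 : {sigma_finite_measure set T1 -> \bar R}) (m2 : {sigma_finite_measure set T2 -> \bar R}).

(** Every section is assumed integrable, not just almost every one: this makes the finite value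
    [rint] agree pointwise with the extended [fubini_F]. *)
Lemma rint_fubini1 (f : T1 * T2 -> R) : itg (m1 \x m2)%E f ->
  (forall x, itg m2 (fun y => f (x, y))) ->
  itg m1 (fun x => rint m2 setT (fun y => f (x, y))) /\
  rint m1 setT (fun x => rint m2 setT (fun y => f (x, y))) = rint (m1 \x m2)%E setT f.
Proof.
move=> fi fx.
have E : (fun x => (rint m2 setT (fun y => f (x, y)))%:E) = fubini_F m2 (EFin \o f).
  by apply/funext => x; rewrite /fubini_F/= rintE.
split; first by rewrite /itg /comp E; exact: integrable_fubini_F.
by rewrite /rint -(integral12_prod_meas1 fi) -E.
Qed.

Lemma rint_fubini2 (f : T1 * T2 -> R) : itg (m1 \x m2)%E f ->
  (forall y, itg m1 (fun x => f (x, y))) ->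
  measurable_fun setT (fun y => rint m1 setT (fun x => f (x, y))) /\
  rint m2 setT (fun y => rint m1 setT (fun x => f (x, y))) = rint (m1 \x m2)%E setT f.
Proof.
move=> fi fx.
have E : (fun y => (rint m1 setT (fun x => f (x, y)))%:E) = fubini_G m1 (EFin \o f).
  by apply/funext => y; rewrite /fubini_G/= rintE.
split; first by apply/measurable_EFinP; rewrite /comp E; exact: (measurable_fubini_G fi).
by rewrite /rint -(integral21_prod_meas1 fi) -E.
Qed.

Lemma lint_fubini1 (f : T1 * T2 -> R[i]) : citg (m1 \x m2)%E f ->
  (forall x, citg m2 (fun y => f (x, y))) ->
  citg m1 (fun x => lint m2 setT (fun y => f (x, y))) /\
  lint m1 setT (fun x => lint m2 setT (fun y => f (x, y))) = lint (m1 \x m2)%E setT f.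
Proof.
move=> [f1 f2] fx.
have [i1 e1] := rint_fubini1 f1 (fun x => (fx x).1).
have [i2 e2] := rint_fubini1 f2 (fun x => (fx x).2).
by split => //; apply: eqC.
Qed.

Lemma lint_fubini2 (f : T1 * T2 -> R[i]) : citg (m1 \x m2)%E f ->
  (forall y, citg m1 (fun x => f (x, y))) ->
  cmeas (fun y => lint m1 setT (fun x => f (x, y))) /\
  lint m2 setT (fun y => lint m1 setT (fun x => f (x, y))) = lint (m1 \x m2)%E setT f.
Proof.
move=> [f1 f2] fx.
have [i1 e1] := rint_fubini2 f1 (fun x => (fx x).1).
have [i2 e2] := rint_fubini2 f2 (fun x => (fx x).2).
by split => //; apply: eqC.
Qed.

Lemma itg_prod (f : T1 -> R) (g : T2 -> R) : itg m1 f -> itg m2 g ->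
  itg (m1 \x m2)%E (fun p => f p.1 * g p.2).
Proof.
move=> fi gi; have mf := itg_meas fi; have mg := itg_meas gi.
have mfg : measurable_fun setT (fun p : T1 * T2 => f p.1 * g p.2).
  apply: measurable_funM.
    exact: (measurableT_comp mf (@measurable_fst _ _ _ _)).
  exact: (measurableT_comp mg (@measurable_snd _ _ _ _)).
apply/(integrable12ltyP m1 m2); first exact/measurable_EFinP.
have mgn : measurable_fun setT (fun y => `|g y|%:E) by apply/measurable_EFinP/measurableT_comp.
rewrite (eq_integral (fun x => (rint m2 setT (fun y => `|g y|) * `|f x|)%:E)).
  rewrite rintE; last by apply: itgZ; exact: itg_norm.
  exact: ltry.
move=> x _; rewrite (eq_integral (fun y => (`|f x|%:E * `|g y|%:E)%E)); last first.
  by move=> y _; rewrite /= normrM EFinM.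
rewrite ge0_integralZl//.
by rewrite rintE; [rewrite -EFinM mulrC|exact: itg_norm].
Qed.

End FubiniC.

(** * Limits, derivatives and integration by parts for integrals on the line *)

Section RealAnalysis.
Context {R : realType}.
Local Notation lam := (@lebesgue_measure R).

Lemma is_derive_cont (f : R -> R) (x l : R) : is_derive x 1 f l -> {for x, continuous f}.
Proof.
by case=> df _; apply: differentiable_continuous; exact/derivable1_diffP.
Qed.

Lemma continuous_sumr (S : topologicalType) (I : Type) (s : seq I) (F : I -> S -> R) :
  (forall i, continuous (F i)) -> continuous (fun x => \sum_(i <- s) F i x).
Proof. by move=> h; apply: continuous_big => //; exact: add_continuous. Qed.

Lemma continuous_prodr (S : topologicalType) (I : Type) (s : seq I) (F : I -> S -> R) :
  (forall i, continuous (F i)) -> continuous (fun x => \prod_(i <- s) F i x).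
Proof. by move=> h; apply: continuous_big => //; exact: mul_continuous. Qed.

Lemma continuous_addr (S : topologicalType) (f g : S -> R) :
  continuous f -> continuous g -> continuous (fun x => f x + g x).
Proof. by move=> cf cg x; exact: (@continuousD _ R^o S f g x (cf x) (cg x)). Qed.

Lemma continuous_mulr (S : topologicalType) (f g : S -> R) :
  continuous f -> continuous g -> continuous (fun x => f x * g x).
Proof. by move=> cf cg x; exact: (@continuousM R S f g x (cf x) (cg x)). Qed.

Lemma continuous_oppr (S : topologicalType) (f : S -> R) :
  continuous f -> continuous (fun x => - f x).
Proof. by move=> cf x; exact: (@continuousN _ R^o S f x (cf x)). Qed.

(** Dominated convergence speaks of sequences; this turns it into continuity of integrals that
    depend on a parameter. A failure of continuity is witnessed by points in the balls of radius
    1/(n+1). *)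
Lemma seq_continuous (S : pseudoMetricType R) (F : S -> R) (x : S) :
  (forall u : nat -> S, u n @[n --> \oo] --> x -> F (u n) @[n --> \oo] --> F x) ->
  {for x, continuous F}.
Proof.
move=> H; apply: contrapT => nc.
have [e e0 he] : exists2 e : R, 0 < e & forall n : nat, exists y, ball x (n.+1%:R^-1 : R) y /\ e <= `|F x - F y|.
  apply: contrapT => h; apply: nc; apply/cvgrPdist_lt => e e0.
  apply: contrapT => nn; apply: h; exists e => // n.
  apply: contrapT => hn; apply: nn; apply/nbhs_ballP; exists (n.+1%:R^-1) => /=.
    by rewrite invr_gt0.
  move=> y xy; rewrite ltNge; apply/negP => ey; apply: hn; by exists y.
have [u hu] := choice he.
have ux : u n @[n --> \oo] --> x.
  apply/cvg_ballP => d d0.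
  have : \forall n \near \oo, n.+1%:R^-1 < d by apply: near_infty_natSinv_lt (PosNum d0).
  by apply: filterS => n nd; apply: (le_ball (ltW nd)); exact: (hu n).1.
have /cvgrPdist_lt/(_ _ e0) := H u ux.
case=> N _ /(_ N (leqnn N)) /=; rewrite ltNge => /negP; apply; exact: (hu N).2.
Qed.

Lemma rint_continuous (dsp : measure_display) (T : measurableType dsp)
  (mu : {measure set T -> \bar R}) (S : pseudoMetricType R) (k : S -> T -> R) (g : T -> R) :
  (forall s, measurable_fun setT (k s)) -> (forall t, continuous (k ^~ t)) ->
  itg mu g -> (forall s t, `|k s t| <= g t) ->
  continuous (fun s => rint mu setT (k s)).
Proof.
move=> mk ck ig kg s; apply: seq_continuous => u us.
apply: (rint_dominated _ _ ig) => // t.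
exact: (cvg_comp _ _ us (ck t s)).
Qed.

Lemma is_derive_rint (dsp : measure_display) (T : measurableType dsp)
  (mu : {measure set T -> \bar R}) (k dk : R -> T -> R) (g : T -> R) (x : R) :
  (forall s, itg mu (k s)) -> (forall (s : R) t, is_derive s 1 (k ^~ t) (dk s t)) ->
  itg mu g -> (forall s t, `|dk s t| <= g t) ->
  is_derive x 1 (fun s => rint mu setT (k s)) (rint mu setT (dk x)).
Proof.
move=> ik hd ig hg.
have Ia : `]x - 1, x + 1[%classic x by rewrite /= in_itv/= ltrBlDr ltrDl ltr01.
have pE s t : partial1of2 k s t = dk s t by rewrite partial1of2E; have [_ ->] := hd s t.
have g0 t : 0 <= g t by exact: le_trans (hg x t).
have D1 s t : `]x - 1, x + 1[%classic s -> setT t -> derivable (k ^~ t) s 1.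
  by move=> _ _; have [] := hd s t.
have ub s t : `]x - 1, x + 1[%classic s -> setT t -> `|partial1of2 k s t| <= g t.
  by move=> _ _; rewrite pE.
apply: DeriveDef.
  exact: (@derivable_under_integral R _ T mu k setT measurableT x _ _ Ia (fun s _ => ik s) D1 g g0 ig ub).
rewrite -derive1E.
rewrite (@differentiation_under_integral R _ T mu k setT measurableT x _ _ Ia (fun s _ => ik s) D1 g g0 ig ub).
by congr (rint _ _ _); apply/funext => t; rewrite pE.
Qed.

Lemma itg_oneDsqrV : itg lam (fun y : R => (1 + y ^+ 2)^-1).
Proof.
apply/integrableP; split.
  by apply/measurable_EFinP; apply: continuous_measurable_fun; exact: (@continuous_oneDsqrV R).
have h0 (y : R) : 0 <= (1 + y ^+ 2)^-1 by rewrite invr_ge0 addr_ge0 ?sqr_ge0.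
under eq_integral => y _ do rewrite /= ger0_norm//.
have := @ge0_symfun_integralT R _ h0 (@continuous_oneDsqrV R).
rewrite -set_itvcy (@integral0y_oneDsqr R) -EFinM => ->; first exact: ltry.
by move=> y /=; rewrite sqrrN.
Qed.

Lemma rint_restrict (f : R -> R) (a b : R) :
  rint lam setT (fun y => if (a <= y <= b) then f y else 0) = rint lam `[a, b] f.
Proof.
rewrite /rint [in RHS]integral_mkcond; congr fine; apply: eq_integral => y _.
rewrite /patch; have -> : (y \in `[a, b]%classic) = (a <= y <= b).
  by apply/idP/idP => [/set_mem|h]; [|apply/mem_set]; rewrite /= in_itv.
by case: ifP.
Qed.

(** Every integration by parts below is an instance: [F] is a product, and the vanishing integral of
    its derivative equates the two terms of the product rule. Limits along the integers suffice
    because the integrals over [-n, n] converge by domination. *)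
Lemma rint_deriv0 (F f : R -> R) : (forall x : R, is_derive x 1 F (f x)) -> continuous f ->
  itg lam f -> F n%:R @[n --> \oo] --> (0 : R) -> F (- n%:R) @[n --> \oo] --> (0 : R) ->
  rint lam setT f = 0.
Proof.
move=> dF cf fi F1 F2.
(* The shift to [n.+1] keeps the interval nondegenerate, as the fundamental theorem of calculus
   demands. *)
pose f_ (n : nat) (y : R) : R := if (- n.+1%:R <= y <= n.+1%:R) then f y else 0.
have mf : measurable_fun setT f by exact: continuous_measurable_fun.
have c1 : rint lam setT (f_ n) @[n --> \oo] --> rint lam setT f.
  apply: (@rint_dominated _ _ _ lam f_ f (fun y => `|f y|)).
  - move=> n; apply: measurable_fun_ifT => //.
    apply: (@measurable_and _ R setT (fun y => - n.+1%:R <= y) (fun y => y <= n.+1%:R)).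
      exact: measurable_fun_ler.
    exact: measurable_fun_ler.
  - exact: mf.
  - exact: itg_norm.
  - move=> x; apply: cvg_near_cst.
    exists (Num.truncn `|x|) => // n /= nx; rewrite /f_ ifT// -ler_norml.
    by rewrite (le_trans (ltW (truncnS_gt _)))// ler_nat ltnS.
  - by move=> n x; rewrite /f_; case: ifP => // _; rewrite normr0.
have E n : rint lam setT (f_ n) = F n.+1%:R - F (- n.+1%:R).
  rewrite rint_restrict /rint (@continuous_FTC2 R f F)//.
  - by rewrite gtrN.
  - exact: continuous_subspaceT.
  - split.
    + by move=> x _; have [] := dF x.
    + by apply: cvg_at_right_filter; exact: is_derive_cont (dF _).
    + by apply: cvg_at_left_filter; exact: is_derive_cont (dF _).
  - by move=> x _; rewrite derive1E; have [_ ->] := dF x.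
have c2 : rint lam setT (f_ n) @[n --> \oo] --> (0 : R) - 0.
  under eq_fun do rewrite E.
  by apply: cvgB; [rewrite (cvg_shiftS (fun n => F n%:R))|rewrite (cvg_shiftS (fun n => F (- n%:R)))].
rewrite subr0 in c2; apply: (cvg_unique _ c1 c2); exact: norm_hausdorff.
Qed.

End RealAnalysis.

(** * Weights and integrability of decaying functions on R^n *)

Section Weights.
Context {R : realType}.
Local Notation lam := (@lebesgue_measure R).
Implicit Types n d : nat.

Lemma sqnorm_ge0 n (x : 'rV[R]_n) : 0 <= sqnorm x.
Proof. by apply: sumr_ge0 => i _; exact: sqr_ge0. Qed.

Lemma sqnormD1_gt0 n (x : 'rV[R]_n) : 0 < 1 + sqnorm x.
Proof. by rewrite ltr_pwDl// sqnorm_ge0. Qed.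

Lemma sqnormD1_ge1 n (x : 'rV[R]_n) : 1 <= 1 + sqnorm x.
Proof. by rewrite lerDl sqnorm_ge0. Qed.

Lemma sqnorm_coord n (x : 'rV[R]_n) i : x 0 i ^+ 2 <= sqnorm x.
Proof.
by rewrite /sqnorm (bigD1 i)//= lerDl; apply: sumr_ge0 => j _; exact: sqr_ge0.
Qed.

Lemma sqnorm_consv n y (x : 'rV[R]_n) : sqnorm (consv y x) = y ^+ 2 + sqnorm x.
Proof.
rewrite /sqnorm big_ord_recl consv0; congr (_ + _).
by apply: eq_bigr => i _; rewrite consvS.
Qed.

Lemma continuous_sqnorm n : continuous (@sqnorm R n).
Proof.
apply: continuous_sumr => i x.
apply: (@continuous_comp _ _ _ (fun z : 'rV[R]_n => z 0 i) (fun t => t ^+ 2)).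
  exact: coord_continuous.
exact: exprn_continuous.
Qed.

(** Unlike powers of 1 + |x|^2, this weight factorises along [consv], so that its integrability
    follows by induction on the dimension; by [le_wt] it dominates (1 + |x|^2)^(-n). *)
Definition wt n (x : 'rV[R]_n) : R := \prod_(i < n) (1 + x 0 i ^+ 2)^-1.

Lemma wt_consv n y (x : 'rV[R]_n) : wt (consv y x) = (1 + y ^+ 2)^-1 * wt x.
Proof.
rewrite /wt big_ord_recl consv0; congr (_ * _).
by apply: eq_bigr => i _; rewrite consvS.
Qed.

Lemma le_wt n (x : 'rV[R]_n) : ((1 + sqnorm x) ^+ n)^-1 <= wt x.
Proof.
rewrite /wt prodfV lef_pV2 ?posrE; last 2 first.
- by rewrite exprn_gt0// sqnormD1_gt0.
- by apply: prodr_gt0 => i _; rewrite ltr_pwDl ?sqr_ge0.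
rewrite -[X in _ ^+ X](card_ord n) -prodr_const; apply: ler_prod => i _.
by rewrite addr_ge0 ?sqr_ge0//= lerD2l sqnorm_coord.
Qed.

(** [measurable_consv] with R seen as the type that carries [lebesgue_measure], as the two changes
    of variables below require. *)
Let measurable_consv_ocitv n : measurable_fun setT
  (fun p : g_sigma_algebraType R.-ocitv.-measurable * 'rV[R]_n => consv (p.1 : R) p.2).
Proof. exact: measurable_consv. Qed.

Lemma itg_consv n (f : 'rV[R]_n.+1 -> R) : measurable_fun setT f ->
  itg (lam \x lebm n)%E (fun p => f (consv p.1 p.2)) -> itg (lebm n.+1) f.
Proof.
move=> mf fi; have := @integrable_pushforward _ _ _ _ _ _ (@measurable_consv_ocitv n)
  (lam \x lebm n)%E setT (EFin \o f).
apply => //; exact/measurable_EFinP.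
Qed.

Lemma rint_consv n (f : 'rV[R]_n.+1 -> R) : measurable_fun setT f ->
  itg (lam \x lebm n)%E (fun p => f (consv p.1 p.2)) ->
  rint (lebm n.+1) setT f = rint (lam \x lebm n)%E setT (fun p => f (consv p.1 p.2)).
Proof.
move=> mf fi; have := @integral_pushforward _ _ _ _ _ _ (@measurable_consv_ocitv n)
  (lam \x lebm n)%E setT (EFin \o f).
move=> h; rewrite /rint; congr fine.
apply: h => //; exact/measurable_EFinP.
Qed.

Lemma measurable_wt n : measurable_fun setT (@wt n).
Proof.
apply: continuous_measurable_row.
apply: continuous_prodr => i x.
apply: (@continuous_comp _ _ _ (fun z : 'rV[R]_n => z 0 i) (fun t => (1 + t ^+ 2)^-1)).
  exact: coord_continuous.
exact: (@continuous_oneDsqrV R).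
Qed.

Lemma itg_wt n : itg (lebm n) (@wt n).
Proof.
elim: n => [|n IH].
  apply: (@itg_le _ _ _ _ _ (fun=> 1)).
  - exact: measurable_wt.
  - exact: (@finite_measure_integrable_cst _ 'rV[R]_0 R (@dirac _ 'rV[R]_0 0 R) setT 1).
  - by move=> x; rewrite /wt big_ord0 normr1.
apply: itg_consv; first exact: measurable_wt.
under eq_fun do rewrite wt_consv.
exact: (itg_prod itg_oneDsqrV IH).
Qed.

Definition decay n (f : 'rV[R]_n -> R[i]) :=
  forall N : nat, exists M : R, forall x, (1 + sqnorm x) ^+ N * normc (f x) <= M.

Lemma decay_ge0 n (f : 'rV[R]_n -> R[i]) : decay f ->
  forall N : nat, exists2 M : R, 0 <= M & forall x, normc (f x) <= M * ((1 + sqnorm x) ^+ N)^-1.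
Proof.
move=> df N; have [M hM] := df N; exists M.
  by apply: le_trans (hM 0); rewrite mulr_ge0 ?normc_ge0// exprn_ge0// ltW// sqnormD1_gt0.
by move=> x; rewrite ler_pdivlMr ?exprn_gt0 ?sqnormD1_gt0// mulrC.
Qed.

Lemma citg_decay n (f : 'rV[R]_n -> R[i]) : cmeas f -> decay f -> citg (lebm n) f.
Proof.
move=> mf /decay_ge0/(_ n)[M M0 hM]; apply: (citg_le mf (itgZ M (itg_wt n))) => x.
by apply: (le_trans (hM x)); rewrite ler_wpM2l// le_wt.
Qed.

End Weights.

(** * Schwartz functions *)

Section DirectionalDerivative.
Context {R : realType} (n : nat).
Implicit Types (F : 'rV[R]_n -> R) (x v : 'rV[R]_n).

Lemma is_derive_line F x v (l : R) :
  is_derive (0 : R) 1 (fun t : R => F (t *: v + x)) l -> is_derive x v F l.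
Proof.
case=> df <-; apply: DeriveDef; first exact/derivable1P.
have E : (fun h : R => h^-1 *: (F (h *: v + x) - F x)) =
    (fun h : R => h^-1 *: (F ((h *: (1 : R) + 0) *: v + x) - F ((0 : R) *: v + x))).
  by apply/funext => h; rewrite addr0 scale0r add0r [_%:A]mulr1.
by rewrite /derive /= E.
Qed.

Lemma line_is_derive F x v (s : R) : derivable F (s *: v + x) v ->
  is_derive s 1 (fun t : R => F (t *: v + x)) ('D_v F (s *: v + x)).
Proof.
move=> df.
have E : (fun h : R => h^-1 *: (F (h *: v + (s *: v + x)) - F (s *: v + x))) =
    (fun h : R => h^-1 *: (F ((h *: (1 : R) + s) *: v + x) - F (s *: v + x))).
  by apply/funext => h; rewrite scalerDl [_%:A]mulr1 addrA.
apply: DeriveDef.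
  by move: df; rewrite /derivable /= E.
by rewrite /derive /= E.
Qed.

Lemma e_coord (i j : 'I_n) (h : R) x : (h *: 'e_i + x) 0 j = (if j == i then h + x 0 i else x 0 j).
Proof.
rewrite !mxE eqxx /=; case: eqVneq => [->|_]; first by rewrite mulr1.
by rewrite mulr0 add0r.
Qed.

Lemma is_derive_coord (i j : 'I_n) x : is_derive x 'e_i (fun z : 'rV[R]_n => z 0 j) ((j == i)%:R : R).
Proof.
apply: is_derive_line; under eq_fun do rewrite e_coord; case: eqVneq => _.
  by apply: is_derive_eq; rewrite addr0.
exact: is_derive_cst.
Qed.

Definition upd x (i : 'I_n) (y : R) : 'rV[R]_n := \row_j (if j == i then y else x 0 j).

Lemma upd_coord x i y j : upd x i y 0 j = if j == i then y else x 0 j.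
Proof. by rewrite mxE. Qed.

Lemma upd_id x i : upd x i (x 0 i) = x.
Proof. by apply/rowP => j; rewrite mxE; case: eqVneq => [->|]. Qed.

Lemma upd_upd x i y z : upd (upd x i y) i z = upd x i z.
Proof. by apply/rowP => j; rewrite !mxE; case: eqVneq. Qed.

Lemma upd_line x (i : 'I_n) (y : R) : upd x i y = y *: 'e_i + upd x i 0.
Proof.
by apply/rowP => j; rewrite e_coord !mxE eqxx addr0; case: eqVneq.
Qed.

Lemma upd_e_eq x (i : 'I_n) (h y : R) : upd (h *: 'e_i + x) i y = upd x i y.
Proof. by apply/rowP => j; rewrite !upd_coord e_coord; case: eqVneq. Qed.

Lemma upd_e_neq x (i j : 'I_n) (h y : R) : i != j -> upd (h *: 'e_j + x) i y = h *: 'e_j + upd x i y.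
Proof.
move=> ij; apply/rowP => k; rewrite upd_coord !e_coord !upd_coord.
by case: (eqVneq k i) => [->|ki]; rewrite ?(negbTE ij)//; case: (eqVneq k j) => // _; rewrite (eq_sym j) (negbTE ij).
Qed.

Lemma continuous_row (S : topologicalType) (f : S -> 'rV[R]_n) :
  (forall j, continuous (fun s => f s 0 j)) -> continuous f.
Proof.
move=> h s; apply/cvg_ballP => e e0.
have H j : \forall t \near s, ball (f s 0 j) e (f t 0 j).
  by have /cvg_ballP := h j s; apply.
have : \forall t \near s, forall j, ball (f s 0 j) e (f t 0 j) by exact: filter_forall.
by apply: filterS => t ht; split => // i j; rewrite ord1.
Qed.

Lemma continuous_updy x i : continuous (upd x i).
Proof.
apply: continuous_row => j y; rewrite /continuous_at.
under eq_fun do rewrite upd_coord; rewrite upd_coord; case: ifP => _; [exact: cvg_id|exact: cvg_cst].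
Qed.

Lemma continuous_updx i y : continuous (fun x => upd x i y).
Proof.
apply: continuous_row => j.
rewrite (_ : (fun x => _) = if j == i then cst y else (fun x : 'rV[R]_n => x 0 j)).
  by case: ifP => _; [exact: cst_continuous|exact: coord_continuous].
by apply/funext => x; rewrite upd_coord; case: ifP.
Qed.

End DirectionalDerivative.

Section RealSchwartz.
Context {R : realType} (n : nat).
Implicit Types (f g : 'rV[R]_n -> R).

Local Notation DD i f := (fun x => 'D_('e_i) f x).

Lemma pderiv_rcons (s : seq 'I_n) i f : pderiv (rcons s i) f = pderiv s (DD i f).
Proof. by rewrite /pderiv foldr_rcons. Qed.

Lemma rs_cont f : rschwartz f -> continuous f.
Proof. by move=> /(_ [::]) []. Qed.

Lemma rs_der f i x : rschwartz f -> is_derive x 'e_i f ('D_('e_i) f x).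
Proof. by move=> /(_ [::]) [_ /(_ i x) h _]; exact: DeriveDef. Qed.

Lemma rs_bound f N : rschwartz f -> exists M, forall x, (1 + sqnorm x) ^+ N * `|f x| <= M.
Proof. by move=> /(_ [::]) [_ _]; apply. Qed.

Lemma rs_D f i : rschwartz f -> rschwartz (DD i f).
Proof. by move=> hf s; rewrite -pderiv_rcons; exact: hf. Qed.

(** A coinduction principle: instead of computing iterated derivatives, one exhibits a class [P] of
    functions that is stable under each partial derivative. The work is then in choosing [P] large
    enough to be stable. *)
Lemma rs_coind (P : ('rV[R]_n -> R) -> Prop) :
  (forall f, P f -> [/\ continuous f,
     forall N, exists M, forall x, (1 + sqnorm x) ^+ N * `|f x| <= M
   & forall i, exists2 g, P g & forall x, is_derive x 'e_i f (g x)]) ->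
  forall f, P f -> rschwartz f.
Proof.
move=> H f Pf s.
have Ps : P (pderiv s f).
  elim: s => [//|i s IH] /=.
  have [_ _ /(_ i) [g Pg hg]] := H _ IH.
  rewrite (_ : (fun _ => _) = g)//; apply/funext => x; by have [_ ->] := hg x.
have [c b d] := H _ Ps; split => // i x.
by have [g _ /(_ x) []] := d i.
Qed.

Lemma rsD f g : rschwartz f -> rschwartz g -> rschwartz (fun x => f x + g x).
Proof.
move=> hf hg; apply: (@rs_coind (fun h => exists f g, [/\ rschwartz f, rschwartz g & h = (fun x => f x + g x)])); last by exists f, g.
move=> _ [{hf}f [{hg}g [hf hg ->]]]; split.
- by apply: continuous_addr; [exact: (rs_cont hf)|exact: (rs_cont hg)].
- move=> N; have [M1 h1] := rs_bound N hf; have [M2 h2] := rs_bound N hg; exists (M1 + M2) => x.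
  apply: (@le_trans _ _ ((1 + sqnorm x) ^+ N * (`|f x| + `|g x|))).
    by rewrite ler_wpM2l ?exprn_ge0 ?(ltW (sqnormD1_gt0 _))// ler_normD.
  by rewrite mulrDr lerD.
- move=> i; exists (fun x => DD i f x + DD i g x).
    by exists (DD i f), (DD i g); split => //; exact: rs_D.
  by move=> x; apply: is_deriveD; exact: rs_der.
Qed.

Lemma rsZ (k : R) f : rschwartz f -> rschwartz (fun x => k * f x).
Proof.
move=> hf; apply: (@rs_coind (fun h => exists2 f, rschwartz f & h = (fun x => k * f x))); last by exists f.
move=> _ [{hf}f hf ->]; split.
- by apply: continuous_mulr; [exact: cst_continuous|exact: (rs_cont hf)].
- move=> N; have [M h] := rs_bound N hf; exists (`|k| * M) => x.
  by rewrite normrM mulrCA ler_wpM2l.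
- move=> i; exists (fun x => k * DD i f x); first by exists (DD i f) => //; exact: rs_D.
  by move=> x; apply: is_deriveZ; exact: rs_der.
Qed.

Lemma rsN f : rschwartz f -> rschwartz (fun x => - f x).
Proof.
by move=> /(rsZ (-1)); rewrite (_ : (fun x => -1 * _) = (fun x => - f x))//;
  apply/funext => x; rewrite mulN1r.
Qed.

Lemma rs_mulcoord i f : rschwartz f -> rschwartz (fun x => x 0 i * f x).
Proof.
(* The functions [x_i f] are not stable under derivation, but the sums [x_i f + g] are; hence the
   null second term. *)
move=> hf; suff H : rschwartz (fun x => x 0 i * f x + 0 * f x).
  by move: H; congr rschwartz; apply/funext => x; rewrite mul0r addr0.
apply: (@rs_coind (fun h => exists f g, [/\ rschwartz f, rschwartz g & h = (fun x => x 0 i * f x + g x)]));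
  last by exists f, (fun x => 0 * f x); split => //; exact: rsZ.
move=> _ [{hf}f [g [hf hg ->]]]; split.
- apply: continuous_addr; last exact: (rs_cont hg).
  by apply: continuous_mulr; [exact: coord_continuous|exact: (rs_cont hf)].
- move=> N; have [M1 h1] := rs_bound N.+1 hf; have [M2 h2] := rs_bound N hg; exists (M1 + M2) => x.
  have p0 : 0 <= (1 + sqnorm x) ^+ N by rewrite exprn_ge0// ltW// sqnormD1_gt0.
  apply: (@le_trans _ _ ((1 + sqnorm x) ^+ N * ((1 + sqnorm x) * `|f x| + `|g x|))).
    rewrite ler_wpM2l// (le_trans (ler_normD _ _))// lerD2r normrM ler_wpM2r//.
    have := sqnorm_coord x i; rewrite -real_normK ?num_real// => h.
    by have := sqr_ge0 (`|x 0 i| - 1); nra.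
  by rewrite mulrDr mulrA -exprSr lerD.
- move=> j; exists (fun x : 'rV[R]_n => x 0 i * DD j f x + ((i == j)%:R * f x + DD j g x)).
    exists (DD j f), (fun x => (i == j)%:R * f x + DD j g x); split => //; first exact: rs_D.
    by apply: rsD; [exact: rsZ|exact: rs_D].
  move=> x; have d1 := is_derive_coord j i x; have d2 := rs_der j x hf; have d3 := rs_der j x hg.
  apply: is_derive_eq; rewrite addrA; congr (_ + _).
  by rewrite !/GRing.scale/= mulrC addrC mulrC [in LHS]mulrC; ring.
Qed.

End RealSchwartz.

(** * Partial transforms and Fourier inversion *)

Section TrigTransform.
Context {R : realType} (n : nat).
Local Notation lam := (@lebesgue_measure R).
Local Notation DD i f := (fun x => 'D_('e_i) f x).
Implicit Types (f g : 'rV[R]_n -> R) (b : bool) (i j : 'I_n) (x : 'rV[R]_n) (t y : R).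

(** Derivation flips the boolean, up to the sign [sg b], so that the cosine and sine transforms
    share their proofs. *)
Definition cs b t : R := if b then cos t else sin t.
Definition sg b : R := if b then -1 else 1.

Lemma is_derive_cs b t : is_derive t 1 (cs b) (sg b * cs (~~ b) t).
Proof.
case: b; rewrite /cs /sg /=; first by rewrite mulN1r; exact: is_derive_cos.
by rewrite mul1r; exact: is_derive_sin.
Qed.

Lemma cs_le1 b t : `|cs b t| <= 1.
Proof.
rewrite ler_norml; case: b; rewrite /cs.
  by rewrite cos_geN1 cos_le1.
by rewrite sin_geN1 sin_le1.
Qed.

Lemma continuous_cs b : continuous (cs b).
Proof. by case: b; [exact: continuous_cos|exact: continuous_sin]. Qed.

(** The real building block of the Fourier transform in one coordinate. The frequency takes the
    place of coordinate [i] of the same vector, so the result is again a function on R^n and can be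
    transformed in another coordinate. *)
Definition tr b i f x : R := rint lam setT (fun y : R => cs b (x 0 i * y) * f (upd x i y)).

(** Of N + 1 powers of decay, one is spent on the integration variable and N are left for the other
    coordinates. *)
Lemma rs_bound_upd f i (N : nat) : rschwartz f -> exists2 M : R, 0 <= M &
  forall x y, (1 + sqnorm (upd x i 0)) ^+ N * `|f (upd x i y)| <= M * (1 + y ^+ 2)^-1.
Proof.
move=> hf; have [M hM] := rs_bound N.+1 hf; exists M.
  by apply: le_trans (hM 0); rewrite mulr_ge0// exprn_ge0// ltW// sqnormD1_gt0.
move=> x y; rewrite ler_pdivlMr ?ltr_pwDl ?sqr_ge0//; apply: le_trans (hM (upd x i y)).
have h1 : sqnorm (upd x i 0) <= sqnorm (upd x i y).
  apply: ler_sum => j _; rewrite !upd_coord; case: eqP => // _.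
  by rewrite expr0n/= sqr_ge0.
have h2 : y ^+ 2 <= sqnorm (upd x i y).
  by have := sqnorm_coord (upd x i y) i; rewrite upd_coord eqxx.
rewrite (exprSr (1 + sqnorm (upd x i y))) mulrAC ler_wpM2r// ler_pM//.
- by rewrite exprn_ge0// ltW// sqnormD1_gt0.
- by rewrite addr_ge0// sqr_ge0.
- by rewrite lerXn2r// ?nnegrE ?(ltW (sqnormD1_gt0 _))// lerD2l.
- by rewrite lerD2l.
Qed.

Lemma rs_bound1 f i : rschwartz f -> exists2 M : R, 0 <= M &
  forall x y, `|f (upd x i y)| <= M * (1 + y ^+ 2)^-1.
Proof.
by move=> hf; have [M M0 h] := rs_bound_upd i 0 hf; exists M => // x y; have := h x y; rewrite expr0 mul1r.
Qed.

Lemma continuous_slice f x i : continuous f -> continuous (fun y => f (upd x i y)).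
Proof.
move=> cf y; apply: (@continuous_comp _ _ _ (upd x i) f); first exact: continuous_updy.
exact: cf.
Qed.

Lemma continuous_trfun b i f x : continuous f ->
  continuous (fun y : R => cs b (x 0 i * y) * f (upd x i y)).
Proof.
move=> cf; apply: continuous_mulr; last exact: continuous_slice.
move=> y; apply: (@continuous_comp _ _ _ (fun y => x 0 i * y) (cs b)); last exact: continuous_cs.
by apply: continuous_mulr; [exact: cst_continuous|move=> z; exact: cvg_id].
Qed.

Lemma itg_trfun b i f x : rschwartz f ->
  itg lam (fun y : R => cs b (x 0 i * y) * f (upd x i y)).
Proof.
move=> hf; have [M M0 hM] := rs_bound1 i hf.
apply: (itg_le _ (itgZ M itg_oneDsqrV)).
  by apply: continuous_measurable_fun; apply: continuous_trfun; exact: rs_cont.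
move=> y; rewrite normrM; apply: le_trans (hM x y).
by rewrite -[leRHS]mul1r ler_wpM2r// cs_le1.
Qed.

Lemma trD b i f g x : rschwartz f -> rschwartz g ->
  tr b i (fun z => f z + g z) x = tr b i f x + tr b i g x.
Proof.
move=> hf hg; rewrite /tr -rintD; [|exact: itg_trfun..].
by congr (rint _ _ _); apply/funext => y; rewrite mulrDr.
Qed.

Lemma trN b i f x : rschwartz f -> tr b i (fun z => - f z) x = - tr b i f x.
Proof.
move=> hf; rewrite /tr -rintN; last exact: itg_trfun.
by congr (rint _ _ _); apply/funext => y; rewrite mulrN.
Qed.

Lemma is_derive_upd f x i y : rschwartz f ->
  is_derive y 1 (fun y => f (upd x i y)) ('D_('e_i) f (upd x i y)).
Proof.
move=> hf; have E : (fun y => f (upd x i y)) = (fun t : R => f (t *: 'e_i + upd x i 0)).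
  by apply/funext => t; rewrite [in LHS]upd_line.
rewrite E [in X in is_derive _ _ _ X]upd_line; apply: line_is_derive.
by have [] := rs_der i (y *: 'e_i + upd x i 0) hf.
Qed.

Lemma cvg_oneDsqrV (u : nat -> R) (M : R) : (forall k, k%:R <= `|u k|) ->
  (M * (1 + u k ^+ 2)^-1) @[k --> \oo] --> (0 : R).
Proof.
move=> hu; rewrite -[X in _ --> X](mulr0 M); apply: cvgM; first exact: cvg_cst.
apply: (@squeeze_cvgr _ _ _ _ (fun=> 0) (fun k => (k.+1%:R)^-1)).
- apply: nearW => k; rewrite invr_ge0 addr_ge0 ?sqr_ge0//=.
  rewrite lef_pV2 ?posrE ?ltr_pwDl ?sqr_ge0// -natr1 addrC lerD2l.
  apply: (@le_trans _ _ (k%:R ^+ 2)).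
    by rewrite -natrX ler_nat; case: k => // k; rewrite expnS leq_pmulr// expn_gt0.
  by rewrite -[leRHS]real_normK ?num_real// lerXn2r// nnegrE.
- exact: cvg_cst.
- exact: cvg_harmonic.
Qed.

Lemma tr_parts b i f x : rschwartz f -> tr b i (DD i f) x = - (sg b * x 0 i) * tr (~~ b) i f x.
Proof.
move=> hf; pose F (y : R) := cs b (x 0 i * y) * f (upd x i y).
pose dF (y : R) := (sg b * x 0 i) * (cs (~~ b) (x 0 i * y) * f (upd x i y)) +
  cs b (x 0 i * y) * 'D_('e_i) f (upd x i y).
have Dfs := rs_D i hf.
have hd y : is_derive y 1 F (dF y).
  have d1 : is_derive y 1 (fun y => cs b (x 0 i * y)) (x 0 i * (sg b * cs (~~ b) (x 0 i * y))).
    have d0 := is_derive_cs b (x 0 i * y).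
    have d2 : is_derive y 1 (fun y => x 0 i * y) (x 0 i).
      by apply: is_derive_eq; rewrite /GRing.scale/= mulr1.
    apply: (@is_derive_eq _ _ _ _ _ _ _ _ (is_derive1_comp d0 d2)).
    by rewrite mulrC.
  have d2 := is_derive_upd x i y hf.
  apply: is_derive_eq; rewrite /dF /GRing.scale/=; ring.
have h0 : rint lam setT dF = 0.
  have [M M0 hM] := rs_bound1 i hf.
  have Fb y : `|F y| <= M * (1 + y ^+ 2)^-1.
    rewrite /F normrM; apply: le_trans (hM x y).
    by rewrite -[leRHS]mul1r ler_wpM2r// cs_le1.
  have Fc (u : nat -> R) : (forall k, k%:R <= `|u k|) -> F (u k) @[k --> \oo] --> (0 : R).
    move=> hu; apply/norm_cvg0P.
    apply: (@squeeze_cvgr _ _ _ _ (fun=> 0) (fun k => M * (1 + u k ^+ 2)^-1)).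
    - by apply: nearW => k; rewrite normr_ge0/= Fb.
    - exact: cvg_cst.
    - exact: cvg_oneDsqrV.
  apply: (rint_deriv0 hd).
  - apply: continuous_addr.
      apply: continuous_mulr; first exact: cst_continuous.
      by apply: continuous_trfun; exact: rs_cont.
    exact: (continuous_trfun (rs_cont Dfs)).
  - exact: (itgD (itgZ (sg b * x 0 i) (itg_trfun (~~ b) i x hf)) (itg_trfun b i x Dfs)).
  - by apply: Fc => k; rewrite ger0_norm.
  - by apply: Fc => k; rewrite normrN ger0_norm.
move: h0; rewrite /dF (rintD (itgZ (sg b * x 0 i) (itg_trfun (~~ b) i x hf)) (itg_trfun b i x Dfs)).
rewrite (rintZ _ (itg_trfun (~~ b) i x hf)).
by move=> /eqP; rewrite addrC addr_eq0 -mulNr => /eqP.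
Qed.

Lemma tr_parts2 b i f x : rschwartz f -> tr b i (DD i (DD i f)) x = - (x 0 i ^+ 2) * tr b i f x.
Proof.
move=> hf; rewrite tr_parts; last exact: rs_D.
by rewrite tr_parts// negbK; case: b; rewrite /sg /=; ring.
Qed.

Lemma is_derive_tr_neq b i j f x : rschwartz f -> i != j ->
  is_derive x 'e_j (tr b i f) (tr b i (DD j f) x).
Proof.
move=> hf ij; apply: is_derive_line.
have [M M0 hM] := rs_bound1 i (rs_D j hf).
have E (t : R) : tr b i f (t *: 'e_j + x) =
    rint lam setT (fun y : R => cs b (x 0 i * y) * f (t *: 'e_j + upd x i y)).
  congr (rint _ _ _); apply/funext => y; rewrite upd_e_neq// e_coord.
  by rewrite (negbTE ij).
under eq_fun do rewrite E.
rewrite /tr (_ : (fun y : R => _ * 'D_'e_j f (upd x i y)) = (fun y : R =>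
  cs b (x 0 i * y) * 'D_'e_j f ((0 : R) *: 'e_j + upd x i y))); last first.
  by apply/funext => y; rewrite scale0r add0r.
apply: (@is_derive_rint _ _ _ lam (fun t y => cs b (x 0 i * y) * f (t *: 'e_j + upd x i y))
  (fun t y => cs b (x 0 i * y) * 'D_('e_j) f (t *: 'e_j + upd x i y)) (fun y => M * (1 + y ^+ 2)^-1)).
- move=> t; have := itg_trfun b i (t *: 'e_j + x) hf.
  by congr itg; apply/funext => y; rewrite upd_e_neq// e_coord (negbTE ij).
- move=> t y; have d := @line_is_derive _ _ f (upd x i y) 'e_j t.
  have {}d : is_derive t 1 (fun t0 : R => f (t0 *: 'e_j + upd x i y))
     ('D_'e_j f (t *: 'e_j + upd x i y)).
    by apply: d; have [] := rs_der j (t *: 'e_j + upd x i y) hf.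
  exact: is_deriveZ.
- exact: (itgZ M itg_oneDsqrV).
- move=> t y; rewrite -upd_e_neq// normrM; apply: le_trans (hM (t *: 'e_j + x) y).
  by rewrite -[leRHS]mul1r ler_wpM2r// cs_le1.
Qed.

Lemma is_derive_tr_eq b i f x : rschwartz f ->
  is_derive x 'e_i (tr b i f) (sg b * tr (~~ b) i (fun z => z 0 i * f z) x).
Proof.
move=> hf; apply: is_derive_line.
have hxf := rs_mulcoord i hf.
have [M M0 hM] := rs_bound1 i hxf.
have E (t : R) : tr b i f (t *: 'e_i + x) =
    rint lam setT (fun y : R => cs b ((t + x 0 i) * y) * f (upd x i y)).
  congr (rint _ _ _); apply/funext => y; rewrite upd_e_eq e_coord.
  by rewrite eqxx.
under eq_fun do rewrite E.
rewrite /tr -(rintZ (sg b) (itg_trfun (~~ b) i x hxf)).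
rewrite (_ : (fun y : R => sg b * _) = (fun y : R =>
  sg b * (cs (~~ b) ((0 + x 0 i) * y) * (y * f (upd x i y))))); last first.
  by apply/funext => y; rewrite add0r upd_coord eqxx.
apply: (@is_derive_rint _ _ _ lam (fun t y => cs b ((t + x 0 i) * y) * f (upd x i y))
  (fun t y => sg b * (cs (~~ b) ((t + x 0 i) * y) * (y * f (upd x i y)))) (fun y => M * (1 + y ^+ 2)^-1)).
- move=> t; have := itg_trfun b i (t *: 'e_i + x) hf.
  by congr itg; apply/funext => y; rewrite upd_e_eq e_coord eqxx.
- move=> t y.
  have d0 := is_derive_cs b ((t + x 0 i) * y).
  have d2 : is_derive t 1 (fun t => (t + x 0 i) * y) y.
    by apply: is_derive_eq; rewrite /GRing.scale/= addr0 mulr1 mulr0 add0r.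
  have d3 := @is_derive1_comp R (cs b) (fun t : R => (t + x 0 i) * y) t _ _ d0 d2.
  apply: (@is_derive_eq _ _ _ (fun t => cs b ((t + x 0 i) * y) * f (upd x i y))).
  by rewrite /GRing.scale/=; ring.
- exact: (itgZ M itg_oneDsqrV).
- move=> t y; rewrite normrM (_ : `|sg b| = 1); last first.
    by case: (b); rewrite /sg ?normrN normr1.
  rewrite mul1r normrM; apply: le_trans (hM x y).
  rewrite upd_coord eqxx -[leRHS]mul1r ler_wpM2r// cs_le1//.
Qed.

Lemma continuous_tr b i f : rschwartz f -> continuous (tr b i f).
Proof.
move=> hf; have [M M0 hM] := rs_bound1 i hf.
apply: (@rint_continuous _ _ _ lam _ (fun x y => cs b (x 0 i * y) * f (upd x i y)) (fun y => M * (1 + y ^+ 2)^-1)).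
- by move=> x; exact: (itg_meas (itg_trfun b i x hf)).
- move=> y; apply: continuous_mulr.
    move=> x; apply: (@continuous_comp _ _ _ (fun x : 'rV[R]_n => x 0 i * y) (cs b)); last exact: continuous_cs.
    by apply: continuous_mulr; [exact: coord_continuous|exact: cst_continuous].
  move=> x; apply: (@continuous_comp _ _ _ (fun x => upd x i y) f); first exact: continuous_updx.
  exact: rs_cont.
- exact: (itgZ M itg_oneDsqrV).
- move=> x y; rewrite normrM; apply: le_trans (hM x y).
  by rewrite -[leRHS]mul1r ler_wpM2r// cs_le1.
Qed.

(** The operator [L = 1 - d_i^2] multiplies the transform by 1 + x_i^2. Applying it N times gives
    decay in the frequency [x_i], the Schwartz bound on [L^N f] gives decay in the other
    coordinates, and 1 + |x|^2 is at most the product of the two weights. *)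
Lemma tr_decay b i f N : rschwartz f -> exists M, forall x, (1 + sqnorm x) ^+ N * `|tr b i f x| <= M.
Proof.
move=> hf.
pose L f := fun z => f z + - DD i (DD i f) z.
have LS h : rschwartz h -> rschwartz (L h).
  by move=> hh; apply: rsD => //; apply: rsN; do 2 apply: rs_D.
have LN k : rschwartz (iter k L f) by elim: k => //= k; exact: LS.
have LE k x : tr b i (iter k L f) x = (1 + x 0 i ^+ 2) ^+ k * tr b i f x.
  elim: k => [|k IH]; first by rewrite mul1r.
  rewrite /= {1}/L trD//; last by apply: rsN; do 2 apply: rs_D.
  rewrite trN; last by do 2 apply: rs_D.
  by rewrite tr_parts2// IH (exprS (1 + x 0 i ^+ 2)); move: (_ ^+ k) (tr b i f x) => u v; ring.
have [M M0 hM] := rs_bound_upd i N (LN N).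
exists (M * rint lam setT (fun y : R => (1 + y ^+ 2)^-1)) => x.
have h1 : 1 + sqnorm x <= (1 + x 0 i ^+ 2) * (1 + sqnorm (upd x i 0)).
  have : sqnorm x <= x 0 i ^+ 2 + sqnorm (upd x i 0).
    rewrite /sqnorm (bigD1 i)//= lerD2l [leRHS](bigD1 i)//= upd_coord eqxx expr0n/= add0r.
    by apply: ler_sum => j ji; rewrite upd_coord (negbTE ji).
  by have := sqnorm_ge0 (upd x i 0); have := sqr_ge0 (x 0 i); nra.
have u0 : 0 <= (1 + sqnorm (upd x i 0)) ^+ N by rewrite exprn_ge0// ltW// sqnormD1_gt0.
apply: (@le_trans _ _ ((1 + sqnorm (upd x i 0)) ^+ N * `|tr b i (iter N L f) x|)).
  rewrite LE normrM [X in _ * (X * _)]ger0_norm ?exprn_ge0 ?addr_ge0 ?sqr_ge0// mulrA -exprMn ler_wpM2r//.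
  rewrite lerXn2r// ?nnegrE ?(ltW (sqnormD1_gt0 _))//.
    by rewrite mulr_ge0 ?addr_ge0 ?sqr_ge0 ?sqnorm_ge0.
  by rewrite [leRHS]mulrC.
rewrite -(rintZ _ itg_oneDsqrV) -[X in X * _]ger0_norm// -normrM -(rintZ _ (itg_trfun b i x (LN N))).
apply: (le_trans (ler_norm_rint (itgZ _ (itg_trfun b i x (LN N))))).
apply: ler_rint.
- by apply: itg_norm; apply: itgZ; exact: itg_trfun.
- exact: (itgZ M itg_oneDsqrV).
- move=> y; apply: le_trans (hM x y).
  rewrite normrM ger0_norm// ler_wpM2l// normrM -[leRHS]mul1r ler_wpM2r// cs_le1//.
Qed.

(** Derivation in coordinate [i] exchanges cosine and sine transforms, so the class that is stable
    under all derivatives consists of sums of one of each. *)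
Lemma rs_tr2 i f g : rschwartz f -> rschwartz g ->
  rschwartz (fun x => tr true i f x + tr false i g x).
Proof.
move=> hf hg; apply: (@rs_coind _ _ (fun h => exists f g,
  [/\ rschwartz f, rschwartz g & h = (fun x => tr true i f x + tr false i g x)])); last by exists f, g.
move=> _ [{hf}f [{hg}g [hf hg ->]]]; split.
- by apply: continuous_addr; exact: continuous_tr.
- move=> N; have [M1 h1] := tr_decay true i N hf; have [M2 h2] := tr_decay false i N hg.
  exists (M1 + M2) => x.
  apply: (@le_trans _ _ ((1 + sqnorm x) ^+ N * (`|tr true i f x| + `|tr false i g x|))).
    by rewrite ler_wpM2l ?exprn_ge0 ?(ltW (sqnormD1_gt0 _))// ler_normD.
  by rewrite mulrDr lerD.
- move=> j; have [<-|ij] := eqVneq i j.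
    exists (fun x => tr true i (fun z => z 0 i * g z) x + tr false i (fun z => - (z 0 i * f z)) x).
      exists (fun z : 'rV[R]_n => z 0 i * g z), (fun z : 'rV[R]_n => - (z 0 i * f z)); split => //; first exact: rs_mulcoord.
      by apply: rsN; exact: rs_mulcoord.
    move=> x; have d1 := is_derive_tr_eq true i x hf; have d2 := is_derive_tr_eq false i x hg.
    apply: is_derive_eq; rewrite trN; last exact: rs_mulcoord.
    by rewrite /sg /=; ring.
  exists (fun x => tr true i (DD j f) x + tr false i (DD j g) x).
    by exists (DD j f), (DD j g); split => //; exact: rs_D.
  by move=> x; apply: is_deriveD; exact: is_derive_tr_neq.
Qed.

Lemma rs_tr b i f : rschwartz f -> rschwartz (tr b i f).
Proof.
move=> hf; have h0 : rschwartz (fun x => 0 * f x) := rsZ 0 hf.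
have z b' x : tr b' i (fun x => 0 * f x) x = 0.
  by rewrite /tr -[RHS](rint0 lam); congr (rint _ _ _); apply/funext => y; rewrite mul0r mulr0.
case: b.
  by have := rs_tr2 i hf h0; congr rschwartz; apply/funext => x; rewrite z addr0.
by have := rs_tr2 i h0 hf; congr rschwartz; apply/funext => x; rewrite z add0r.
Qed.

End TrigTransform.

(** * Gaussian integrals and the transform of a Gaussian *)

Section GaussianTransform.
Context {R : realType}.
Local Notation lam := (@lebesgue_measure R).
Implicit Types (m s u v a x y t : R) (b : bool).
Local Notation nf := normal_fun.

Definition nfmass s : R := Num.sqrt (s ^+ 2 * pi *+ 2).

(** A Gaussian of width s transforms into [nfmass s] times one of width 1/s. This product of masses
    is the 2 pi of the inversion formula. *)
Lemma nfmassV s : 0 < s -> nfmass s * nfmass s^-1 = 2 * pi.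
Proof.
move=> s0; rewrite /nfmass -sqrtrM; last by rewrite mulrn_wge0// mulr_ge0 ?sqr_ge0// pi_ge0.
rewrite [X in Num.sqrt X](_ : _ = (2 * pi) ^+ 2); last by field; rewrite gt_eqF.
by rewrite sqrtr_sqr ger0_norm// mulr_ge0// pi_ge0.
Qed.

Lemma nf_ge0 m s y : 0 <= nf m s y. Proof. exact: expR_ge0. Qed.

Lemma nf_pdf m s : 0 < s -> nf m s = (fun x => nfmass s * normal_pdf m s x).
Proof.
move=> s0; have sn0 : s != 0 by rewrite gt_eqF.
apply/funext => x; rewrite normal_pdfE// /normal_peak /nfmass mulrA divff ?mul1r//.
by rewrite gt_eqF// sqrtr_gt0 mulrn_wgt0// mulr_gt0 ?exprn_gt0 ?pi_gt0.
Qed.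

Lemma itg_nf m s : 0 < s -> itg lam (nf m s).
Proof. by move=> s0; rewrite nf_pdf//; apply: itgZ; exact: integrable_normal_pdf. Qed.

Lemma rint_nf m s : 0 < s -> rint lam setT (nf m s) = nfmass s.
Proof.
move=> s0; rewrite nf_pdf// rintZ; last exact: integrable_normal_pdf.
by rewrite /rint integral_normal_pdf mulr1.
Qed.

Lemma nf_bound m s : 0 < s -> exists2 C : R, 0 <= C &
  forall y, (1 + (y - m) ^+ 2) * nf m s y <= C * (1 + y ^+ 2)^-1.
Proof.
(* The factors come from 1 + y^2 <= 2 (1 + m^2) (1 + (y - m)^2) and from 1 + (y - m)^2 <= (1 + 4
   s^2) (1 + t/2), squared, where exp(-t) is the value of the Gaussian and exp(-t) <= (1 +
   t/2)^(-2). *)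
move=> s0; exists (2 * (1 + m ^+ 2) * (1 + 4 * s ^+ 2) ^+ 2).
  have := sqr_ge0 m; have := sqr_ge0 (1 + 4 * s ^+ 2); nra.
move=> y; set t := (y - m) ^+ 2 / (s ^+ 2 *+ 2).
have t0 : 0 <= t by rewrite divr_ge0 ?sqr_ge0// mulrn_wge0// sqr_ge0.
have E : (y - m) ^+ 2 = 2 * s ^+ 2 * t by rewrite /t; field; rewrite gt_eqF.
have e1 : nf m s y <= ((1 + t / 2) ^+ 2)^-1.
  rewrite /nf mulNr -/t expRN lef_pV2 ?posrE ?expR_gt0//; last first.
    by rewrite exprn_gt0// ltr_pwDl// divr_ge0.
  rewrite [t in expR t](_ : t = t / 2 *+ 2); last by field.
  rewrite mulr2n expRD -expr2 lerXn2r ?nnegrE ?expR_ge0 ?expR_ge1Dx//.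
  by rewrite addr_ge0// divr_ge0.
have ss := sqr_ge0 s.
have h1 : 1 + (y - m) ^+ 2 <= (1 + 4 * s ^+ 2) * (1 + t / 2) by rewrite E; nra.
have h2 : 1 + y ^+ 2 <= 2 * (1 + m ^+ 2) * (1 + (y - m) ^+ 2).
  by have := sqr_ge0 m; have := sqr_ge0 (y - m); have := sqr_ge0 (y - 2 * m); have := sqr_ge0 (m * (y - m)); nra.
have p0 : 0 < 1 + t / 2 by rewrite ltr_pwDl// divr_ge0.
rewrite ler_pdivlMr ?ltr_pwDl ?sqr_ge0//.
have q0 : 0 <= 1 + (y - m) ^+ 2 by rewrite addr_ge0// sqr_ge0.
have m0 : 0 <= 2 * (1 + m ^+ 2) by have := sqr_ge0 m; nra.
apply: (@le_trans _ _ ((1 + (y - m) ^+ 2) * nf m s y * (2 * (1 + m ^+ 2) * (1 + (y - m) ^+ 2)))).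
  by rewrite ler_wpM2l// mulr_ge0// nf_ge0.
rewrite (_ : _ * _ * (_ * _) = 2 * (1 + m ^+ 2) * ((1 + (y - m) ^+ 2) ^+ 2 * nf m s y)); last by ring.
rewrite ler_wpM2l//.
apply: (@le_trans _ _ (((1 + 4 * s ^+ 2) * (1 + t / 2)) ^+ 2 * ((1 + t / 2) ^+ 2)^-1)).
  rewrite ler_pM ?nf_ge0 ?exprn_ge0// lerXn2r// ?nnegrE//.
  exact: le_trans h1.
by rewrite exprMn mulfK// gt_eqF// exprn_gt0.
Qed.

Lemma is_derive_nf m s y : 0 < s -> is_derive y 1 (nf m s) (- ((y - m) / s ^+ 2) * nf m s y).
Proof.
move=> s0.
have d0 : is_derive (- (y - m) ^+ 2 / (s ^+ 2 *+ 2)) 1 expR (nf m s y) by exact: is_derive_expR.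
have d1 : is_derive y 1 (fun y => - (y - m) ^+ 2 / (s ^+ 2 *+ 2)) (- ((y - m) / s ^+ 2)).
  apply: is_derive_eq; rewrite /GRing.scale/=; field; by rewrite gt_eqF.
have := @is_derive1_comp R expR (fun y => - (y - m) ^+ 2 / (s ^+ 2 *+ 2)) y _ _ d0 d1.
by rewrite mulrC.
Qed.

Lemma continuous_nf m s : 0 < s -> continuous (nf m s).
Proof. by move=> s0 y; exact: is_derive_cont (is_derive_nf m y s0). Qed.

Lemma nf_cvg0 m s (F : R -> R) (u : nat -> R) : 0 < s ->
  (forall y, `|F y| <= (1 + (y - m) ^+ 2) * nf m s y) -> (forall k, k%:R <= `|u k|) ->
  F (u k) @[k --> \oo] --> (0 : R).
Proof.
move=> s0 Fb hu; have [C C0 hC] := nf_bound m s0; apply/norm_cvg0P.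
apply: (@squeeze_cvgr _ _ _ _ (fun=> 0) (fun k => C * (1 + u k ^+ 2)^-1)).
- by apply: nearW => k; rewrite normr_ge0/= (le_trans (Fb _)).
- exact: cvg_cst.
- exact: cvg_oneDsqrV.
Qed.

Lemma itg_nf_le m s (F : R -> R) : 0 < s -> continuous F ->
  (forall y, `|F y| <= (1 + (y - m) ^+ 2) * nf m s y) -> itg lam F.
Proof.
move=> s0 cF Fb; have [C C0 hC] := nf_bound m s0.
apply: (itg_le _ (itgZ C itg_oneDsqrV)); first exact: continuous_measurable_fun.
by move=> y; apply: le_trans (hC y).
Qed.

Lemma norm_le1Dsqr t : `|t| <= 1 + t ^+ 2.
Proof. by rewrite -[t ^+ 2]real_normK ?num_real//; have := sqr_ge0 (`|t| - 1); nra. Qed.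

Lemma continuous_subr_cst m : continuous (fun y => y - m).
Proof.
by apply: continuous_addr => [z|]; [exact: cvg_id|exact: cst_continuous].
Qed.

Lemma rint_nf_var m s : 0 < s ->
  itg lam (fun y => (y - m) ^+ 2 * nf m s y) /\
  rint lam setT (fun y => (y - m) ^+ 2 * nf m s y) = s ^+ 2 * nfmass s.
Proof.
move=> s0; have cn := @continuous_nf m s s0; have cm := @continuous_subr_cst m.
have i1 : itg lam (fun y => (y - m) ^+ 2 * nf m s y).
  apply: (itg_nf_le (m := m) s0).
    by apply: continuous_mulr => //; rewrite /GRing.exp/=; exact: continuous_mulr.
  move=> y; rewrite ger0_norm; last by apply: mulr_ge0; [exact: sqr_ge0|exact: nf_ge0].
  by apply: ler_wpM2r; [exact: nf_ge0|rewrite lerDr].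
split => //.
(* The derivative of [F] is the Gaussian minus s^(-2) (y - m)^2 times the Gaussian, so its null
   integral gives the variance. *)
pose F y := (y - m) * nf m s y.
pose f y := nf m s y - (s ^+ 2)^-1 * ((y - m) ^+ 2 * nf m s y).
have hd y : is_derive y 1 F (f y).
  have d := is_derive_nf m y s0.
  apply: is_derive_eq; rewrite /f /GRing.scale/=; field; by rewrite gt_eqF.
have Fb y : `|F y| <= (1 + (y - m) ^+ 2) * nf m s y.
  rewrite normrM (ger0_norm (nf_ge0 _ _ _)) ler_wpM2r ?nf_ge0//; exact: norm_le1Dsqr.
have : rint lam setT f = 0.
  apply: (rint_deriv0 hd).
  - rewrite /f; apply: continuous_addr => //; apply: continuous_oppr.
    apply: continuous_mulr; first exact: cst_continuous.
    by apply: continuous_mulr => //; rewrite /GRing.exp/=; exact: continuous_mulr.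
  - exact: (itgB (itg_nf m s0) (itgZ (s ^+ 2)^-1 i1)).
  - by apply: (nf_cvg0 s0 Fb) => k; rewrite ger0_norm.
  - by apply: (nf_cvg0 s0 Fb) => k; rewrite normrN ger0_norm.
rewrite /f (rintB (itg_nf m s0) (itgZ (s ^+ 2)^-1 i1)) (rintZ _ i1) rint_nf//.
by move/eqP; rewrite subr_eq0 => /eqP ->; rewrite mulrA divff ?mul1r// gt_eqF// exprn_gt0.
Qed.

Definition gaussK b s u : R := rint lam setT (fun a : R => cs b (u * a) * nf 0 s a).

Lemma continuous_csM b u : continuous (fun a : R => cs b (u * a)).
Proof.
move=> y; apply: (@continuous_comp _ _ _ (fun y => u * y) (cs b)); last exact: continuous_cs.
by apply: continuous_mulr; [exact: cst_continuous|move=> z; exact: cvg_id].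
Qed.

Lemma is_derive_csM b u (a : R) : is_derive a 1 (fun a : R => cs b (u * a)) (u * (sg b * cs (~~ b) (u * a))).
Proof.
have d0 := is_derive_cs b (u * a).
have d2 : is_derive a 1 (fun y => u * y) u.
  by apply: is_derive_eq; rewrite /GRing.scale/= mulr1.
apply: (@is_derive_eq _ _ _ _ _ _ _ _ (@is_derive1_comp R (cs b) (fun y => u * y) a _ _ d0 d2)).
by rewrite mulrC.
Qed.

Lemma itg_csnf b s u (p : R -> R) : 0 < s -> continuous p -> (forall a, `|p a| <= 1 + a ^+ 2) ->
  itg lam (fun a => cs b (u * a) * (p a * nf 0 s a)).
Proof.
move=> s0 cp hp; apply: (itg_nf_le (m := 0) s0).
  apply: continuous_mulr; first exact: continuous_csM.
  by apply: continuous_mulr => //; exact: continuous_nf.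
move=> a; rewrite !normrM (ger0_norm (nf_ge0 _ _ _)) mulrA ler_wpM2r ?nf_ge0// subr0.
by rewrite -[leRHS]mul1r ler_pM ?cs_le1.
Qed.

Lemma itg_gaussK b s u : 0 < s -> itg lam (fun a : R => cs b (u * a) * nf 0 s a).
Proof.
move=> s0; have c1 : continuous (fun _ : R => 1 : R) by exact: cst_continuous.
have := itg_csnf b u s0 c1.
under eq_fun do rewrite mul1r.
by apply => a; rewrite normr1 lerDl sqr_ge0.
Qed.

(** Derivation under the integral brings down a factor [a], and [a] times the Gaussian is - s^2
    times its derivative. Integrating by parts flips the boolean back and leaves the linear equation
    that [gaussKE] solves. *)
Lemma is_derive_gaussK b s u : 0 < s -> is_derive u 1 (gaussK b s) (- (s ^+ 2 * u) * gaussK b s u).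
Proof.
move=> s0.
have cid : continuous (fun a : R => a) by move=> z; exact: cvg_id.
have i1 b' u' : itg lam (fun a => cs b' (u' * a) * (a * nf 0 s a)).
  by apply: itg_csnf => // a; exact: norm_le1Dsqr.
have P1 : rint lam setT (fun a : R => cs (~~ b) (u * a) * (a * nf 0 s a)) = s ^+ 2 * (u * sg (~~ b)) * gaussK b s u.
  pose F a := cs (~~ b) (u * a) * nf 0 s a.
  pose f a := (u * sg (~~ b)) * (cs b (u * a) * nf 0 s a) - (s ^+ 2)^-1 * (cs (~~ b) (u * a) * (a * nf 0 s a)).
  have hd a : is_derive a 1 F (f a).
    have d := is_derive_nf 0 a s0; have d' := is_derive_csM (~~ b) u a.
    apply: is_derive_eq; rewrite negbK subr0 /f /GRing.scale/=; field; by rewrite gt_eqF.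
  have Fb a : `|F a| <= (1 + (a - 0) ^+ 2) * nf 0 s a.
    rewrite normrM (ger0_norm (nf_ge0 _ _ _)) ler_wpM2r ?nf_ge0//.
    by rewrite (le_trans (cs_le1 _ _))// lerDl sqr_ge0.
  have : rint lam setT f = 0.
    apply: (rint_deriv0 hd).
    - rewrite /f; apply: continuous_addr.
        apply: continuous_mulr; first exact: cst_continuous.
        by apply: continuous_mulr; [exact: continuous_csM|exact: continuous_nf].
      apply: continuous_oppr; apply: continuous_mulr; first exact: cst_continuous.
      apply: continuous_mulr; first exact: continuous_csM.
      by apply: continuous_mulr => //; exact: continuous_nf.
    - exact: (itgB (itgZ (u * sg (~~ b)) (itg_gaussK b u s0)) (itgZ (s ^+ 2)^-1 (i1 (~~ b) u))).
    - by apply: (nf_cvg0 s0 Fb) => k; rewrite ger0_norm.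
    - by apply: (nf_cvg0 s0 Fb) => k; rewrite normrN ger0_norm.
  rewrite /f (rintB (itgZ (u * sg (~~ b)) (itg_gaussK b u s0)) (itgZ (s ^+ 2)^-1 (i1 (~~ b) u))).
  rewrite (rintZ _ (itg_gaussK b u s0)) (rintZ _ (i1 (~~ b) u)).
  move/eqP; rewrite subr_eq0 => /eqP h; rewrite -[RHS]mulrA; rewrite -/(gaussK b s u) in h.
  by rewrite h mulrA divff ?mul1r// gt_eqF// exprn_gt0.
have [C C0 hC] := nf_bound 0 s0.
have D := @is_derive_rint R _ _ lam (fun u a => cs b (u * a) * nf 0 s a)
  (fun u a => sg b * (cs (~~ b) (u * a) * (a * nf 0 s a))) (fun a => C * (1 + a ^+ 2)^-1) u.
apply: (@is_derive_eq _ _ _ _ _ _ _ _ (D _ _ _ _)).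
- by move=> v; exact: itg_gaussK.
- move=> v a; have d := is_derive_csM b a v.
  have E : (fun v => cs b (v * a)) = (fun v => cs b (a * v)) by apply/funext => w; rewrite mulrC.
  rewrite -E in d; apply: is_derive_eq; rewrite /GRing.scale/= mulr0 add0r (mulrC a v); ring.
- exact: (itgZ C itg_oneDsqrV).
- move=> v a; apply: le_trans (hC a); rewrite normrM (_ : `|sg b| = 1); last first.
    by case: (b); rewrite /sg ?normrN normr1.
  rewrite mul1r !normrM (ger0_norm (nf_ge0 _ _ _)) mulrA ler_wpM2r ?nf_ge0// subr0.
  by rewrite -[leRHS]mul1r ler_pM ?cs_le1//; exact: norm_le1Dsqr.
- by rewrite (rintZ _ (i1 (~~ b) u)) P1; case: (b); rewrite /sg /=; ring.
Qed.

Lemma gaussKE b s u : 0 < s -> gaussK b s u = gaussK b s 0 * expR (- (s ^+ 2 * u ^+ 2 / 2)).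
Proof.
move=> s0.
pose E v := expR (s ^+ 2 * v ^+ 2 / 2).
have hE v : is_derive v 1 E (s ^+ 2 * v * E v).
  have d0 : is_derive (s ^+ 2 * v ^+ 2 / 2) 1 expR (E v) by exact: is_derive_expR.
  have d1 : is_derive v 1 (fun v => s ^+ 2 * v ^+ 2 / 2) (s ^+ 2 * v).
    by apply: is_derive_eq; rewrite /GRing.scale/=; field.
  by have := @is_derive1_comp R expR (fun v => s ^+ 2 * v ^+ 2 / 2) v _ _ d0 d1; rewrite mulrC.
have hd (v : R) : is_derive v 1 (fun v => gaussK b s v * E v) 0.
  have d1 := is_derive_gaussK b v s0; have d2 := hE v.
  by apply: is_derive_eq; rewrite /GRing.scale/=; ring.
have := is_derive_0_is_cst u 0 hd; rewrite /E expr0n/= mulr0 mul0r expR0 mulr1 => <-.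
by rewrite -mulrA -expRD addrN expR0 mulr1.
Qed.

Lemma gaussK_false s u : 0 < s -> gaussK false s u = 0.
Proof.
move=> s0; rewrite gaussKE// (_ : gaussK false s 0 = 0) ?mul0r//.
rewrite /gaussK -[RHS](rint0 lam); congr (rint _ _ _); apply/funext => a.
by rewrite /cs mul0r sin0 mul0r.
Qed.

Lemma gaussK_true s u : 0 < s -> gaussK true s u = nfmass s * expR (- (s ^+ 2 * u ^+ 2 / 2)).
Proof.
move=> s0; rewrite gaussKE//; congr (_ * _).
rewrite -(rint_nf 0 s0) /gaussK; congr (rint _ _ _); apply/funext => a.
by rewrite /cs mul0r cos0 mul1r.
Qed.

End GaussianTransform.

(** * Inversion on the line by Gaussian mollification *)

Section FourierInversion1.
Context {R : realType}.
Local Notation lam := (@lebesgue_measure R).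
Implicit Types (a x y s e : R) (h : R -> R[i]).
Local Notation nf := normal_fun.

Lemma cmeas_comp (d1 d2 : measure_display) (T1 : measurableType d1) (T2 : measurableType d2)
  (f : T2 -> R[i]) (p : T1 -> T2) : cmeas f -> measurable_fun setT p -> cmeas (fun t => f (p t)).
Proof. by move=> [f1 f2] mp; split; [exact: (measurableT_comp f1 mp)|exact: (measurableT_comp f2 mp)]. Qed.

Lemma normcB_le (z w : R[i]) : normc (z - w) <= normc z + normc w.
Proof. by apply: (le_trans (le_normcD _ _)); rewrite normcN. Qed.

Lemma normc_cvg0 (z : R[i]) (u : nat -> R) : (forall n, normc z <= u n) ->
  u n @[n --> \oo] --> (0 : R) -> z = 0.
Proof.
move=> h u0; apply: ComplexField.Normc.eq0_normc; apply/eqP; rewrite eq_le normc_ge0 andbT.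
rewrite leNgt; apply/negP => z0.
have /cvgrPdist_lt/(_ _ z0) [N _ /(_ N (leqnn N))] := u0.
rewrite /= sub0r normrN => /(le_lt_trans (ler_norm _)); rewrite ltNge => /negP; apply; exact: h.
Qed.

(** The regularity of the one-variable slices of functions in C_FD: integrable, bounded and
    continuous, which is what inversion on the line uses. *)
Definition lone h := [/\ continuous (fun y => re (h y)), continuous (fun y => im (h y)) &
  exists2 M : R, 0 <= M & forall y, normc (h y) <= M * (1 + y ^+ 2)^-1].

Lemma lone_citg h : lone h -> citg lam h.
Proof.
move=> [c1 c2 [M M0 hM]]; apply: (citg_le _ (itgZ M itg_oneDsqrV) hM).
by split; exact: continuous_measurable_fun.
Qed.

(** [e] is the sign of the exponent, 1 or -1, so that one proof covers the transform and its
    inverse. *)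
Definition ft1 e h a : R[i] := lint lam setT (fun y : R => expi (e * a * y) * h y).

Lemma measurable_mulrl a : measurable_fun setT (fun y => a * y).
Proof. by apply: measurable_funM => //; exact: measurable_cst. Qed.

Lemma citg_expi h (c : R) : citg lam h -> citg lam (fun y : R => expi (c * y) * h y).
Proof.
move=> hi; apply: (citg_le _ (citg_normc hi)).
  apply: cmeasM; last exact: (citg_meas hi).
  by apply: cmeas_expi; exact: measurable_mulrl.
by move=> y; rewrite ComplexField.Normc.normcM normc_expi mul1r.
Qed.

Lemma gaussK_lint s u : 0 < s ->
  lint lam setT (fun a : R => (nf 0 s a)%:C * expi (u * a)) = (nfmass s * expR (- (s ^+ 2 * u ^+ 2 / 2)))%:C.
Proof.
move=> s0; rewrite -(gaussK_true u s0); apply: eqC.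
  rewrite re_lint /=; congr (rint _ _ _); apply/funext => a.
  by rewrite /cs; ring.
rewrite im_lint /=; transitivity (gaussK false s u); last exact: gaussK_false.
congr (rint _ _ _); apply/funext => a.
by rewrite /cs; ring.
Qed.

(** The kernel [K n] has mass 2 pi and second moment 2 pi / (n+1)^2 around [x]. As in Chebyshev's
    inequality, a bound of |h y - h x| by [eta + C (y - x)^2] is integrated against it. *)
Lemma approx_identity h x : lone h -> exists (u : nat -> R), u n @[n --> \oo] --> (0 : R) /\
  forall n, normc (lint lam setT (fun y : R => (nfmass n.+1%:R * nf x (n.+1%:R)^-1 y)%:C * h y) -
     (2 * pi)%:C * h x) <= u n.
Proof.
move=> lh; have [c1 c2 [M M0 hM]] := lh.
pose K (n : nat) (y : R) := nfmass n.+1%:R * nf x (n.+1%:R)^-1 y.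
have sp n : 0 < n.+1%:R^-1 :> R by rewrite invr_gt0.
have Kge0 n y : 0 <= K n y by rewrite mulr_ge0 ?nf_ge0// sqrtr_ge0.
have Ki n : itg lam (K n) by exact: (itgZ _ (itg_nf x (sp n))).
have Kint n : rint lam setT (K n) = 2 * pi by rewrite (rintZ _ (itg_nf x (sp n))) rint_nf// nfmassV.
have Kvi n : itg lam (fun y => (y - x) ^+ 2 * K n y).
  have := itgZ (nfmass n.+1%:R) (rint_nf_var x (sp n)).1.
  by congr itg; apply/funext => y; rewrite mulrCA.
have Kvar n : rint lam setT (fun y => (y - x) ^+ 2 * K n y) = 2 * pi * (n.+1%:R^-1) ^+ 2.
  transitivity (rint lam setT (fun y => nfmass n.+1%:R * ((y - x) ^+ 2 * nf x (n.+1%:R)^-1 y))).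
    by congr (rint _ _ _); apply/funext => y; rewrite mulrCA.
  rewrite (rintZ _ (rint_nf_var x (sp n)).1) (rint_nf_var x (sp n)).2 mulrCA nfmassV//.
  by rewrite mulrC.
have Kh n : citg lam (fun y => (K n y)%:C * h y).
  apply: (citg_le _ (itgZ M (Ki n))).
    apply: cmeasM; last exact: (citg_meas (lone_citg lh)).
    by apply: cmeas_real; exact: itg_meas (Ki n).
  move=> y; rewrite ComplexField.Normc.normcM normcR ger0_norm// mulrC ler_wpM2r//.
  apply: (le_trans (hM y)); rewrite -[leRHS]mulr1 ler_wpM2l// invf_le1 ?lerDl ?sqr_ge0//.
  by rewrite ltr_pwDl ?sqr_ge0.
exists (fun n => normc (lint lam setT (fun y => (K n y)%:C * h y) - (2 * pi)%:C * h x)).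
split => //.
have E n : lint lam setT (fun y => (K n y)%:C * h y) - (2 * pi)%:C * h x =
    lint lam setT (fun y => (K n y)%:C * (h y - h x)).
  have Kc := citgZ (h x) (citg_real (Ki n)).
  rewrite -(Kint n) -lint_real mulrC -lintZ; last exact: (citg_real (Ki n)).
  rewrite -lintB//; congr lint; apply/funext => y; ring.
(* Near [x] continuity gives [eta]; at distance at least r, the bound 2 M is paid for by (y - x)^2 /
   r^2. *)
have bound (eta : R) : 0 < eta -> exists C, forall y, normc (h y - h x) <= eta + C * (y - x) ^+ 2.
  move=> eta0.
  have e2 : 0 < eta / 2 by rewrite divr_gt0.
  have [/= r1 r10 hr1] : exists2 r : R, 0 < r & forall y, `|x - y| < r -> `|re (h x) - re (h y)| < eta / 2.
    by have /cvgrPdist_lt/(_ _ e2) /nbhs_ballP[r r0 hr] := c1 x; exists r.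
  have [/= r2 r20 hr2] : exists2 r : R, 0 < r & forall y, `|x - y| < r -> `|im (h x) - im (h y)| < eta / 2.
    by have /cvgrPdist_lt/(_ _ e2) /nbhs_ballP[r r0 hr] := c2 x; exists r.
  pose r := Num.min r1 r2; have r0 : 0 < r by rewrite lt_min r10.
  exists (2 * M / r ^+ 2) => y; have [yr|ry] := ltP `|x - y| r.
    apply: (@le_trans _ _ eta); last first.
      by rewrite lerDl; apply: mulr_ge0; [apply: divr_ge0; [exact: mulr_ge0|exact: sqr_ge0]|exact: sqr_ge0].
    apply: (le_trans (normc_le _)); rewrite !reimE distrC (distrC (im _)) [leRHS]splitr.
    by move: yr; rewrite lt_min => /andP[y1 y2]; rewrite lerD// ltW// ?hr1 ?hr2.
  have b z : normc (h z) <= M.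
    apply: (le_trans (hM z)); rewrite -[leRHS]mulr1 ler_wpM2l// invf_le1 ?lerDl ?sqr_ge0//.
    by rewrite ltr_pwDl ?sqr_ge0.
  apply: (le_trans (normcB_le _ _)); apply: (@le_trans _ _ (2 * M)).
    by rewrite mulr2n mulrDl mul1r lerD.
  rewrite ler_wpDl ?(ltW eta0)// mulrAC ler_pdivlMr ?exprn_gt0// ler_wpM2l ?mulr_ge0//.
  by rewrite -[X in _ <= X]real_normK ?num_real// distrC lerXn2r// nnegrE ltW.
apply/cvgrPdist_le => eps eps0.
have pi0 : 0 < 8 * pi :> R by rewrite mulr_gt0// pi_gt0.
(* The mass 2 pi and the factor 2 of [normc_lint_le] turn [eta] into eps / 2. *)
pose eta := eps / (8 * pi).
have eta0 : 0 < eta by rewrite divr_gt0.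
have [C hC] := bound _ eta0.
have C0 : (2 * C * (2 * pi)) * n.+1%:R^-1 @[n --> \oo] --> (0 : R).
  by rewrite -[X in _ --> X](mulr0 (2 * C * (2 * pi))); apply: cvgM; [exact: cvg_cst|exact: cvg_harmonic].
have e2 : 0 < eps / 2 by rewrite divr_gt0.
have /cvgrPdist_le/(_ _ e2) := C0; apply: filterS => n hn.
rewrite sub0r normrN ger0_norm ?normc_ge0// E.
have gi : itg lam (fun y => eta * K n y + C * ((y - x) ^+ 2 * K n y)).
  exact: (itgD (itgZ eta (Ki n)) (itgZ C (Kvi n))).
have mF : cmeas (fun y => (K n y)%:C * (h y - h x)).
  apply: cmeasM; first by apply: cmeas_real; exact: itg_meas (Ki n).
  apply: cmeasD; first exact: (citg_meas (lone_citg lh)).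
  exact: cmeas_cst.
have bF y : normc ((K n y)%:C * (h y - h x)) <= eta * K n y + C * ((y - x) ^+ 2 * K n y).
  by rewrite ComplexField.Normc.normcM normcR ger0_norm// mulrA -mulrDl mulrC ler_wpM2r.
have := @normc_lint_le _ _ R lam _ _ mF gi bF.
move/le_trans; apply.
- rewrite (rintD (itgZ eta (Ki n)) (itgZ C (Kvi n))) (rintZ _ (Ki n)) (rintZ _ (Kvi n)) Kint Kvar.
  rewrite mulrDr [leRHS]splitr lerD//.
    have pn : pi != 0 :> R by rewrite gt_eqF ?pi_gt0.
    have F (e0 p : R) : p != 0 -> 2 * (e0 / (8 * p) * (2 * p)) = e0 / 2 by move=> p0; field.
    by rewrite /eta F.
  rewrite sub0r normrN in hn; apply: le_trans hn.
  rewrite (_ : 2 * (C * _) = 2 * C * (2 * pi) / n.+1%:R * n.+1%:R^-1); last by ring.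
  apply: (le_trans (ler_norm _)); rewrite normrM -[leRHS]mulr1 ler_wpM2l// ger0_norm ?(ltW (sp n))//.
  by rewrite invf_le1// ler1n.
Qed.

(** A Gaussian of width n + 1 damps the outer integral, so that the double integral [Phi] converges
    absolutely and may be exchanged. The inner integral is then a Gaussian of width 1/(n+1) centred
    at [x], an approximate identity. Integrability of [ft1 e h] serves to remove the damping by
    dominated convergence. *)
Lemma ft1_inv e h x : e ^+ 2 = 1 -> lone h -> citg lam (ft1 e h) ->
  lint lam setT (fun a : R => expi (- (e * x * a)) * ft1 e h a) = (2 * pi)%:C * h x.
Proof.
move=> e2 lh fi; have [c1 c2 [M M0 hM]] := lh; have hi := lone_citg lh.
have [u [u0 hu]] := approx_identity x lh.
set J := lint _ _ _.
pose f a := expi (- (e * x * a)) * ft1 e h a.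
pose f_ (n : nat) a := (nf 0 n.+1%:R a)%:C * f a.
have mf : cmeas f.
  apply: cmeasM; last exact: citg_meas fi.
  by apply: cmeas_expi; apply: measurableT_comp => //; exact: measurable_mulrl.
have nfle (n : nat) a : nf 0 n.+1%:R a <= 1.
  rewrite -expR0 ler_expR mulNr oppr_le0 divr_ge0 ?sqr_ge0// mulrn_wge0// sqr_ge0.
have nff a : normc (f a) = normc (ft1 e h a) by rewrite ComplexField.Normc.normcM normc_expi mul1r.
have lim : normc (lint lam setT (f_ n) - J) @[n --> \oo] --> (0 : R).
  apply: (@lint_dominated _ _ R lam f_ f (fun a => normc (ft1 e h a)) _ mf (citg_normc fi)).
  - move=> n; apply: cmeasM => //; apply: cmeas_real; exact: measurable_normal_fun.
  - move=> a; apply: (@squeeze_cvgr _ _ _ _ (fun=> 0) (fun n => (a ^+ 2 * normc (f a)) * n.+1%:R^-1)).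
    + apply: nearW => n; apply/andP; split; first exact: normc_ge0.
      rewrite (_ : f_ n a - f a = (nf 0 n.+1%:R a - 1)%:C * f a); last by rewrite /f_ rmorphB mulrBl mul1r.
      rewrite ComplexField.Normc.normcM mulrAC ler_wpM2r ?normc_ge0//.
      rewrite normcR distrC ger0_norm ?subr_ge0// lerBlDl -lerBlDr.
      apply: (@le_trans _ _ (1 + - a ^+ 2 / (n.+1%:R ^+ 2 *+ 2))); last first.
        by rewrite /nf subr0; exact: expR_ge1Dx.
      rewrite lerD2l mulNr lerN2 ler_wpM2l ?sqr_ge0// lef_pV2 ?posrE ?mulrn_wgt0 ?exprn_gt0//.
      rewrite -natrX -mulrnA ler_nat; apply: (@leq_trans (n.+1 ^ 2)); last exact: leq_pmulr.
      by rewrite expnS expn1 leq_pmulr.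
    + exact: cvg_cst.
    + by rewrite -[X in _ --> X](mulr0 (a ^+ 2 * normc (f a))); apply: cvgM; [exact: cvg_cst|exact: cvg_harmonic].
  - move=> n a; rewrite ComplexField.Normc.normcM nff normcR ger0_norm ?nf_ge0//.
    by rewrite -[leRHS]mul1r ler_wpM2r ?normc_ge0.
have E n : lint lam setT (f_ n) =
    lint lam setT (fun y : R => (nfmass n.+1%:R * nf x (n.+1%:R)^-1 y)%:C * h y).
  pose s : R := n.+1%:R; have s0 : 0 < s by [].
  pose Phi (p : R * R) := (nf 0 s p.1)%:C * (expi (e * p.1 * (p.2 - x)) * h p.2).
  have mPhi : cmeas Phi.
    have m1 : measurable_fun setT (fun p : R * R => p.1) by exact: measurable_fst.
    have m2 : measurable_fun setT (fun p : R * R => p.2) by exact: measurable_snd.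
    apply: cmeasM.
      by apply: cmeas_real; apply: measurableT_comp m1; exact: measurable_normal_fun.
    apply: cmeasM; last exact: (cmeas_comp (citg_meas hi) m2).
    apply: cmeas_expi; apply: measurable_funM.
      by apply: measurable_funM => //; exact: measurable_cst.
    by apply: measurable_funB => //; exact: measurable_cst.
  have nPhi p : normc (Phi p) <= nf 0 s p.1 * (M * (1 + p.2 ^+ 2)^-1).
    rewrite !ComplexField.Normc.normcM normc_expi mul1r normcR ger0_norm ?nf_ge0//.
    by rewrite ler_wpM2l ?nf_ge0.
  have iPhi : citg (lam \x lam)%E Phi.
    exact: (@citg_le _ _ R (lam \x lam)%E _ _ mPhi (itg_prod (itg_nf 0 s0) (itgZ M itg_oneDsqrV)) nPhi).
  have i1 a : citg lam (fun y => Phi (a, y)).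
    rewrite /Phi /=; apply: citgZ.
    have := citgZ (expi (- (e * a * x))) (citg_expi (e * a) hi).
    congr citg; apply/funext => y; rewrite mulrA -expiD; congr (expi _ * _); ring.
  have i2 y : citg lam (fun a => Phi (a, y)).
    apply: (citg_le _ (itgZ (M * (1 + y ^+ 2)^-1) (itg_nf 0 s0))).
      have mp : measurable_fun setT (fun a : R => (a, y)).
        by apply: measurable_fun_pair; [exact: measurable_id|exact: measurable_cst].
      exact: (cmeas_comp mPhi mp).
    by move=> a; rewrite mulrC; exact: nPhi.
  have [_ e1] := lint_fubini1 iPhi i1; have [_ e3] := lint_fubini2 iPhi i2.
  transitivity (lint lam setT (fun a => lint lam setT (fun y => Phi (a, y)))).
    congr lint; apply/funext => a; rewrite /f_ /f /ft1 -lintZ; last exact: citg_expi.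
    rewrite -lintZ; last by apply: citgZ; exact: citg_expi.
    congr lint; apply/funext => y; rewrite /Phi/= [in RHS](_ : e * a * (y - x) = - (e * x * a) + e * a * y).
      by rewrite expiD; ring.
    by ring.
  rewrite e1 -e3; congr lint; apply/funext => y.
  have ge : citg lam (fun a => (nf 0 s a)%:C * expi (e * (y - x) * a)).
    apply: (citg_le _ (itg_nf 0 s0)).
      apply: cmeasM; first by apply: cmeas_real; exact: measurable_normal_fun.
      by apply: cmeas_expi; exact: measurable_mulrl.
    by move=> a; rewrite ComplexField.Normc.normcM normc_expi mulr1 normcR ger0_norm ?nf_ge0.
  transitivity (h y * lint lam setT (fun a => (nf 0 s a)%:C * expi (e * (y - x) * a))).
    rewrite -lintZ//; congr lint; apply/funext => a; rewrite /Phi /=.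
    by rewrite (_ : e * a * (y - x) = e * (y - x) * a); [ring|ring].
  rewrite gaussK_lint// mulrC; congr (_%:C * _); congr (_ * _).
  rewrite /nf; congr expR; rewrite exprMn e2 mul1r -/s; field; by rewrite gt_eqF.
apply/eqP; rewrite -subr_eq0; apply/eqP.
apply: (@normc_cvg0 _ (fun n => normc (lint lam setT (f_ n) - J) + u n)).
  move=> n; rewrite (_ : J - _ = (lint lam setT (f_ n) - (2 * pi)%:C * h x) - (lint lam setT (f_ n) - J)); last by ring.
  apply: (le_trans (normcB_le _ _)); rewrite addrC lerD2l E; exact: hu.
by rewrite -[X in _ --> X]addr0; apply: cvgD.
Qed.

End FourierInversion1.

(** * The Fourier transform on R^n as a composition of transforms in one coordinate *)

Section PartialFourier.
Context {R : realType}.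
Local Notation lam := (@lebesgue_measure R).
Implicit Types (n d : nat) (e a y : R).

Definition c0 : R := (Num.sqrt (2 * pi))^-1.

Lemma c0_sqr : c0 ^+ 2 * (2 * pi) = 1 :> R.
Proof.
have p0 : 0 < 2 * pi :> R by rewrite mulr_gt0// pi_gt0.
by rewrite /c0 exprVn sqr_sqrtr ?(ltW p0)// mulVf// gt_eqF.
Qed.

Lemma c0_neq0 : c0 != 0.
Proof. by apply/eqP => c; have := c0_sqr; rewrite c expr0n/= mul0r => /eqP; rewrite eq_sym oner_eq0. Qed.

Definition fou e n (f : 'rV[R]_n -> R[i]) (xi : 'rV[R]_n) : R[i] :=
  (c0 ^+ n)%:C * lint (lebm n) setT (fun x => expi (e * dotv xi x) * f x).

Lemma fourier_fou n (f : 'rV[R]_n -> R[i]) : fourier f = fou (-1) f.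
Proof.
apply/funext => xi; rewrite /fourier /fou lebE; congr (_ * lint _ _ _).
by apply/funext => x; rewrite mulN1r.
Qed.

Lemma ifourier_fou n (f : 'rV[R]_n -> R[i]) : ifourier f = fou 1 f.
Proof.
apply/funext => xi; rewrite /ifourier /fou lebE; congr (_ * lint _ _ _).
by apply/funext => x; rewrite mul1r /dotv; congr (expi _ * _); apply: eq_bigr => i _; rewrite mulrC.
Qed.

Definition pft e n (i : 'I_n) (f : 'rV[R]_n -> R[i]) (x : 'rV[R]_n) : R[i] :=
  c0%:C * ft1 e (fun y => f (upd x i y)) (x 0 i).

Definition PF e n (l : seq 'I_n) (f : 'rV[R]_n -> R[i]) := foldr (pft e (n:=n)) f l.

Definition slice n (f : 'rV[R]_n.+1 -> R[i]) y : 'rV[R]_n -> R[i] := fun x => f (consv y x).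

Lemma upd_consv0 n y z (x : 'rV[R]_n) : upd (consv y x) ord0 z = consv z x.
Proof.
apply/rowP => j; rewrite upd_coord; case: (unliftP ord0 j) => [k ->|->].
  by rewrite !consvS.
by rewrite eqxx consv0.
Qed.

Lemma upd_consvS n y z (x : 'rV[R]_n) i : upd (consv y x) (lift ord0 i) z = consv y (upd x i z).
Proof.
apply/rowP => j; rewrite upd_coord; case: (unliftP ord0 j) => [k ->|->].
  by rewrite !consvS upd_coord (inj_eq lift_inj).
by rewrite !consv0.
Qed.

Lemma slice_pft e n (i : 'I_n) f y : slice (pft e (lift ord0 i) f) y = pft e i (slice f y).
Proof.
apply/funext => x; rewrite /slice /pft consvS; apply: (congr1 (fun h => c0%:C * ft1 e h (x 0 i))).
by apply/funext => t; rewrite upd_consvS.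
Qed.

Lemma slice_PF e n (l : seq 'I_n) f y : slice (PF e (map (lift ord0) l) f) y = PF e l (slice f y).
Proof. by elim: l => //= i l IH; rewrite slice_pft IH. Qed.

Lemma CFD_cmeas n (f : 'rV[R]_n -> R[i]) : CFD f -> cmeas f.
Proof. by move=> [[c1 c2] _]; split; exact: continuous_measurable_row. Qed.

Lemma CFD_decay n (f : 'rV[R]_n -> R[i]) : CFD f -> decay f.
Proof. by case. Qed.

Lemma CFD_citg n (f : 'rV[R]_n -> R[i]) : CFD f -> citg (lebm n) f.
Proof. by move=> hf; apply: citg_decay; [exact: CFD_cmeas|exact: CFD_decay]. Qed.

Lemma CFD_lone n (f : 'rV[R]_n -> R[i]) (p : R -> 'rV[R]_n) : CFD f -> continuous p ->
  (forall y, y ^+ 2 <= sqnorm (p y)) -> lone (fun y => f (p y)).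
Proof.
move=> [[c1 c2] df] cp hp; split.
- move=> y; apply: (@continuous_comp _ _ _ p (fun z => re (f z))); [exact: cp|exact: c1].
- move=> y; apply: (@continuous_comp _ _ _ p (fun z => im (f z))); [exact: cp|exact: c2].
- have [M M0 hM] := decay_ge0 df 1; exists M => // y; apply: (le_trans (hM _)).
  rewrite ler_wpM2l// lef_pV2 ?posrE ?expr1 ?sqnormD1_gt0 ?ltr_pwDl ?sqr_ge0//.
  by rewrite lerD2l.
Qed.

Lemma continuous_consvx n y : continuous (fun x : 'rV[R]_n => consv y x).
Proof.
apply: continuous_row => j; case: (unliftP ord0 j) => [k ->|->].
  rewrite (_ : (fun x => _) = (fun x : 'rV[R]_n => x 0 k)); first exact: coord_continuous.
  by apply/funext => x; rewrite consvS.
rewrite (_ : (fun x => _) = (fun _ : 'rV[R]_n => y)); first exact: cst_continuous.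
by apply/funext => x; rewrite consv0.
Qed.

Lemma continuous_consvy n (x : 'rV[R]_n) : continuous (fun y => consv y x).
Proof.
apply: continuous_row => j; case: (unliftP ord0 j) => [k ->|->].
  rewrite (_ : (fun y => _) = (fun=> x 0 k)); first exact: cst_continuous.
  by apply/funext => y; rewrite consvS.
rewrite (_ : (fun y => _) = id); first by move=> y; exact: cvg_id.
by apply/funext => y; rewrite consv0.
Qed.

Lemma decay_slice n (f : 'rV[R]_n.+1 -> R[i]) y : decay f -> decay (slice f y).
Proof.
move=> df N; have [M hM] := df N; exists M => x; apply: le_trans (hM (consv y x)).
rewrite ler_wpM2r ?normc_ge0// lerXn2r// ?nnegrE ?(ltW (sqnormD1_gt0 _))//.
by rewrite lerD2l sqnorm_consv lerDr sqr_ge0.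
Qed.

Lemma CFD_slice n (f : 'rV[R]_n.+1 -> R[i]) y : CFD f -> CFD (slice f y).
Proof.
move=> [[c1 c2] df]; split; last exact: decay_slice.
split=> x.
  by apply: (@continuous_comp _ _ _ (fun x : 'rV[R]_n => consv y x) (fun z => re (f z)));
    [exact: continuous_consvx|exact: c1].
by apply: (@continuous_comp _ _ _ (fun x : 'rV[R]_n => consv y x) (fun z => im (f z)));
    [exact: continuous_consvx|exact: c2].
Qed.

Lemma CFD_lone_consv n (f : 'rV[R]_n.+1 -> R[i]) (x : 'rV[R]_n) : CFD f -> lone (fun y => f (consv y x)).
Proof.
move=> hf; apply: (CFD_lone hf (@continuous_consvy n x)) => y.
by rewrite sqnorm_consv lerDl sqnorm_ge0.
Qed.

Lemma CFD_lone_upd n (f : 'rV[R]_n -> R[i]) (x : 'rV[R]_n) i : CFD f -> lone (fun y => f (upd x i y)).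
Proof.
move=> hf; apply: (CFD_lone hf (@continuous_updy _ _ x i)) => y.
by have := sqnorm_coord (upd x i y) i; rewrite upd_coord eqxx.
Qed.

Lemma decay_consv n (f : 'rV[R]_n.+1 -> R[i]) (N : nat) : decay f -> exists2 M : R, 0 <= M &
  forall y (x : 'rV[R]_n), (1 + sqnorm x) ^+ N * normc (f (consv y x)) <= M * (1 + y ^+ 2)^-1.
Proof.
move=> df; have [M hM] := df N.+1; exists M.
  by apply: le_trans (hM 0); rewrite mulr_ge0 ?normc_ge0// exprn_ge0// ltW// sqnormD1_gt0.
move=> y x; rewrite ler_pdivlMr ?ltr_pwDl ?sqr_ge0//; apply: le_trans (hM (consv y x)).
rewrite (exprSr (1 + sqnorm (consv y x))) mulrAC ler_wpM2r ?normc_ge0//.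
have s0 := sqnorm_ge0 x; have y0 := sqr_ge0 y.
rewrite sqnorm_consv ler_pM ?exprn_ge0 ?addr_ge0//.
  by rewrite lerXn2r// ?nnegrE ?addr_ge0// lerD2l lerDr.
by rewrite lerD2l lerDl.
Qed.

Lemma continuous_expi_dot n e (xi : 'rV[R]_n) :
  continuous (fun x => re (expi (e * dotv xi x))) /\ continuous (fun x => im (expi (e * dotv xi x))).
Proof.
have cd : continuous (fun x : 'rV[R]_n => e * dotv xi x).
  apply: continuous_mulr; first exact: cst_continuous.
  by apply: continuous_sumr => i; apply: continuous_mulr; [exact: cst_continuous|exact: coord_continuous].
split => x /=.
  by apply: (@continuous_comp _ _ _ (fun x : 'rV[R]_n => e * dotv xi x) cos); [exact: cd|exact: continuous_cos].
by apply: (@continuous_comp _ _ _ (fun x : 'rV[R]_n => e * dotv xi x) sin); [exact: cd|exact: continuous_sin].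
Qed.

Lemma ccontinuousM (S : topologicalType) (f g : S -> R[i]) :
  continuous (fun x => re (f x)) /\ continuous (fun x => im (f x)) ->
  continuous (fun x => re (g x)) /\ continuous (fun x => im (g x)) ->
  continuous (fun x => re (f x * g x)) /\ continuous (fun x => im (f x * g x)).
Proof.
move=> [f1 f2] [g1 g2]; split.
  rewrite (_ : (fun x => _) = (fun x => re (f x) * re (g x) + - (im (f x) * im (g x)))).
    by apply: continuous_addr; [exact: continuous_mulr|apply: continuous_oppr; exact: continuous_mulr].
  by apply/funext => x; rewrite re_mul.
rewrite (_ : (fun x => _) = (fun x => re (f x) * im (g x) + im (f x) * re (g x))).
  by apply: continuous_addr; exact: continuous_mulr.
by apply/funext => x; rewrite im_mul.
Qed.

Lemma CFD_le n (f g : 'rV[R]_n -> R[i]) : CFD f -> ccontinuous g -> (forall x, normc (g x) <= normc (f x)) -> CFD g.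
Proof.
move=> [_ df] cg gf; split => // N; have [M hM] := df N; exists M => x; apply: le_trans (hM x).
by rewrite ler_wpM2l// exprn_ge0// ltW// sqnormD1_gt0.
Qed.

Lemma CFD_expi n e (xi : 'rV[R]_n) f : CFD f -> CFD (fun x => expi (e * dotv xi x) * f x).
Proof.
move=> hf; apply: (CFD_le hf).
  by apply: ccontinuousM; [exact: continuous_expi_dot|case: hf].
by move=> x; rewrite ComplexField.Normc.normcM normc_expi mul1r.
Qed.

Lemma dotv_consv n a b (x z : 'rV[R]_n) : dotv (consv a x) (consv b z) = a * b + dotv x z.
Proof.
rewrite /dotv big_ord_recl !consv0; congr (_ + _).
by apply: eq_bigr => i _; rewrite !consvS.
Qed.

Lemma citg_consv n (f : 'rV[R]_n.+1 -> R[i]) : CFD f ->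
  citg (lam \x lebm n)%E (fun p => f (consv p.1 p.2)).
Proof.
move=> hf; have [M M0 hM] := decay_consv n (CFD_decay hf).
apply: (@citg_le _ _ R (lam \x lebm n)%E _ (fun p => (M * (1 + p.1 ^+ 2)^-1) * wt p.2)).
- exact: (cmeas_comp (CFD_cmeas hf) (@measurable_consv R n)).
- exact: (itg_prod (itgZ M itg_oneDsqrV) (itg_wt n)).
- move=> [y x] /=; have := hM y x; rewrite -ler_pdivlMl ?exprn_gt0 ?sqnormD1_gt0// => h.
  apply: (le_trans h); rewrite mulrC ler_wpM2l ?le_wt//.
  by rewrite mulr_ge0// invr_ge0 addr_ge0 ?sqr_ge0.
Qed.

Lemma lint_consv n (f : 'rV[R]_n.+1 -> R[i]) : CFD f ->
  lint (lebm n.+1) setT f = lint (lam \x lebm n)%E setT (fun p => f (consv p.1 p.2)).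
Proof.
move=> hf; have [i1 i2] := citg_consv hf; have [m1 m2] := CFD_cmeas hf.
by apply: eqC; rewrite !(re_lint, im_lint) rint_consv.
Qed.

(** [fouA] and [fouB] are the two orders of integration: the first coordinate is transformed last in
    [fouA] and first in [fouB]. They write the transform as a composition in either order of the
    coordinates; using one order for the transform and the other for its inverse, the factors cancel
    from the inside, and transforms in different coordinates never have to be shown to commute. *)
Lemma fouA e n (f : 'rV[R]_n.+1 -> R[i]) a (xi : 'rV[R]_n) : CFD f ->
  fou e f (consv a xi) = c0%:C * ft1 e (fun y => fou e (slice f y) xi) a.
Proof.
move=> hf; rewrite /fou exprS rmorphM -mulrA; congr (_ * _).
have hg := CFD_expi e (consv a xi) hf.
rewrite lint_consv//.
have [] := lint_fubini1 (citg_consv hg) (fun y => CFD_citg (CFD_slice y hg)).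
move=> i1 <-; rewrite -lintZ//; rewrite /ft1; congr lint; apply/funext => y.
rewrite [RHS]mulrCA -(lintZ (expi (e * a * y)) (CFD_citg (CFD_expi e xi (CFD_slice y hf)))).
congr (_ * _); congr lint; apply/funext => x; rewrite /= dotv_consv mulrDr mulrA expiD /slice.
by rewrite mulrA.
Qed.

Lemma fouB e n (f : 'rV[R]_n.+1 -> R[i]) a (xi : 'rV[R]_n) : CFD f ->
  fou e f (consv a xi) = fou e (slice (pft e ord0 f) a) xi.
Proof.
move=> hf; rewrite /fou exprSr rmorphM -mulrA; congr (_ * _).
have hg := CFD_expi e (consv a xi) hf.
rewrite lint_consv//.
have i1 x : citg lam (fun y => expi (e * dotv (consv a xi) (consv y x)) * f (consv y x)).
  exact: (lone_citg (CFD_lone_consv x hg)).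
have [m1 e1] := lint_fubini2 (citg_consv hg) i1.
rewrite -e1.
have E x : lint lam setT (fun y : R => expi (e * dotv (consv a xi) (consv y x)) * f (consv y x)) =
    expi (e * dotv xi x) * ft1 e (fun y => f (consv y x)) a.
  rewrite /ft1 -lintZ; last by apply: citg_expi; exact: (lone_citg (CFD_lone_consv x hf)).
  congr lint; apply/funext => y; rewrite dotv_consv [RHS]mulrA -expiD; congr (expi _ * _); ring.
have F x : expi (e * dotv xi x) * slice (pft e ord0 f) a x =
    c0%:C * lint lam setT (fun y : R => expi (e * dotv (consv a xi) (consv y x)) * f (consv y x)).
  transitivity (c0%:C * (expi (e * dotv xi x) * ft1 e (fun y => f (consv y x)) a)); last first.
    by congr (_ * _); symmetry; exact: E.
  have -> : slice (pft e ord0 f) a x = c0%:C * ft1 e (fun y => f (consv y x)) a.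
    rewrite /slice /pft (consv0 a x).
    have -> : (fun y => f (upd (consv a x) ord0 y)) = (fun y => f (consv y x)); last by [].
    by apply/funext => y; rewrite (upd_consv0 a y x).
  exact: mulrCA.
transitivity (lint (lebm n) setT (fun x => c0%:C *
   lint lam setT (fun y : R => expi (e * dotv (consv a xi) (consv y x)) * f (consv y x)))); last first.
  by congr lint; apply/funext => x; symmetry; exact: F.
apply/esym/lintZ.
have [M M0 hM] := decay_consv n (CFD_decay hf).
apply: (citg_le m1 (itgZ (2 * (M * rint lam setT (fun y : R => (1 + y ^+ 2)^-1))) (itg_wt n))) => x.
have w0 : 0 <= ((1 + sqnorm x) ^+ n)^-1 by rewrite invr_ge0 exprn_ge0// ltW// sqnormD1_gt0.
apply: (@le_trans _ _ (2 * (M * rint lam setT (fun y : R => (1 + y ^+ 2)^-1)) * ((1 + sqnorm x) ^+ n)^-1)); last first.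
  rewrite ler_wpM2l ?le_wt// mulr_ge0// mulr_ge0// rint_ge0// => y.
  by rewrite invr_ge0 addr_ge0 ?sqr_ge0.
have K := itgZ (M * ((1 + sqnorm x) ^+ n)^-1) itg_oneDsqrV.
have := @normc_lint_le _ _ R lam _ _ (citg_meas (i1 x)) K.
rewrite (rintZ _ itg_oneDsqrV) => h; apply: (le_trans (h _)) => [y|]; last first.
  by rewrite le_eqVlt; apply/orP; left; apply/eqP; ring.
rewrite ComplexField.Normc.normcM normc_expi mul1r.
have := hM y x; rewrite -ler_pdivlMl ?exprn_gt0 ?sqnormD1_gt0// => k.
by apply: (le_trans k); rewrite le_eqVlt; apply/orP; left; apply/eqP; ring.
Qed.

End PartialFourier.

Section FourierTheory.
Context {R : realType}.
Local Notation lam := (@lebesgue_measure R).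
Implicit Types (n d : nat) (e a y : R).

Lemma pft_consv e n (f : 'rV[R]_n.+1 -> R[i]) a (x : 'rV[R]_n) :
  pft e ord0 f (consv a x) = c0%:C * ft1 e (fun y => f (consv y x)) a.
Proof.
rewrite /pft (consv0 a x).
have -> : (fun y => f (upd (consv a x) ord0 y)) = (fun y => f (consv y x)); last by [].
by apply/funext => y; rewrite (upd_consv0 a y x).
Qed.

Lemma fou0 e (f : 'rV[R]_0 -> R[i]) : fou e f = f.
Proof.
apply/funext => x; rewrite /fou expr0 mul1r.
have all0 (z : 'rV[R]_0) : z = 0 by apply/rowP => -[].
have E (h : 'rV[R]_0 -> R) : rint (lebm 0) setT h = h 0.
  have := @integral_dirac _ 'rV[R]_0 0 R setT measurableT (fun z => (h z)%:E) .
  rewrite /rint => ->; first by rewrite diracT mul1e.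
  rewrite (_ : (fun z => _) = cst (h 0)%:E); first exact: measurable_cst.
  by apply/funext => z; rewrite (all0 z).
rewrite (all0 x); apply: eqC; rewrite !(re_lint, im_lint) E /dotv big_ord0 mulr0 expi0 mul1r//.
Qed.

Lemma fou_PF e n (f : 'rV[R]_n -> R[i]) : CFD f -> fou e f = PF e (enum 'I_n) f.
Proof.
elim: n f => [|n IH] f hf; first by rewrite fou0 enum_ord0.
apply/funext => z; rewrite (rowS z); set a := z 0 ord0; set x := \row__ _.
rewrite enum_ordSl /= pft_consv fouA//; congr (_ * _); rewrite /ft1; congr lint; apply/funext => y.
by rewrite (IH _ (CFD_slice y hf)) -slice_PF.
Qed.

(** For a merely continuous [f], decay in the transformed coordinate is lost. At a fixed frequency
    [a], continuity and decay in the other coordinates survive, and this is what the induction on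
    the dimension needs. *)
Lemma CFD_slice_pft e n (f : 'rV[R]_n.+1 -> R[i]) a : CFD f -> CFD (slice (pft e ord0 f) a).
Proof.
move=> hf.
have E : slice (pft e ord0 f) a = (fun x => c0%:C * ft1 e (fun y => f (consv y x)) a).
  by apply/funext => x; rewrite /slice pft_consv.
have [[c1 c2] df] := hf.
have [M M0 hM] := decay_consv 0 df.
pose k (x : 'rV[R]_n) y := expi (e * a * y) * f (consv y x).
have mk x : cmeas (k x).
  by have := citg_meas (citg_expi (e * a) (lone_citg (CFD_lone_consv x hf))).
have ck y : continuous (fun x => re (k x y)) /\ continuous (fun x => im (k x y)).
  apply: ccontinuousM.
    by split; exact: cst_continuous.
  by have [[]] := CFD_slice y hf.
have kM x y : normc (k x y) <= M * (1 + y ^+ 2)^-1.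
  rewrite /k ComplexField.Normc.normcM normc_expi mul1r; have := hM y x.
  by rewrite expr0 mul1r.
have ft1C : ccontinuous (fun x => ft1 e (fun y => f (consv y x)) a).
  split.
    apply: (@rint_continuous R _ _ lam _ (fun x y => re (k x y)) (fun y => M * (1 + y ^+ 2)^-1)).
    + by move=> x; have [] := mk x.
    + by move=> y; have [] := ck y.
    + exact: (itgZ M itg_oneDsqrV).
    + by move=> x y; exact: le_trans (normc_ge_re _) (kM x y).
  apply: (@rint_continuous R _ _ lam _ (fun x y => im (k x y)) (fun y => M * (1 + y ^+ 2)^-1)).
  + by move=> x; have [] := mk x.
  + by move=> y; have [] := ck y.
  + exact: (itgZ M itg_oneDsqrV).
  + by move=> x y; exact: le_trans (normc_ge_im _) (kM x y).
rewrite E; split.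
  by apply: ccontinuousM => //; split; exact: cst_continuous.
move=> N; have [L L0 hL] := decay_consv N df.
exists (normc c0%:C * (2 * (L * rint lam setT (fun y : R => (1 + y ^+ 2)^-1)))) => x.
rewrite ComplexField.Normc.normcM mulrCA ler_wpM2l ?normc_ge0//.
have p0 : 0 < (1 + sqnorm x) ^+ N by rewrite exprn_gt0// sqnormD1_gt0.
rewrite mulrC -ler_pdivlMr//.
have K := itgZ (L * ((1 + sqnorm x) ^+ N)^-1) (itg_oneDsqrV (R := R)).
have kb y : normc (k x y) <= L * ((1 + sqnorm x) ^+ N)^-1 * (1 + y ^+ 2)^-1.
  rewrite /k ComplexField.Normc.normcM normc_expi mul1r; have := hL y x.
  by rewrite -ler_pdivlMl// => h; apply: (le_trans h); rewrite le_eqVlt; apply/orP; left; apply/eqP; ring.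
have := @normc_lint_le _ _ R lam _ _ (mk x) K kb.
rewrite (rintZ _ itg_oneDsqrV) => h; apply: (le_trans h).
by rewrite le_eqVlt; apply/orP; left; apply/eqP; ring.
Qed.

Lemma fou_PFr e n (f : 'rV[R]_n -> R[i]) : CFD f -> fou e f = PF e (rev (enum 'I_n)) f.
Proof.
elim: n f => [|n IH] f hf; first by rewrite fou0 enum_ord0.
apply/funext => z; rewrite (rowS z); set a := z 0 ord0; set x := \row__ _.
rewrite enum_ordSl rev_cons -map_rev /PF foldr_rcons -/(PF e _ _) fouB//.
by rewrite (IH _ (CFD_slice_pft e a hf)) -slice_PF.
Qed.

(** The transform of such an [h] need not be integrable in general, but the zero transform is, so
    the inversion formula applies and yields injectivity. *)
Lemma ft1_eq0 e h : e ^+ 2 = 1 -> lone h -> (forall a, ft1 e h a = 0) -> forall y, h y = 0.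
Proof.
move=> e2 lh h0 y; have E : ft1 e h = (fun=> 0) by apply/funext => a.
have i0 : citg lam (ft1 e h) by rewrite E; split; exact: itg0.
have := ft1_inv y e2 lh i0; rewrite E.
have -> : lint lam setT (fun a : R => expi (- (e * y * a)) * 0) = 0.
  by rewrite -[RHS](lint0 lam); congr lint; apply/funext => a; rewrite mulr0.
move=> /esym/eqP; rewrite mulf_eq0 => /orP[|/eqP//].
rewrite -(rmorph0 (real_complex R)) (inj_eq (@complexI R)) mulf_eq0 => /orP[/eqP p|/eqP p].
  by have := ltr0n R 2; rewrite p ltxx.
by have := pi_gt0 R; rewrite p ltxx.
Qed.

Lemma fou_eq0 e n (f : 'rV[R]_n -> R[i]) : e ^+ 2 = 1 -> CFD f -> (forall xi, fou e f xi = 0) -> forall x, f x = 0.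
Proof.
move=> e2; elim: n f => [|n IH] f hf h0 x; first by rewrite -(fou0 e f).
rewrite (rowS x); set x' := \row__ _.
apply: (ft1_eq0 e2 (CFD_lone_consv x' hf)) => a.
have := IH _ (CFD_slice_pft e a hf) (fun xi => _) x'.
rewrite /slice pft_consv => h.
have {}h : c0%:C * ft1 e (fun y => f (consv y x')) a = 0.
  by apply: h => xi; rewrite -[LHS](fouB e a xi hf) h0.
move/eqP: h; rewrite mulf_eq0 => /orP[|/eqP//].
by rewrite -(rmorph0 (real_complex R)) (inj_eq (@complexI R)) (negbTE c0_neq0).
Qed.

Lemma CFDB n (f g : 'rV[R]_n -> R[i]) : CFD f -> CFD g -> CFD (fun x => f x - g x).
Proof.
move=> [[f1 f2] df] [[g1 g2] dg]; split; first split.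
- rewrite (_ : (fun x => _) = (fun x => re (f x) + - re (g x))); last by apply/funext => x; rewrite !reimE.
  by apply: continuous_addr => //; exact: continuous_oppr.
- rewrite (_ : (fun x => _) = (fun x => im (f x) + - im (g x))); last by apply/funext => x; rewrite !reimE.
  by apply: continuous_addr => //; exact: continuous_oppr.
move=> N; have [M hM] := df N; have [L hL] := dg N; exists (M + L) => x.
apply: (le_trans _ (lerD (hM x) (hL x))); rewrite -mulrDr ler_wpM2l ?normcB_le//.
by rewrite exprn_ge0// ltW// sqnormD1_gt0.
Qed.

Lemma fourier_inj n (f g : 'rV[R]_n -> R[i]) : CFD f -> CFD g -> fourier f = fourier g -> f = g.
Proof.
move=> hf hg fg; apply/funext => x; apply/eqP; rewrite -subr_eq0; apply/eqP.
have e2 : (-1 : R) ^+ 2 = 1 by rewrite sqrrN expr1n.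
apply: (fou_eq0 e2 (CFDB hf hg)) => xi.
have : fou (-1) f xi - fou (-1) g xi = 0 by rewrite -!fourier_fou fg subrr.
rewrite /fou -mulrBr -lintB; [|exact: (CFD_citg (CFD_expi (-1) xi hf))|exact: (CFD_citg (CFD_expi (-1) xi hg))].
move=> <-; congr (_ * _); congr lint; apply/funext => z; rewrite mulrBr//.
Qed.

Lemma schwartz_CFD n (f : 'rV[R]_n -> R[i]) : schwartz f -> CFD f.
Proof.
move=> [h1 h2]; split; first by split; exact: rs_cont.
move=> N; have [M hM] := rs_bound N h1; have [L hL] := rs_bound N h2; exists (M + L) => x.
apply: (le_trans _ (lerD (hM x) (hL x))); rewrite -mulrDr ler_wpM2l ?normc_le//.
by rewrite exprn_ge0// ltW// sqnormD1_gt0.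
Qed.

Lemma pftE e n (i : 'I_n) (f : 'rV[R]_n -> R[i]) x : e = 1 \/ e = -1 -> schwartz f ->
  re (pft e i f x) = c0 * (tr true i (fun z => re (f z)) x + - (e * tr false i (fun z => im (f z)) x)) /\
  im (pft e i f x) = c0 * (tr true i (fun z => im (f z)) x + e * tr false i (fun z => re (f z)) x).
Proof.
move=> he [hr hi]; rewrite /pft; split.
  rewrite re_mul /= mul0r subr0; congr (_ * _).
  rewrite /tr -(rintZ e (itg_trfun false i x hi)) -(rintB (itg_trfun true i x hr) (itgZ e (itg_trfun false i x hi))).
  congr (rint _ _ _); apply/funext => y; rewrite re_mul /cs /=.
  by case: he => ->; rewrite ?mul1r ?mulN1r ?mulNr ?cosN ?sinN; ring.
rewrite im_mul /= mul0r addr0; congr (_ * _).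
rewrite /tr -(rintZ e (itg_trfun false i x hr)) -(rintD (itg_trfun true i x hi) (itgZ e (itg_trfun false i x hr))).
congr (rint _ _ _); apply/funext => y; rewrite im_mul /cs /=.
by case: he => ->; rewrite ?mul1r ?mulN1r ?mulNr ?cosN ?sinN; ring.
Qed.

Lemma schwartz_pft e n (i : 'I_n) (f : 'rV[R]_n -> R[i]) : e = 1 \/ e = -1 -> schwartz f -> schwartz (pft e i f).
Proof.
move=> he hf; have [hr hi] := hf; split.
  rewrite (_ : (fun x => _) = (fun x => c0 * (tr true i (fun z => re (f z)) x + - (e * tr false i (fun z => im (f z)) x)))).
    by apply: rsZ; apply: rsD; [exact: rs_tr|apply: rsN; apply: rsZ; exact: rs_tr].
  by apply/funext => x; have [] := pftE i x he hf.
rewrite (_ : (fun x => _) = (fun x => c0 * (tr true i (fun z => im (f z)) x + e * tr false i (fun z => re (f z)) x))).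
  by apply: rsZ; apply: rsD; [exact: rs_tr|apply: rsZ; exact: rs_tr].
by apply/funext => x; have [] := pftE i x he hf.
Qed.

Lemma schwartz_PF e n (l : seq 'I_n) (f : 'rV[R]_n -> R[i]) : e = 1 \/ e = -1 -> schwartz f -> schwartz (PF e l f).
Proof. by move=> he hf; elim: l => //= i l IH; exact: schwartz_pft. Qed.

Lemma pftK e n (i : 'I_n) (f : 'rV[R]_n -> R[i]) : e = 1 \/ e = -1 -> schwartz f -> pft (- e) i (pft e i f) = f.
Proof.
move=> he hf; have e2 : e ^+ 2 = 1 by case: he => ->; rewrite ?sqrrN expr1n.
apply/funext => x; pose h y := f (upd x i y).
have lh : lone h := CFD_lone_upd x i (schwartz_CFD hf).
have E a : pft e i f (upd x i a) = c0%:C * ft1 e h a.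
  rewrite /pft upd_coord eqxx; congr (_ * _).
  by rewrite /ft1; congr lint; apply/funext => y; rewrite upd_upd.
(* That the transform is again Schwartz gives the integrability which inversion asks for; C_FD would
   not provide it. *)
have l2 := lone_citg (CFD_lone_upd x i (schwartz_CFD (schwartz_pft i he hf))).
have ih : citg lam (ft1 e h).
  have := citgZ (c0%:C)^-1 l2; congr citg; apply/funext => a; rewrite E mulrA mulVf ?mul1r//.
  by rewrite -(rmorph0 (real_complex R)) (inj_eq (@complexI R)) c0_neq0.
have := ft1_inv (x 0 i) e2 lh ih; rewrite /h upd_id => inv.
have O : ft1 (- e) (fun y => pft e i f (upd x i y)) (x 0 i) =
    c0%:C * lint lam setT (fun a : R => expi (- (e * x 0 i * a)) * ft1 e h a).
  have ih' : citg lam (fun a : R => expi (- (e * x 0 i * a)) * ft1 e h a).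
    have := citg_expi (- (e * x 0 i)) ih; congr citg; apply/funext => a; congr (expi _ * _); ring.
  rewrite -(lintZ _ ih'); transitivity (lint lam setT (fun a : R => expi (- e * x 0 i * a) * pft e i f (upd x i a))).
    by [].
  congr lint; apply/funext => a; rewrite E mulrCA; congr (_ * (expi _ * _)); ring.
transitivity (c0%:C * ft1 (- e) (fun y => pft e i f (upd x i y)) (x 0 i)); first by [].
rewrite O inv !mulrA -!rmorphM -expr2 -[RHS]mul1r; congr (_ * _).
by rewrite c0_sqr.
Qed.

Lemma PFK e n (l : seq 'I_n) (f : 'rV[R]_n -> R[i]) : e = 1 \/ e = -1 -> schwartz f -> PF (- e) (rev l) (PF e l f) = f.
Proof.
move=> he hf; elim: l => //= i l IH; rewrite rev_cons /PF foldr_rcons -/(PF e l f) pftK//.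
exact: schwartz_PF.
Qed.

Lemma fouK e n (f : 'rV[R]_n -> R[i]) : e = 1 \/ e = -1 -> schwartz f -> fou (- e) (fou e f) = f.
Proof.
move=> he hf; rewrite (fou_PF e (schwartz_CFD hf)) fou_PFr ?PFK//.
by apply: schwartz_CFD; exact: schwartz_PF.
Qed.

Lemma schwartz_fou e n (f : 'rV[R]_n -> R[i]) : e = 1 \/ e = -1 -> schwartz f -> schwartz (fou e f).
Proof. by move=> he hf; rewrite (fou_PF e (schwartz_CFD hf)); exact: schwartz_PF. Qed.

Lemma fouN e n (f : 'rV[R]_n -> R[i]) xi : fou (- e) f xi = fou e f (- xi).
Proof.
rewrite /fou; congr (_ * lint _ _ _); apply/funext => x; congr (expi _ * _).
rewrite mulNr -mulrN /dotv -sumrN; congr (_ * _); apply: eq_bigr => i _.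
by rewrite mxE mulNr.
Qed.

Lemma schwartz_fourier n (f : 'rV[R]_n -> R[i]) : schwartz f -> schwartz (fourier f).
Proof. by rewrite fourier_fou; apply: schwartz_fou; right. Qed.

Lemma fourierK n (f : 'rV[R]_n -> R[i]) : schwartz f -> ifourier (fourier f) = f.
Proof.
move=> hf; rewrite fourier_fou ifourier_fou -{1}(opprK 1); apply: fouK => //; by right.
Qed.

Lemma fourier_fourier n (f : 'rV[R]_n -> R[i]) x : schwartz f -> fourier (fourier f) x = f (- x).
Proof.
move=> hf; rewrite [in LHS]fourier_fou fouN -ifourier_fou fourierK//.
Qed.

End FourierTheory.

(** * Transforms on space-time *)

Section SpaceTime.
Context {R : realType} (d : nat).
Implicit Types (e t : R) (x : 'rV[R]_d) (z : 'rV[R]_(d + 1)) (f : 'rV[R]_(d + 1) -> R[i]).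

Definition time_index : 'I_(d + 1) := rshift d ord0.

Lemma spaceK x t : space (spacetime x t) = x.
Proof. by rewrite /space /spacetime row_mxKl. Qed.

Lemma timeK x t : time (spacetime x t) = t.
Proof. by rewrite /time /spacetime row_mxKr mxE eqxx mulr1n. Qed.

Lemma spacetimeE z : spacetime (space z) (time z) = z.
Proof.
rewrite /spacetime /space /time -[RHS]hsubmxK; congr row_mx.
by apply/rowP => i; rewrite !ord1 !mxE eqxx mulr1n.
Qed.

Lemma spacetime_l x t i : spacetime x t 0 (lshift 1 i) = x 0 i.
Proof. by rewrite /spacetime row_mxEl. Qed.

Lemma spacetime_r x t : spacetime x t 0 time_index = t.
Proof. by rewrite /spacetime row_mxEr mxE eqxx mulr1n. Qed.

Lemma eq_spacetime z (z' : 'rV[R]_(d + 1)) : (forall i, z 0 (lshift 1 i) = z' 0 (lshift 1 i)) ->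
  z 0 time_index = z' 0 time_index -> z = z'.
Proof.
move=> h1 h2; apply/rowP => j; case: (splitP j) => [i ji|i ji].
  by rewrite (_ : j = lshift 1 i) ?h1//; exact/val_inj.
by rewrite (_ : j = time_index)//; apply/val_inj; rewrite /= ji ord1.
Qed.

Lemma lshift_neq_time_index i : (lshift 1 i == time_index :> 'I_(d + 1)) = false.
Proof. by apply/eqP => /(congr1 val) /= h; have := ltn_ord i; rewrite h addn0 ltnn. Qed.

Lemma upd_spacetime_l x t i (y : R) : upd (spacetime x t) (lshift 1 i) y = spacetime (upd x i y) t.
Proof.
apply: eq_spacetime => [j|].
  by rewrite upd_coord !spacetime_l upd_coord (inj_eq (@lshift_inj _ _)).
by rewrite upd_coord !spacetime_r eq_sym lshift_neq_time_index.
Qed.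

Lemma upd_spacetime_r x t (s : R) : upd (spacetime x t) time_index s = spacetime x s.
Proof.
apply: eq_spacetime => [j|].
  by rewrite upd_coord !spacetime_l lshift_neq_time_index.
by rewrite upd_coord !spacetime_r eqxx.
Qed.

Lemma sqnorm_spacetime x t : sqnorm (spacetime x t) = sqnorm x + t ^+ 2.
Proof.
rewrite /sqnorm big_split_ord/= big_ord1; congr (_ + _); last by rewrite spacetime_r.
by apply: eq_bigr => i _; rewrite spacetime_l.
Qed.

Lemma spacetime01 : spacetime 0 1 = 'e_time_index :> 'rV[R]_(d + 1).
Proof.
apply: eq_spacetime => [j|].
  by rewrite spacetime_l !mxE eqxx lshift_neq_time_index.
by rewrite spacetime_r !mxE !eqxx.
Qed.

Lemma continuous_spacetimex t : continuous (fun x => spacetime x t).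
Proof.
apply: continuous_row => j; case: (splitP j) => [i ji|i ji].
  rewrite (_ : (fun x => _) = (fun x : 'rV[R]_d => x 0 i)); first exact: coord_continuous.
  by apply/funext => x; rewrite (_ : j = lshift 1 i) ?spacetime_l//; exact/val_inj.
rewrite (_ : (fun x => _) = (fun _ : 'rV[R]_d => t)); first exact: cst_continuous.
apply/funext => x; rewrite (_ : j = time_index) ?spacetime_r//.
by apply/val_inj; rewrite /= ji ord1.
Qed.

Lemma CFD_spacetime f t : CFD f -> CFD (fun x => f (spacetime x t)).
Proof.
move=> [[c1 c2] df]; split.
  split=> x.
    by apply: (@continuous_comp _ _ _ (fun x => spacetime x t) (fun z => re (f z)));
      [exact: continuous_spacetimex|exact: c1].
  by apply: (@continuous_comp _ _ _ (fun x => spacetime x t) (fun z => im (f z)));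
    [exact: continuous_spacetimex|exact: c2].
move=> N; have [M hM] := df N; exists M => x; apply: le_trans (hM (spacetime x t)).
rewrite ler_wpM2r ?normc_ge0// lerXn2r// ?nnegrE ?(ltW (sqnormD1_gt0 _))//.
by rewrite lerD2l sqnorm_spacetime lerDl sqr_ge0.
Qed.

Definition fouS e f z : R[i] := fou e (fun x => f (spacetime x (time z))) (space z).

Lemma fourierS_fouS f : fourierS f = fouS (-1) f.
Proof. by apply/funext => z; rewrite /fourierS fourier_fou. Qed.

Lemma ifourierS_fouS f : ifourierS f = fouS 1 f.
Proof. by apply/funext => z; rewrite /ifourierS ifourier_fou. Qed.

Lemma pft_spacetime_l e i f t :
  (fun x => pft e (lshift 1 i) f (spacetime x t)) = pft e i (fun x => f (spacetime x t)).
Proof.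
apply/funext => x; rewrite /pft spacetime_l.
have -> // : (fun y => f (upd (spacetime x t) (lshift 1 i) y)) = (fun y => f (spacetime (upd x i y) t)).
by apply/funext => y; rewrite (upd_spacetime_l x t i y).
Qed.

Lemma PF_spacetime_l e (l : seq 'I_d) f t :
  (fun x => PF e (map (lshift 1) l) f (spacetime x t)) = PF e l (fun x => f (spacetime x t)).
Proof. by elim: l => //= i l IH; rewrite pft_spacetime_l IH. Qed.

Definition spl : seq 'I_(d + 1) := map (lshift 1) (enum 'I_d).

Lemma fouS_PF e f : CFD f -> fouS e f = PF e spl f.
Proof.
move=> hf; apply/funext => z; rewrite -[in RHS](spacetimeE z) /fouS.
rewrite (fou_PF e (CFD_spacetime (time z) hf)) -PF_spacetime_l//.
Qed.

Lemma fouS_PFr e f : CFD f -> fouS e f = PF e (rev spl) f.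
Proof.
move=> hf; apply/funext => z; rewrite -[in RHS](spacetimeE z) /fouS.
rewrite (fou_PFr e (CFD_spacetime (time z) hf)) -PF_spacetime_l map_rev//.
Qed.

Lemma schwartz_fouS e f : e = 1 \/ e = -1 -> schwartz f -> schwartz (fouS e f).
Proof. by move=> he hf; rewrite (fouS_PF e (schwartz_CFD hf)); exact: schwartz_PF. Qed.

Lemma fouSK e f : e = 1 \/ e = -1 -> schwartz f -> fouS (- e) (fouS e f) = f.
Proof.
move=> he hf; rewrite (fouS_PF e (schwartz_CFD hf)) fouS_PFr ?PFK//.
by apply: schwartz_CFD; exact: schwartz_PF.
Qed.

Lemma schwartz_fourierS f : schwartz f -> schwartz (fourierS f).
Proof. by rewrite fourierS_fouS; apply: schwartz_fouS; right. Qed.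

Lemma fourierSK f : schwartz f -> ifourierS (fourierS f) = f.
Proof.
by move=> hf; rewrite fourierS_fouS ifourierS_fouS -{1}(opprK 1); apply: fouSK => //; right.
Qed.

Definition reflS z : 'rV[R]_(d + 1) := spacetime (- space z) (time z).

Lemma fourierS_fourierS f z : schwartz f -> fourierS (fourierS f) z = f (reflS z).
Proof.
move=> hf; rewrite -[in RHS](fourierSK hf) ifourierS_fouS [in LHS]fourierS_fouS /fouS.
by rewrite fouN /reflS spaceK timeK.
Qed.

Lemma enum_spl : enum 'I_(d + 1) = spl ++ [:: time_index].
Proof.
apply: (inj_map val_inj); transitivity (iota 0 (d + 1)); first exact: val_enum_ord.
rewrite map_cat /spl -map_comp iotaD /= add0n addn0; congr (_ ++ _).
transitivity (map val (enum 'I_d)); first by symmetry; exact: val_enum_ord.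
by apply: eq_map.
Qed.

(** Time is the last coordinate in the enumeration, hence the innermost factor of the
    composition. *)
Lemma fou_fouS e f : e = 1 \/ e = -1 -> schwartz f -> fou e f = fouS e (pft e time_index f).
Proof.
move=> he hf; rewrite (fou_PF e (schwartz_CFD hf)) enum_spl fouS_PF.
  by rewrite /PF foldr_cat.
by apply: schwartz_CFD; exact: schwartz_pft.
Qed.

Lemma fourier_fourierS f : schwartz f -> fourier f = fourierS (pft (-1) time_index f).
Proof. by move=> hf; rewrite fourier_fou fourierS_fouS fou_fouS//; right. Qed.

Lemma dtE f : dt f = fun z => 'D_('e_time_index) (fun y => re (f y)) z +i* 'D_('e_time_index) (fun y => im (f y)) z.
Proof. by apply/funext => z; rewrite /dt spacetime01. Qed.

Lemma schwartz_dt f : schwartz f -> schwartz (dt f).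
Proof. by move=> [h1 h2]; rewrite dtE; split; exact: rs_D. Qed.

(** With the exponent sign +1, d/dt becomes - i omega. This moves the factor i omega of the
    evolution equation onto the test function as - d/dt. *)
Lemma pft_dt f z : schwartz f ->
  pft 1 time_index (dt f) z = - ((0 +i* time z) * pft 1 time_index f z).
Proof.
move=> hf; have [h1 h2] := hf; have he : (1 : R) = 1 \/ (1 : R) = -1 by left.
have [r1 i1] := pftE time_index z he hf; have [r2 i2] := pftE time_index z he (schwartz_dt hf).
have tE b (g : 'rV[R]_(d + 1) -> R) : rschwartz g ->
    tr b time_index (fun y : 'rV[R]_(d + 1) => 'D_'e_time_index g y) z = - (sg b * time z) * tr (~~ b) time_index g z.
  by move=> hg; rewrite tr_parts// time_coord.
have q1 b : tr b time_index (fun y => re (dt f y)) z = - (sg b * time z) * tr (~~ b) time_index (fun y => re (f y)) z.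
  rewrite -(tE b _ h1); have -> // : (fun y => re (dt f y)) = (fun y => 'D_'e_time_index (fun y => re (f y)) y).
  by apply/funext => y; rewrite dtE.
have q2 b : tr b time_index (fun y => im (dt f y)) z = - (sg b * time z) * tr (~~ b) time_index (fun y => im (f y)) z.
  rewrite -(tE b _ h2); have -> // : (fun y => im (dt f y)) = (fun y => 'D_'e_time_index (fun y => im (f y)) y).
  by apply/funext => y; rewrite dtE.
rewrite !q1 !q2 in r2 i2; move: r1 i1 r2 i2.
move: (pft 1 time_index f z) (pft 1 time_index (dt f) z) => w w' r1 i1 r2 i2.
by apply: eqC; rewrite !reimE ?r2 ?i2 /= r1 i1 /sg /=; ring.
Qed.

Lemma dt_pft e i f : e = 1 \/ e = -1 -> i != time_index -> schwartz f -> dt (pft e i f) = pft e i (dt f).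
Proof.
move=> he il hf; have [h1 h2] := hf; apply/funext => z; rewrite dtE.
have [r2 i2] := pftE i z he (schwartz_dt hf).
have dT b g : rschwartz g -> is_derive z 'e_time_index (tr b i g) (tr b i (fun y => 'D_('e_time_index) g y) z).
  by move=> hg; exact: is_derive_tr_neq.
have E1 : (fun y => re (dt f y)) = (fun y => 'D_'e_time_index (fun y => re (f y)) y).
  by apply/funext => y; rewrite dtE.
have E2 : (fun y => im (dt f y)) = (fun y => 'D_'e_time_index (fun y => im (f y)) y).
  by apply/funext => y; rewrite dtE.
have P1 : (fun y => re (pft e i f y)) =
    (fun y => c0 * (tr true i (fun z => re (f z)) y + - (e * tr false i (fun z => im (f z)) y))).
  by apply/funext => y; have [] := pftE i y he hf.
have P2 : (fun y => im (pft e i f y)) =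
    (fun y => c0 * (tr true i (fun z => im (f z)) y + e * tr false i (fun z => re (f z)) y)).
  by apply/funext => y; have [] := pftE i y he hf.
have L1 : 'D_'e_time_index (fun y => re (pft e i f y)) z = re (pft e i (dt f) z).
  rewrite P1 r2 E1 E2; have d1 := dT true _ h1; have d2 := dT false _ h2.
  have d4 := is_deriveZ c0 (is_deriveB d1 (is_deriveZ e d2)).
  by have [_] := d4.
have L2 : 'D_'e_time_index (fun y => im (pft e i f y)) z = im (pft e i (dt f) z).
  rewrite P2 i2 E1 E2; have d1 := dT true _ h2; have d2 := dT false _ h1.
  have d4 := is_deriveZ c0 (is_deriveD d1 (is_deriveZ e d2)).
  by have [_] := d4.
by rewrite L1 L2; apply: eqC.
Qed.

Lemma dt_fourierS f : schwartz f -> dt (fourierS f) = fourierS (dt f).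
Proof.
move=> hf; have he : (-1 : R) = 1 \/ (-1 : R) = -1 by right.
rewrite !fourierS_fouS !fouS_PF; [|exact: schwartz_CFD (schwartz_dt hf)|exact: schwartz_CFD].
rewrite /spl; elim: (enum 'I_d) => //= i l IH.
rewrite dt_pft ?IH//; last exact: schwartz_PF.
by rewrite lshift_neq_time_index.
Qed.

End SpaceTime.

(** * Slow-growing complex measures as combinations of positive measures *)

Section Density.
Context (dsp : measure_display) (T : measurableType dsp) {R : realType}.
Variables (p : {measure set T -> \bar R}) (h : T -> R).
Hypotheses (mh : measurable_fun setT h) (h0 : forall x, 0 <= h x).
Local Open Scope ereal_scope.

Let dens (A : set T) : \bar R := \int[p]_(x in A) (h x)%:E.

Let dens0 : dens set0 = 0.
Proof. by rewrite /dens integral_set0. Qed.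

Let dens_ge0 A : 0 <= dens A.
Proof. by apply: integral_ge0 => x _; rewrite lee_fin. Qed.

Let dens_sigma_additive : semi_sigma_additive dens.
Proof.
move=> F mF tF mUF; rewrite /dens ge0_integral_bigcup//.
- by apply: is_cvg_ereal_nneg_natsum => n _; exact: dens_ge0.
- by apply/measurable_EFinP; exact: measurable_funTS.
- by move=> x _; rewrite lee_fin.
Qed.

HB.instance Definition _ := isMeasure.Build _ _ _ dens dens0 dens_ge0 dens_sigma_additive.

Import HBNNSimple.

(** The measure with density [h] with respect to an arbitrary [p]: the identity is checked on simple
    functions and passes to the limit by monotone convergence, without any finiteness of [p]. *)
Lemma density_measure : exists P : {measure set T -> \bar R},
  forall f : T -> \bar R, measurable_fun setT f -> (forall x, 0 <= f x) ->
    \int[P]_x f x = \int[p]_x (f x * (h x)%:E).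
Proof.
exists dens => f mf f0.
pose g := nnsfun_approx measurableT mf.
have mg n : measurable_fun setT (EFin \o g n) by apply/measurable_EFinP; exact: measurable_funP.
have mhE : measurable_fun setT (EFin \o h) by exact/measurable_EFinP.
have fE x : f x = lim ((EFin \o g n) x @[n --> \oo]).
  by apply/esym/cvg_lim => //; exact: cvg_nnsfun_approx.
have fgE x : f x * (h x)%:E = lim (((EFin \o g n) x * (h x)%:E) @[n --> \oo]).
  by apply/esym/cvg_lim => //; apply: cvgeZr => //; exact: cvg_nnsfun_approx.
have nd x : {homo (fun n => (EFin \o g n) x) : a b / (a <= b)%N >-> a <= b}.
  by move=> a b ab; rewrite lee_fin; exact/lefP/nd_nnsfun_approx.
rewrite (eq_integral (fun x => lim ((EFin \o g n) x @[n --> \oo]))); last by move=> x _; rewrite fE.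
rewrite [RHS](eq_integral (fun x => lim (((EFin \o g n) x * (h x)%:E) @[n --> \oo]))); last by move=> x _; rewrite fgE.
rewrite monotone_convergence//; last by move=> n x _; rewrite lee_fin.
rewrite monotone_convergence//; last 3 first.
- by move=> n; exact: emeasurable_funM.
- by move=> n x _; rewrite mule_ge0// lee_fin.
- by move=> x _ a b ab; rewrite lee_wpmul2r ?lee_fin//; exact: nd.
suff E n : \int[dens]_x (EFin \o g n) x = \int[p]_x ((EFin \o g n) x * (h x)%:E).
  by under eq_fun do rewrite E.
have mI y : measurable (g n @^-1` [set y]) by exact: measurable_sfunP.
have mIy y : measurable_fun setT (fun x => (y * \1_(g n @^-1` [set y]) x)%:E).
  by apply/measurable_EFinP; apply: measurable_funM => //; exact: measurable_indic.
transitivity (\sum_(y \in range (g n)) y%:E * dens (g n @^-1` [set y])).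
  under eq_integral do rewrite /= fimfunE -fsumEFin//.
  rewrite ge0_integral_fsum//; last by move=> y x _; exact: nnfun_muleindic_ge0.
  apply: eq_fsbigr => y _.
  rewrite (@integralZl_indic _ _ _ _ _ measurableT (fun y => g n @^-1` [set y]))//.
    by rewrite integral_indic// setIT.
  by move=> y0; exact: preimage_nnfun0.
rewrite (eq_integral (fun x => \sum_(y \in range (g n)) ((y * \1_(g n @^-1` [set y]) x)%:E * (h x)%:E))); last first.
  move=> x _; rewrite /= fimfunE -fsumEFin// ge0_mule_fsuml// => y.
  exact: nnfun_muleindic_ge0.
rewrite ge0_integral_fsum//; last 2 first.
- by move=> y; exact: emeasurable_funM.
- by move=> y x _; rewrite mule_ge0 ?lee_fin//; exact: nnfun_muleindic_ge0.
apply: eq_fsbigr => y; rewrite inE => -[x0 _ gx0].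
have y0 : (0 <= y)%R by rewrite -gx0.
under [RHS]eq_integral do rewrite EFinM -muleA.
rewrite ge0_integralZl//; last 2 first.
- by apply: emeasurable_funM => //; apply/measurable_EFinP; exact: measurable_indic.
- by move=> x _; rewrite mule_ge0// lee_fin.
congr (_ * _); rewrite /dens integral_mkcond; apply: eq_integral => x _.
by rewrite /patch indicE; case: ifPn => _; rewrite ?mul1e ?mul0e.
Qed.

End Density.

Section Combination.
Context (dZ dT : measure_display) (Z : measurableType dZ) (T : measurableType dT) {R : realType}.
Variables (q : Z -> T) (mq : measurable_fun setT q).

(** [P] is the sum of the push-forwards by [q] of the measures with density [h j] with respect to
    [p j]. The formula is first obtained for nonnegative functions, then for [f] through its
    positive and negative parts. *)
Lemma comb_measure (m : nat) (p : nat -> {measure set Z -> \bar R}) (h : nat -> Z -> R) :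
  (forall j, measurable_fun setT (h j)) -> (forall j z, 0 <= h j z) ->
  exists P : {measure set T -> \bar R}, forall f : T -> R, measurable_fun setT f ->
    (forall j, itg (p j) (fun z => f (q z) * h j z)) ->
    itg P f /\ rint P setT f = \sum_(j < m) rint (p j) setT (fun z => f (q z) * h j z).
Proof.
move=> mh h0.
have /choice[D hD] : forall j, exists P : {measure set Z -> \bar R},
    forall f : Z -> \bar R, measurable_fun setT f -> (forall x, 0 <= f x)%E ->
    (\int[P]_x f x = \int[p j]_x (f x * (h j x)%:E))%E.
  by move=> j; exact: density_measure.
have /choice[E hE] : forall j, exists P : {measure set T -> \bar R},
    forall f : T -> \bar R, measurable_fun setT f -> (forall x, 0 <= f x)%E ->
    (\int[P]_x f x = \int[D j]_x f (q x))%E.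
  move=> j; unshelve eexists (pushforward (D j) q); first exact: mq.
  move=> f mf f0.
  by rewrite ge0_integral_pushforward.
exists (msum E m) => f mf fi.
have H (g : T -> R) : measurable_fun setT g -> (forall x, 0 <= g x) ->
    (\int[msum E m]_x (g x)%:E = \sum_(j < m) \int[p j]_z (g (q z) * h j z)%:E)%E.
  move=> mg g0; have mgE : measurable_fun setT (EFin \o g) by exact/measurable_EFinP.
  rewrite ge0_integral_measure_sum//; last by move=> x _; rewrite lee_fin.
  apply: eq_bigr => j _; rewrite hE// hD//.
    exact: (measurableT_comp mgE mq).
  by move=> z; rewrite lee_fin.
have nfi j (g : T -> R) : measurable_fun setT g -> (forall x, `|g x| <= `|f x|) ->
    itg (p j) (fun z => g (q z) * h j z).
  move=> mg gf; apply: (itg_le _ (itg_norm (fi j))).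
    by apply: measurable_funM => //; exact: (measurableT_comp mg mq).
  by move=> z; rewrite !normrM ler_wpM2r.
have mn : measurable_fun setT (fun x => `|f x|) by exact: measurableT_comp.
have pI : itg (msum E m) f.
  apply/integrableP; split; first exact/measurable_EFinP.
  under eq_integral do rewrite /=; rewrite H//.
  rewrite (eq_bigr (fun j : 'I_m => (rint (p j) setT (fun z => `|f (q z)| * h j z))%:E)).
    by rewrite sumEFin ltry.
  move=> j _; apply: rintE; apply: (nfi j (fun x => `|f x|) mn) => x.
  by rewrite normr_id.
split => //.
have pos (g : T -> R) : measurable_fun setT g -> (forall x, 0 <= g x) -> (forall x, `|g x| <= `|f x|) ->
    itg (msum E m) g /\ rint (msum E m) setT g = \sum_(j < m) rint (p j) setT (fun z => g (q z) * h j z).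
  move=> mg g0 gf; split.
    by apply: (itg_le mg (itg_norm pI)) => x; exact: gf.
  rewrite /rint H// (eq_bigr (fun j : 'I_m => (rint (p j) setT (fun z => g (q z) * h j z))%:E)).
    by rewrite sumEFin.
  by move=> j _; apply: rintE; exact: (nfi j g).
pose fp x : R := Num.max (f x) 0; pose fn x : R := Num.max (- f x) 0.
have mp : measurable_fun setT fp by exact: measurable_funrpos.
have mm : measurable_fun setT fn by exact: measurable_funrneg.
have fE x : f x = fp x - fn x.
  rewrite /fp /fn; have [f0|/ltW f0] := leP 0 (f x).
    by rewrite max_r ?oppr_le0// subr0.
  by rewrite max_l ?oppr_ge0// sub0r opprK.
have fp0 x : 0 <= fp x by rewrite le_max lexx orbT.
have fn0 x : 0 <= fn x by rewrite le_max lexx orbT.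
have fpf x : `|fp x| <= `|f x| by rewrite ger0_norm// /fp ge_max ler_norm normr_ge0.
have fnf x : `|fn x| <= `|f x| by rewrite ger0_norm// /fn ge_max -normrN ler_norm normr_ge0.
have [ip ep] := pos _ mp fp0 fpf; have [im em] := pos _ mm fn0 fnf.
rewrite (_ : f = fun x => fp x - fn x); last exact/funext.
rewrite rintB// ep em -sumrB; apply: eq_bigr => j _.
rewrite -rintB; [|exact: (nfi j fp)|exact: (nfi j fn)]; congr (rint _ _ _); apply/funext => z.
by rewrite mulrBl.
Qed.

End Combination.

(** * Integrals against set functions that are not known to be measures *)

Section SetFunctions.
Context (dsp : measure_display) (T : measurableType dsp) {R : realType}.
Local Open Scope ereal_scope.
Import HBNNSimple.
Implicit Type m : set T -> \bar R.

Lemma sintegral_setfunE m (f : T -> R) : m set0 = 0 ->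
  sintegral m f = \sum_(x \in range f) x%:E * m (f @^-1` [set x]).
Proof.
move=> m0; rewrite (fsbig_widen (range f) setT)//= => x [_ Nfx] /=.
by rewrite preimage10// m0 mule0.
Qed.

(** The growth condition is an integral against [tvar mu], which is treated only as a set function.
    The supremum over simple functions makes sense in that generality and gives monotonicity in the
    set function. *)
Lemma integral_setfunE m (f : T -> R) : m set0 = 0 -> (forall x, (0 <= f x)%R) ->
  \int[m]_x (f x)%:E =
  ereal_sup [set sintegral m h | h in [set h : {nnsfun T >-> R} | forall x, (h x <= f x)%R]].
Proof.
move=> m0 f0; rewrite /integral patch_setT.
have -> : (fun x => (f x)%:E)^\+ = EFin \o f.
  by apply/funext => x; rewrite funeposE max_l// lee_fin.
have -> : (fun x => (f x)%:E)^\- = cst 0.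
  by apply/funext => x; rewrite funenegE -EFinN max_r// lee_fin oppr_le0.
rewrite [X in _ - X](_ : _ = 0) ?sube0.
  by congr ereal_sup; apply/seteqP; split => _ [h hf <-]; exists h => // x; have := hf x; rewrite lee_fin.
have s0 (h : {nnsfun T >-> R}) : (forall x, (h x)%:E <= cst 0 x) -> sintegral m h = 0.
  move=> h0; rewrite sintegral_setfunE// fsbig1// => _ [x _ <-].
  suff -> : h x = 0%R by rewrite mul0e.
  by apply/eqP; rewrite eq_le fun_ge0 andbT -lee_fin h0.
apply/eqP; rewrite eq_le; apply/andP; split.
  by apply: ge_ereal_sup => _ [h h0 <-]; rewrite s0.
by apply: ereal_sup_ubound; exists nnsfun0 => //; exact: s0.
Qed.

Lemma le_integral_setfun m1 m2 (f : T -> R) : m1 set0 = 0 -> m2 set0 = 0 ->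
  (forall A, measurable A -> m1 A <= m2 A) -> (forall x, (0 <= f x)%R) ->
  \int[m1]_x (f x)%:E <= \int[m2]_x (f x)%:E.
Proof.
move=> m10 m20 m12 f0; rewrite !integral_setfunE//.
apply: ge_ereal_sup => _ [h hf <-].
apply: (@le_trans _ _ (sintegral m2 h)); last by apply: ereal_sup_ubound; exists h.
rewrite !sintegral_setfunE//; apply: lee_fsum => // _ [x _ <-].
by apply: lee_wpmul2l; [rewrite lee_fin|apply: m12; exact: measurable_sfunP].
Qed.

(** Markov's inequality, tested on the simple function [c] times the indicator of [B]. It turns the
    growth condition into finiteness of the total variation on bounded sets. *)
Lemma integral_setfun_lty m (f : T -> R) (c : R) B : m set0 = 0 -> (forall A, 0 <= m A) ->
  (forall x, (0 <= f x)%R) -> measurable B -> (0 < c)%R -> (forall x, B x -> (c <= f x)%R) ->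
  \int[m]_x (f x)%:E < +oo -> m B < +oo.
Proof.
move=> m0 mge f0 mB c0 cf fi.
have [->|/set0P[b Bb]] := eqVneq B set0; first by rewrite m0.
pose h : {nnsfun T >-> R} := scale_nnsfun (indic_nnsfun R mB) (ltW c0).
have hE x : h x = (c * \1_B x)%R by [].
have {}hE : (h : T -> R) = (fun x => (c * \1_B x)%R) by exact/funext.
have hB : h @^-1` [set c] = B.
  rewrite hE; apply/seteqP; split => x; rewrite /= indicE.
    by have [|_] := boolP (x \in B); rewrite ?inE// mulr0 => c0'; have := c0; rewrite -c0' ltxx.
  by move=> Bx; rewrite mem_set// mulr1.
have : c%:E * m B <= \int[m]_x (f x)%:E.
  rewrite integral_setfunE//; apply: (@le_trans _ _ (sintegral m h)); last first.
    apply: ereal_sup_ubound; exists h => // x; rewrite hE /= indicE.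
    by have [|_] := boolP (x \in B); rewrite ?inE ?mulr1 ?mulr0//; exact: cf.
  rewrite sintegral_setfunE// -{1}hB.
  apply: (@le_trans _ _ (\sum_(x \in [set c]) x%:E * m (h @^-1` [set x]))).
    by rewrite fsbig_set1.
  apply: lee_fsum_nneg_subset => //.
    by move=> x; rewrite !inE => ->; exists b => //; rewrite hE /= indicE mem_set// mulr1.
  move=> x; rewrite !inE => /andP[_]; rewrite inE => -[y _ <-].
  by rewrite mule_ge0// lee_fin.
move=> cm; rewrite ltey; apply/eqP => mBy; move: cm fi.
by rewrite mBy mulry gtr0_sg// mul1e leye_eq => /eqP ->; rewrite ltxx.
Qed.

End SetFunctions.

(** * Jordan decomposition of real set functions on bounded Borel sets *)

Section BoundedBorel.
Context {R : realType} (n : nat).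
Implicit Types A B : set 'rV[R]_n.

Lemma borel_boundedP A : borel_bounded A <->
  measurable A /\ exists M : R, forall x, A x -> `|x| <= M.
Proof.
split=> -[mA].
  move=> [M [Mr hM]]; split => //; exists (M + 1) => x Ax; apply: (hM (M + 1)) => //.
  by rewrite ltrDl.
move=> [M hM]; split => //; exists M; split; first exact: num_real.
by move=> k Mk x Ax; apply: le_trans (ltW Mk); exact: hM.
Qed.

Lemma sub_borel_bounded A B : measurable A -> borel_bounded B -> A `<=` B -> borel_bounded A.
Proof.
move=> mA /borel_boundedP[_ [M hM]] AB; apply/borel_boundedP; split => //.
by exists M => x /AB; exact: hM.
Qed.

Lemma borel_bounded0 : borel_bounded (set0 : set 'rV[R]_n).
Proof. by apply/borel_boundedP; split => //; exists 0 => x. Qed.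

Lemma borel_boundedU A B : borel_bounded A -> borel_bounded B -> borel_bounded (A `|` B).
Proof.
move=> /borel_boundedP[mA [M hM]] /borel_boundedP[mB [N hN]]; apply/borel_boundedP.
split; first exact: measurableU.
by exists (Num.max M N) => x [/hM|/hN]; rewrite le_max => ->; rewrite ?orbT.
Qed.

Definition cube (k : nat) : set 'rV[R]_n := [set x | `|x| <= k%:R].

Lemma measurable_cube k : measurable (cube k).
Proof.
have mN : measurable_fun setT (fun x : 'rV[R]_n => `|x|).
  by apply: continuous_measurable_row; exact: norm_continuous.
rewrite (_ : cube k = setT `&` (fun x : 'rV[R]_n => `|x|) @^-1` `]-oo, k%:R]%classic).
  by apply: mN.
by rewrite setTI; apply/seteqP; split => x; rewrite /= in_itv.
Qed.

Lemma borel_bounded_cube k : borel_bounded (cube k).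
Proof. by apply/borel_boundedP; split; [exact: measurable_cube|exists k%:R]. Qed.

Lemma bigcup_cube A : A = \bigcup_k (A `&` cube k).
Proof.
apply/seteqP; split => [x Ax|x [k _ []]//].
exists (Num.truncn `|x|).+1 => //; split => //.
by rewrite /cube /= ltW// truncnS_gt.
Qed.

Lemma nondecreasing_cube A : nondecreasing_seq (fun k => A `&` cube k).
Proof.
move=> k l kl; apply/subsetPset => x [Ax]; rewrite /cube /= => xk; split => //=.
by apply: le_trans xk _; rewrite ler_nat.
Qed.

(** Boundedness of sets refers to the maximum norm, the weights to the Euclidean one. *)
Lemma sqnorm_le_norm (x : 'rV[R]_n) : sqnorm x <= n%:R * `|x| ^+ 2.
Proof.
apply: (@le_trans _ _ (\sum_(i < n) `|x| ^+ 2)); last by rewrite sumr_const card_ord mulr_natl.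
apply: ler_sum => i _; rewrite -[leLHS]real_normK ?num_real// ler_sqr ?nnegrE//.
by rewrite [leRHS]mx_normrE; apply/bigmax_geP; right; exists (0, i).
Qed.

End BoundedBorel.

Section PositiveVariation.
Context {R : realType} (n : nat).
Implicit Types A B : set 'rV[R]_n.

Definition rradon (r : set 'rV[R]_n -> R) := forall F : nat -> set 'rV[R]_n,
  (forall k, measurable (F k)) -> trivIset setT F -> bounded_set (\bigcup_k F k) ->
  (\sum_(0 <= k < N) r (F k)) @[N --> \oo] --> r (\bigcup_k F k).

Lemma rradonN r : rradon r -> rradon (fun A => - r A).
Proof.
move=> hr F mF tF bF; under eq_fun do rewrite sumrN.
by apply: cvgN; exact: hr.
Qed.

Variables (r : set 'rV[R]_n -> R) (hr : rradon r).

(** Countable additivity on a constant sequence of empty sets: the terms of a convergent series tend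
    to 0. *)
Lemma rradon0 : r set0 = 0.
Proof.
have [_ b0] := @borel_bounded0 R n.
have := hr (F := fun=> set0) (fun=> measurable0) (@trivIset_set0 nat _ setT).
rewrite bigcup0// => /(_ b0) h.
have h1 : (\sum_(0 <= k < N.+1) r set0) @[N --> \oo] --> r set0.
  by rewrite (cvg_shiftS (fun N => \sum_(0 <= k < N) r set0)).
have h2 : (\sum_(0 <= k < N.+1) r set0 - \sum_(0 <= k < N) r set0) @[N --> \oo] --> r set0 - r set0.
  exact: cvgB.
rewrite subrr in h2; apply: (cvg_unique _ _ h2) => //.
rewrite (_ : (fun _ => _) = cst (r set0)); first exact: cvg_cst.
by apply/funext => N; rewrite big_nat_recr//= [X in X - _]addrC addrK.
Qed.

Lemma rradonU A B : borel_bounded A -> borel_bounded B -> A `&` B = set0 ->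
  r (A `|` B) = r A + r B.
Proof.
move=> bA bB AB.
have [mA _] := bA; have [mB _] := bB; have [_ bAB] := borel_boundedU bA bB.
have mF : forall k, measurable (bigcup2 A B k) by move=> [|[|k]] /=.
have := hr mF; rewrite bigcup2E => /(_ _ bAB) h.
rewrite -trivIset_bigcup2 in h; have {}h := h AB.
have h2 : (\sum_(0 <= k < N.+2) r (bigcup2 A B k)) @[N --> \oo] --> r (A `|` B).
  by rewrite (cvg_shiftS (fun N => \sum_(0 <= k < N.+1) r (bigcup2 A B k)))
             (cvg_shiftS (fun N => \sum_(0 <= k < N) r (bigcup2 A B k))).
apply: (cvg_unique _ h2) => //.
rewrite (_ : (fun _ => _) = cst (r A + r B)); first exact: cvg_cst.
apply/funext => N; rewrite 2?big_nat_recl//= big1 ?addr0// => k _.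
exact: rradon0.
Qed.

Lemma rradonD A B : borel_bounded A -> measurable B -> r A = r (A `&` B) + r (A `\` B).
Proof.
move=> bA mB; have [mA _] := bA; rewrite -rradonU ?setUIDK//.
- by apply: (sub_borel_bounded _ bA) => //; exact: measurableI.
- by apply: (sub_borel_bounded _ bA) => //; exact: measurableD.
- by rewrite setDE setIACA setICr setI0.
Qed.

Local Open Scope ereal_scope.

Lemma pvar_ub A B : borel_bounded B -> B `<=` A -> (r B)%:E <= pvar r A.
Proof. by move=> bB BA; apply: ereal_sup_ubound; exists B. Qed.

Lemma pvar_le A x : (forall B, borel_bounded B -> B `<=` A -> (r B)%:E <= x) -> pvar r A <= x.
Proof. by move=> h; apply: ge_ereal_sup => _ [B [bB BA] <-]; exact: h. Qed.

Lemma pvar_ge0 A : 0 <= pvar r A.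
Proof. by have := @pvar_ub A set0 (borel_bounded0 _) (@sub0set _ A); rewrite rradon0. Qed.

Lemma pvar_mono A B : A `<=` B -> pvar r A <= pvar r B.
Proof. by move=> AB; apply: pvar_le => C bC CA; apply: pvar_ub => //; exact: subset_trans AB. Qed.

Lemma pvar0 : pvar r set0 = 0.
Proof.
apply/eqP; rewrite eq_le pvar_ge0 andbT; apply: pvar_le => B _.
by rewrite subset0 => ->; rewrite rradon0.
Qed.

Lemma pvar_superadd A B : A `&` B = set0 -> pvar r A + pvar r B <= pvar r (A `|` B).
Proof.
move=> AB; have [/eqP Ay|Afin] := boolP (pvar r A == +oo).
  have -> : pvar r (A `|` B) = +oo.
    by apply/eqP; rewrite -leye_eq -Ay; apply: pvar_mono; exact: subsetUl.
  by rewrite leey.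
have fA : pvar r A \is a fin_num by rewrite ge0_fin_numE ?pvar_ge0// lt_neqAle Afin leey.
rewrite -leeBrDl//; apply: pvar_le => C bC CB; rewrite leeBrDl//.
rewrite -leeBrDr//; apply: pvar_le => D bD DA; rewrite leeBrDr//.
rewrite -EFinD -rradonU//; last first.
  by apply/seteqP; split => // x [Dx Cx]; rewrite -AB; split; [exact: DA|exact: CB].
by apply: pvar_ub; [exact: borel_boundedU|exact: setUSS].
Qed.

(** For the upper bound, a bounded [B] inside the union is cut along the [F k], and the additivity
    of [r] applies to the pieces. The lower bound is finite superadditivity. *)
Lemma pvar_sigma_additive : semi_sigma_additive (pvar r).
Proof.
move=> F mF tF mUF.
have cv : cvg ((\sum_(0 <= k < N) pvar r (F k)) @[N --> \oo]).
  by apply: is_cvg_ereal_nneg_natsum => k _; exact: pvar_ge0.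
suff -> : pvar r (\bigcup_k F k) = lim ((\sum_(0 <= k < N) pvar r (F k)) @[N --> \oo]) by [].
apply/eqP; rewrite eq_le; apply/andP; split.
  apply: pvar_le => B bB BF; have [mB _] := bB.
  have E : \bigcup_k (B `&` F k) = B.
    by rewrite -setI_bigcupr; exact: setIidl.
  have := @hr (fun k => B `&` F k); rewrite E => /(_ _ _ bB.2) h.
  have {}h : (\sum_(0 <= k < N) (r (B `&` F k))%:E) @[N --> \oo] --> (r B)%:E.
    under eq_fun do rewrite sumEFin; apply/fine_cvgP; split; first exact: nearW.
    apply: h => [k|]; first exact: measurableI.
    by apply: trivIset_setIl.
  rewrite -(cvg_lim _ h)//; apply: lee_lim => //; first by apply/cvg_ex; exists (r B)%:E.
  apply: nearW => N; apply: lee_sum => k _; apply: pvar_ub => //.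
  apply: (sub_borel_bounded _ bB) => //; exact: measurableI.
apply: lime_le => //; apply: nearW => N.
have h : \sum_(0 <= k < N) pvar r (F k) <= pvar r (\big[setU/set0]_(k < N) F k).
  elim: N => [|N IH]; first by rewrite big_nil big_ord0 pvar0.
  rewrite big_nat_recr//= big_ord_recr/=; apply: le_trans (pvar_superadd _).
    by rewrite leeD2r.
  by apply: (@trivIset_bigsetUI _ xpredT F) => // i j _ _; exact: tF.
apply: le_trans h _; apply: pvar_mono.
by rewrite -bigcup_mkord => x [k _ Fx]; exists k.
Qed.

End PositiveVariation.

Section Jordan.
Context {R : realType} (n : nat).
Implicit Types A B : set 'rV[R]_n.

(** An equality of set functions, so that [pvar r] can be replaced by a bundled measure inside an
    integral. *)
Lemma pvar_measure (r : set 'rV[R]_n -> R) : rradon r ->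
  exists P : {measure set 'rV[R]_n -> \bar R}, pvar r = P.
Proof.
move=> hr.
pose m := isMeasure.Build _ _ _ (pvar r) (pvar0 hr) (pvar_ge0 hr) (pvar_sigma_additive hr).
exists (HB.pack_for {measure set 'rV[R]_n -> \bar R} (pvar r) m).
by [].
Qed.

Local Open Scope ereal_scope.

(** A bounded [B] inside [A] is compared with its complement through r B = r A - r (A \ B). The
    additive form avoids a difference of possibly infinite values. *)
Lemma jordan (r : set 'rV[R]_n -> R) A : rradon r -> borel_bounded A ->
  pvar r A = (r A)%:E + pvar (fun B => - r B)%R A.
Proof.
move=> hr bA; apply/eqP; rewrite eq_le; apply/andP; split.
  apply: pvar_le => B bB BA; have [mB _] := bB.
  rewrite (rradonD hr bA mB) setIidr// EFinD -addeA leeDl// -leeBlDl// sub0e -EFinN.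
  apply: pvar_ub; last exact: subDsetl.
  by apply: (sub_borel_bounded _ bA) => //; apply: measurableD => //; case: bA.
rewrite -leeBrDl//; apply: pvar_le => B bB BA; have [mB _] := bB.
rewrite leeBrDl// -EFinD (rradonD hr bA mB) setIidr// addrAC subrr add0r.
apply: pvar_ub; last exact: subDsetl.
by apply: (sub_borel_bounded _ bA) => //; apply: measurableD => //; case: bA.
Qed.

(* Both [pvar r + q] and [pvar (- r) + p] are measures, and they agree on bounded sets. *)
Lemma sint_diff (r : set 'rV[R]_n -> R) (p q : {measure set 'rV[R]_n -> \bar R}) (f : 'rV[R]_n -> R) :
  rradon r -> (forall A, borel_bounded A -> [/\ p A < +oo, q A < +oo & r A = (fine (p A) - fine (q A))%R]) ->
  itg p f -> itg q f -> sint r setT f = (rint p setT f - rint q setT f)%R.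
Proof.
move=> hr hpq ip iq.
have hrN := rradonN hr.
have [P EP] := pvar_measure hr; have [Q EQ] := pvar_measure hrN.
have fp A : borel_bounded A -> p A \is a fin_num.
  by case/hpq => h _ _; rewrite ge0_fin_numE.
have fq A : borel_bounded A -> q A \is a fin_num.
  by case/hpq => _ h _; rewrite ge0_fin_numE.
(* The data concern bounded sets only; continuity from below along the cubes extends a comparison of
   measures to all Borel sets. *)
have le_ext (m1 m2 : {measure set 'rV[R]_n -> \bar R}) : (forall A, borel_bounded A -> m1 A <= m2 A) ->
    forall A, measurable A -> m1 A <= m2 A.
  move=> h A mA; rewrite (bigcup_cube A).
  have mAk k : measurable (A `&` cube k) by apply: measurableI => //; exact: measurable_cube.
  have bAk k : borel_bounded (A `&` cube k).
    by apply: (sub_borel_bounded (mAk k) (borel_bounded_cube n k)) => x [].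
  have mU : measurable (\bigcup_k (A `&` cube k)) by exact: bigcup_measurable.
  have c1 := nondecreasing_cvg_mu (mu := m1) mAk mU (nondecreasing_cube A).
  have c2 := nondecreasing_cvg_mu (mu := m2) mAk mU (nondecreasing_cube A).
  rewrite -(cvg_lim _ c1)// -(cvg_lim _ c2)//.
  apply: lee_lim; [by apply/cvg_ex; eexists; exact: c1|by apply/cvg_ex; eexists; exact: c2|].
  apply: nearW => k; apply: h.
  exact: bAk.
have rpq A : borel_bounded A -> (r A)%:E = p A - q A.
  move=> bA; have [_ _ ->] := hpq A bA.
  by rewrite EFinB !fineK ?fp ?fq.
(* The positive variations form the smallest decomposition, hence lie below [p] and [q]. This gives
   the integrability of [f] against them. *)
have Pp : forall A, measurable A -> P A <= p A.
  apply: le_ext => A bA; rewrite -EP; apply: pvar_le => B bB BA; rewrite rpq//.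
  rewrite leeBlDr ?fq//; apply: (@le_trans _ _ (p A)); last by rewrite leeDl.
  by apply: le_measure => //; rewrite inE; [case: bB|case: bA].
have Qq : forall A, measurable A -> Q A <= q A.
  apply: le_ext => A bA; rewrite -EQ; apply: pvar_le => B bB BA; rewrite EFinN rpq//.
  rewrite fin_num_oppeB ?fp ?fq// addeC leeBlDr ?fp//; apply: (@le_trans _ _ (q A)); last by rewrite leeDl.
  by apply: le_measure => //; rewrite inE; [case: bB|case: bA].
have iP : itg P f.
  apply/integrableP; split; first by case/integrableP: ip.
  apply: le_lt_trans (_ : \int[p]_x `|(f x)%:E| < +oo); last by case/integrableP: ip.
  exact: le_integral_setfun.
have iQ : itg Q f.
  apply/integrableP; split; first by case/integrableP: iq.
  apply: le_lt_trans (_ : \int[q]_x `|(f x)%:E| < +oo); last by case/integrableP: iq.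
  exact: le_integral_setfun.
have E1 A : borel_bounded A -> P A + q A = Q A + p A.
  move=> bA; rewrite -EP -EQ (jordan hr bA) rpq//.
  by rewrite addeAC subeK ?fq// addeC.
have E2 : forall A, measurable A -> measure_add P q A = measure_add Q p A.
  have E1' B : borel_bounded B -> measure_add P q B = measure_add Q p B.
    by move=> bB; rewrite !measure_addE E1.
  have eqle (x y : \bar R) : x = y -> x <= y by move=> ->.
  move=> A mA; apply/eqP; rewrite eq_le; apply/andP; split.
    by apply: (le_ext (measure_add P q) (measure_add Q p)) => // B /E1'/eqle; apply.
  by apply: (le_ext (measure_add Q p) (measure_add P q)) => // B /E1'/esym/eqle; apply.
have : \int[measure_add P q]_x (f x)%:E = \int[measure_add Q p]_x (f x)%:E.
  by apply: eq_measure_integral => A mA _; exact: E2.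
rewrite (integral_measure_add measurableT iP iq) (integral_measure_add measurableT iQ ip).
rewrite (rintE iP) (rintE iQ) (rintE ip) (rintE iq) -!EFinD => -[e].
by rewrite /sint EP EQ; lra.
Qed.

End Jordan.

Section JordanParts.
Context {R : realType}.
Implicit Types z : R[i].

(** Coefficients and positive parts with z = jpart 0 - jpart 1 + i (jpart 2 - jpart 3). The indices
    are natural numbers, with value 0 from 4 on, so that they can label the sequences of measures
    below. *)
Definition jc (k : nat) : R[i] := nth 0 [:: 1; -1; 'i%C; - 'i%C] k.
Definition jpart (k : nat) z : R := Num.max (nth 0 [:: re z; - re z; im z; - im z] k) 0.

Lemma jpart_ge0 k z : 0 <= jpart k z. Proof. by rewrite le_max lexx orbT. Qed.

Lemma jpart_le k z : jpart k z <= normc z.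
Proof.
rewrite ge_max normc_ge0 andbT.
have hr := normc_ge_re z; have hi := normc_ge_im z.
case: k => [|[|[|[|k]]]] /=; rewrite ?nth_nil ?normc_ge0//.
- by apply: le_trans hr; exact: ler_norm.
- by apply: le_trans hr; rewrite -normrN; exact: ler_norm.
- by apply: le_trans hi; exact: ler_norm.
- by apply: le_trans hi; rewrite -normrN; exact: ler_norm.
Qed.

Lemma jpartE z : z = \sum_(k < 4) jc k * (jpart k z)%:C.
Proof.
have maxB (x : R) : Num.max x 0 - Num.max (- x) 0 = x.
  have [x0|/ltW x0] := leP 0 x; first by rewrite max_r ?oppr_le0// subr0.
  by rewrite max_l ?oppr_ge0// sub0r opprK.
rewrite !big_ord_recl big_ord0 /jc /jpart /= addr0.
apply: eqC; rewrite !reimE /=; [rewrite -[LHS]maxB|rewrite -[LHS]maxB]; ring.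
Qed.

Lemma measurable_jpart (dsp : measure_display) (T : measurableType dsp) (f : T -> R[i]) k :
  cmeas f -> measurable_fun setT (fun x => jpart k (f x)).
Proof.
move=> [fr fi]; apply: measurable_maxr; last exact: measurable_cst.
case: k => [|[|[|[|k]]]] //=.
- exact: measurableT_comp.
- exact: measurableT_comp.
Qed.

End JordanParts.

Section ComplexSums.
Context (dsp : measure_display) (T : measurableType dsp) {R : realType}.
Variable mu : {measure set T -> \bar R}.

Lemma lint_sum (I : Type) (s : seq I) (F : I -> T -> R[i]) : (forall i, citg mu (F i)) ->
  citg mu (fun x => \sum_(i <- s) F i x) /\
  lint mu setT (fun x => \sum_(i <- s) F i x) = \sum_(i <- s) lint mu setT (F i).
Proof.
move=> hF; elim: s => [|i s [IH1 IH2]].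
  under eq_fun do rewrite big_nil; rewrite big_nil lint0; split => //.
  by split; exact: itg0.
under eq_fun do rewrite big_cons; rewrite big_cons lintD// IH2; split => //.
exact: citgD.
Qed.

Lemma lint_jpart (f psi : T -> R[i]) : cmeas f -> cmeas psi -> citg mu (fun x => psi x * f x) ->
  lint mu setT (fun x => psi x * f x) =
    \sum_(k < 4) jc k * lint mu setT (fun x => psi x * (jpart k (f x))%:C).
Proof.
move=> mf mpsi hf.
have ik k : citg mu (fun x => psi x * (jpart k (f x))%:C).
  apply: (citg_le _ (citg_normc hf)).
    by apply: cmeasM => //; apply: cmeas_real; exact: measurable_jpart.
  move=> x; rewrite !ComplexField.Normc.normcM ler_wpM2l ?normc_ge0// normcR ger0_norm ?jpart_ge0//.
  exact: jpart_le.
have iZ (k : 'I_4) : citg mu (fun x => jc k * (psi x * (jpart k (f x))%:C)) by exact: citgZ.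
have [_] := lint_sum (index_enum 'I_4) iZ.
rewrite (_ : (fun x => _) = fun x => psi x * f x).
  by move=> ->; apply: eq_bigr => k _; rewrite lintZ.
apply/funext => x; rewrite [in RHS](jpartE (f x)) mulr_sumr.
by apply: eq_bigr => k _; exact: mulrCA.
Qed.

End ComplexSums.

Section ComplexCombination.
Context (dZ dT : measure_display) (Z : measurableType dZ) (T : measurableType dT) {R : realType}.
Variables (q : Z -> T) (mq : measurable_fun setT q).

(* The [P k] are the Jordan parts of the push-forward by [q] of the complex
   measure [\sum_j F j * p j]. *)
Lemma comb_measureC (m : nat) (p : nat -> {measure set Z -> \bar R}) (F : nat -> Z -> R[i]) :
  (forall j, cmeas (F j)) ->
  exists P : nat -> {measure set T -> \bar R}, forall psi : T -> R[i], cmeas psi ->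
    (forall j, citg (p j) (fun z => psi (q z) * F j z)) ->
    (forall k, citg (P k) psi) /\
    \sum_(k < 4) jc k * lint (P k) setT psi =
    \sum_(j < m) lint (p j) setT (fun z => psi (q z) * F j z).
Proof.
move=> mF.
have /choice[P hP] : forall k, exists P : {measure set T -> \bar R},
  forall f : T -> R, measurable_fun setT f ->
    (forall j, itg (p j) (fun z => f (q z) * jpart k (F j z))) ->
    itg P f /\ rint P setT f = \sum_(j < m) rint (p j) setT (fun z => f (q z) * jpart k (F j z)).
  move=> k; apply: (comb_measure mq m p (h := fun j z => jpart k (F j z))) => [j|j z].
    exact: measurable_jpart.
  exact: jpart_ge0.
exists P => psi [mr mi] hpsi.
have mpq : cmeas (fun z => psi (q z)).
  by split; [exact: (measurableT_comp mr mq)|exact: (measurableT_comp mi mq)].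
have hc k j : citg (p j) (fun z => psi (q z) * (jpart k (F j z))%:C).
  apply: (citg_le _ (citg_normc (hpsi j))).
    by apply: cmeasM => //; apply: cmeas_real; exact: measurable_jpart.
  move=> x; rewrite !ComplexField.Normc.normcM ler_wpM2l ?normc_ge0// normcR ger0_norm ?jpart_ge0//.
  exact: jpart_le.
have reE k j z : re (psi (q z) * (jpart k (F j z))%:C) = re (psi (q z)) * jpart k (F j z).
  by rewrite re_mul /= mulr0 subr0.
have imE k j z : im (psi (q z) * (jpart k (F j z))%:C) = im (psi (q z)) * jpart k (F j z).
  by rewrite im_mul /= mulr0 add0r.
have hr k j : itg (p j) (fun z => re (psi (q z)) * jpart k (F j z)).
  by have [h _] := hc k j; under eq_fun do rewrite -reE.
have hi k j : itg (p j) (fun z => im (psi (q z)) * jpart k (F j z)).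
  by have [_ h] := hc k j; under eq_fun do rewrite -imE.
split=> [k|].
  by split; [have [] := hP k _ mr (hr k)|have [] := hP k _ mi (hi k)].
have E (k : nat) : lint (P k) setT psi = \sum_(j < m) lint (p j) setT (fun z => psi (q z) * (jpart k (F j z))%:C).
  have [_ er] := hP k _ mr (hr k); have [_ ei] := hP k _ mi (hi k).
  apply: eqC; rewrite ?re_lint ?im_lint ?er ?ei.
    rewrite (big_morph _ (@re_add R) (erefl : re 0 = 0)); apply: eq_bigr => j _.
    by rewrite re_lint; under [in RHS]eq_fun do rewrite reE.
  rewrite (big_morph _ (@im_add R) (erefl : im 0 = 0)); apply: eq_bigr => j _.
  by rewrite im_lint; under [in RHS]eq_fun do rewrite imE.
under eq_bigr do rewrite E mulr_sumr.
rewrite exchange_big /=; apply: eq_bigr => j _.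
by rewrite [RHS]lint_jpart.
Qed.

End ComplexCombination.

(** * Slow-growing measures as combinations of four positive measures *)

Section JordanRepresentation.
Context {R : realType} (n : nat).
Implicit Types (A B : set 'rV[R]_n) (mu : set 'rV[R]_n -> R[i]).
Implicit Types p : nat -> {measure set 'rV[R]_n -> \bar R}.

Definition pw (N : nat) (x : 'rV[R]_n) : R := ((1 + sqnorm x) ^+ N)^-1.

Lemma pw_gt0 N x : 0 < pw N x.
Proof. by rewrite invr_gt0 exprn_gt0// sqnormD1_gt0. Qed.

Lemma measurable_pw N : measurable_fun setT (pw N).
Proof.
apply: continuous_measurable_row => x.
apply: (@continuous_comp _ _ _ (@sqnorm R n) (fun t : R => ((1 + t) ^+ N)^-1)).
  exact: continuous_sqnorm.
apply: cvgV; first by rewrite expf_neq0// gt_eqF// sqnormD1_gt0.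
apply: (@continuous_comp _ _ _ (fun t : R => 1 + t) (fun t => t ^+ N)); last exact: exprn_continuous.
by apply: cvgD; [exact: cvg_cst|exact: cvg_id].
Qed.

(* On bounded sets [mu] is [p 0 - p 1 + i (p 2 - p 3)]. *)
Definition jrep mu p := forall A, borel_bounded A ->
  (forall j, (p j A < +oo)%E) /\ mu A = \sum_(j < 4) jc j * (fine (p j A))%:C.

Lemma jrep_re mu p A : jrep mu p -> borel_bounded A -> re (mu A) = fine (p 0 A) - fine (p 1 A).
Proof.
move=> mp bA; have [_ ->] := mp A bA.
by rewrite !big_ord_recl big_ord0 /jc !reimE /=; ring.
Qed.

Lemma jrep_im mu p A : jrep mu p -> borel_bounded A -> im (mu A) = fine (p 2 A) - fine (p 3 A).
Proof.
move=> mp bA; have [_ ->] := mp A bA.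
by rewrite !big_ord_recl big_ord0 /jc !reimE /=; ring.
Qed.

Lemma rradon_diff (r : set 'rV[R]_n -> R) (m1 m2 : {measure set 'rV[R]_n -> \bar R}) :
  (forall A, borel_bounded A -> [/\ (m1 A < +oo)%E, (m2 A < +oo)%E & r A = fine (m1 A) - fine (m2 A)]) ->
  rradon r.
Proof.
move=> h F mF tF bF.
have bU : borel_bounded (\bigcup_k F k) by split => //; exact: bigcup_measurable.
have bFk k : borel_bounded (F k) by apply: (sub_borel_bounded (mF k) bU) => x Fx; exists k.
have cv (m : {measure set 'rV[R]_n -> \bar R}) : (forall A, borel_bounded A -> (m A < +oo)%E) ->
    (\sum_(0 <= k < N) fine (m (F k))) @[N --> \oo] --> fine (m (\bigcup_k F k)).
  move=> mfin; have mf A : borel_bounded A -> m A \is a fin_num.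
    by move=> bA; rewrite ge0_fin_numE// mfin.
  have := @measure_semi_sigma_additive _ _ _ m F mF tF bU.1.
  rewrite -(fineK (mf _ bU)) (_ : (fun N => _) = fun N => (\sum_(0 <= k < N) fine (m (F k)))%:E).
    by move/fine_cvg.
  apply/funext => N; rewrite -sumEFin; apply: eq_bigr => k _.
  by rewrite fineK// mf.
have [_ _ ->] := h _ bU.
rewrite (_ : (fun N => _) = fun N => \sum_(0 <= k < N) fine (m1 (F k)) - \sum_(0 <= k < N) fine (m2 (F k))).
  by apply: cvgB; apply: cv => A /h[].
by apply/funext => N; rewrite -sumrB; apply: eq_bigr => k _; have [_ _ ->] := h _ (bFk k).
Qed.

Lemma jrep_radon mu p : jrep mu p -> rradon (fun A => re (mu A)) /\ rradon (fun A => im (mu A)).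
Proof.
move=> mp; split.
  apply: (@rradon_diff _ (p 0) (p 1)) => A bA; have [h _] := mp A bA.
  by split; [exact: h|exact: h|exact: jrep_re].
apply: (@rradon_diff _ (p 2) (p 3)) => A bA; have [h _] := mp A bA.
by split; [exact: h|exact: h|exact: jrep_im].
Qed.

(** Any representation by four positive measures computes [cint], not only the one by positive
    variations. Hence representations of products and push-forwards need no minimality. *)
Lemma cint_jrep mu p (f : 'rV[R]_n -> R[i]) : jrep mu p -> (forall j, citg (p j) f) ->
  cint mu setT f = \sum_(j < 4) jc j * lint (p j) setT f.
Proof.
move=> mp hf; have [rr ri] := jrep_radon mp.
have sr (u : 'rV[R]_n -> R) : (forall j, itg (p j) u) ->
    sint (fun A => re (mu A)) setT u = rint (p 0) setT u - rint (p 1) setT u.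
  move=> hu; apply: sint_diff => // A bA; have [h _] := mp A bA.
  by split; [exact: h|exact: h|exact: jrep_re].
have si (u : 'rV[R]_n -> R) : (forall j, itg (p j) u) ->
    sint (fun A => im (mu A)) setT u = rint (p 2) setT u - rint (p 3) setT u.
  move=> hu; apply: sint_diff => // A bA; have [h _] := mp A bA.
  by split; [exact: h|exact: h|exact: jrep_im].
have fr j : itg (p j) (fun x => re (f x)) by case: (hf j).
have fi j : itg (p j) (fun x => im (f x)) by case: (hf j).
rewrite /cint !sr// !si//.
rewrite !big_ord_recl big_ord0 /jc /bump /=.
by apply: eqC; rewrite !reimE !re_lint !im_lint /=; ring.
Qed.

Lemma tvar0 mu : mu set0 = 0 -> tvar mu set0 = 0%E.
Proof.
move=> mu0; apply/eqP; rewrite eq_le; apply/andP; split.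
  apply: ge_ereal_sup => _ [k [B [hB _ ->]]].
  rewrite big1// => i _; have [_] := hB i; rewrite subset0 => ->.
  by rewrite mu0 ComplexField.Normc.normc0.
apply: ereal_sup_ubound; exists 0, (fun=> set0); split => [[]//||]; first exact: trivIset_set0.
by rewrite big_ord0.
Qed.

Lemma tvar_ub mu A B : borel_bounded B -> B `<=` A -> ((normc (mu B))%:E <= tvar mu A)%E.
Proof.
move=> bB BA; apply: ereal_sup_ubound; exists 1, (fun=> B); split => //.
  by move=> i j _ _ _; rewrite !ord1.
by rewrite big_ord1.
Qed.

Lemma tvar_ge0 mu A : mu set0 = 0 -> (0 <= tvar mu A)%E.
Proof.
move=> mu0; have := @tvar_ub mu A set0 (borel_bounded0 _) (@sub0set _ A).
by rewrite mu0 ComplexField.Normc.normc0.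
Qed.

(** The four measures are the positive variations of plus and minus the real and imaginary parts.
    Each lies below [tvar mu], which yields finiteness on bounded sets and the integrability of the
    weight. *)
Lemma slow_growing_jrep mu : slow_growing mu -> exists p N,
  jrep mu p /\ forall j, itg (p j) (pw N).
Proof.
move=> [cr [N hN]].
have rr : rradon (fun A => re (mu A)) by move=> F mF tF bF; case: (cr F mF tF bF).
have ri : rradon (fun A => im (mu A)) by move=> F mF tF bF; case: (cr F mF tF bF).
have mu0 : mu set0 = 0 by apply: eqC; [exact: (rradon0 rr)|exact: (rradon0 ri)].
pose s (j : nat) (A : set 'rV[R]_n) : R := nth 0 [:: re (mu A); - re (mu A); im (mu A); - im (mu A)] j.
have rs j : (j < 4)%N -> rradon (s j).
  by case: j => [|[|[|[|j]]]] // _; exact: rradonN.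
have sle j A : s j A <= normc (mu A).
  apply: le_trans (jpart_le j (mu A)); rewrite /jpart le_max; apply/orP; left.
  by case: j => [|[|[|[|j]]]] //=; rewrite nth_nil.
(* The zero measure beyond index 3 lets the later bounds hold for every [j]. *)
have /choice[p hp] : forall j, exists P : {measure set 'rV[R]_n -> \bar R},
    if (j < 4)%N then pvar (s j) = P else forall A, P A = 0%E.
  move=> j; have [j4|_] := boolP (j < 4)%N; last by exists mzero.
  by have [P hP] := pvar_measure (rs j j4); exists P.
have ple j A : (p j A <= tvar mu A)%E.
  have [j4|] := boolP (j < 4)%N.
    have := hp j; rewrite j4 => <-; apply: pvar_le => B bB BA.
    by apply: (@le_trans _ _ (normc (mu B))%:E); [rewrite lee_fin|exact: tvar_ub].
  by move=> j4; have := hp j; rewrite (negbTE j4) => ->; exact: tvar_ge0.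
have tfin A : borel_bounded A -> (tvar mu A < +oo)%E.
  move=> /borel_boundedP[mA [M hM]].
  apply: (@integral_setfun_lty _ _ _ _ (pw N) ((1 + n%:R * M ^+ 2) ^+ N)^-1 A _ _ _ mA _ _ hN).
  - exact: tvar0.
  - by move=> B; exact: tvar_ge0.
  - by move=> x; exact/ltW/pw_gt0.
  - by rewrite invr_gt0 exprn_gt0// ltr_wpDr// mulr_ge0// sqr_ge0.
  - move=> x Ax; rewrite /pw lef_pV2 ?posrE ?exprn_gt0 ?sqnormD1_gt0//; last first.
      by rewrite ltr_wpDr// mulr_ge0// sqr_ge0.
    apply: lerXn2r; rewrite ?nnegrE; [exact/ltW/sqnormD1_gt0|by rewrite addr_ge0// mulr_ge0// sqr_ge0|].
    rewrite lerD2l; apply: le_trans (sqnorm_le_norm x) _.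
    rewrite ler_wpM2l// ler_sqr ?nnegrE//; first exact: hM.
    by apply: le_trans (hM x Ax).
exists p, N; split=> [A bA|j].
  have pfin j : (p j A < +oo)%E by apply: le_lt_trans (ple j A) (tfin A bA).
  have pf j : p j A \is a fin_num by rewrite ge0_fin_numE.
  split=> //.
  have er : re (mu A) = fine (p 0 A) - fine (p 1 A).
    have := jordan rr bA; rewrite (hp 0) (hp 1) -(fineK (pf 0)) -(fineK (pf 1)) -EFinD => -[->].
    by rewrite addrK.
  have ei : im (mu A) = fine (p 2 A) - fine (p 3 A).
    have := jordan ri bA; rewrite (hp 2) (hp 3) -(fineK (pf 2)) -(fineK (pf 3)) -EFinD => -[->].
    by rewrite addrK.
  rewrite !big_ord_recl big_ord0 /jc /bump /=.
  by apply: eqC; rewrite !reimE /= ?er ?ei; ring.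
apply/integrableP; split; first by apply/measurable_EFinP; exact: measurable_pw.
under eq_integral do rewrite /= gtr0_norm ?pw_gt0//.
apply: le_lt_trans hN; apply: le_integral_setfun => //.
- exact: tvar0.
- by move=> x; exact/ltW/pw_gt0.
Qed.

(** On measurable sets the total variation is at most p 0 + p 1 + p 2 + p 3, since the coefficients
    have modulus 1; integrals of set functions are monotone. *)
Lemma jrep_slow_growing mu p N : jrep mu p -> (forall j, itg (p j) (pw N)) -> slow_growing mu.
Proof.
move=> mp ip; have [rr ri] := jrep_radon mp.
have mu0 : mu set0 = 0 by apply: eqC; [exact: (rradon0 rr)|exact: (rradon0 ri)].
split; first by move=> F mF tF bF; split; [exact: rr|exact: ri].
exists N; apply: (@le_lt_trans _ _ (\int[msum p 4]_x (pw N x)%:E)%E); last first.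
  rewrite ge0_integral_measure_sum//; last 2 first.
  - by move=> x _; rewrite lee_fin; exact/ltW/pw_gt0.
  - by apply/measurable_EFinP; exact: measurable_pw.
  rewrite (eq_bigr (fun j : 'I_4 => (rint (p j) setT (pw N))%:E)) ?sumEFin ?ltry// => j _.
  exact: rintE.
apply: le_integral_setfun => //; [exact: tvar0| |by move=> x; exact/ltW/pw_gt0].
move=> A mA; apply: ge_ereal_sup => _ [k [B [hB tB ->]]].
have mB i : measurable (B i) by case: (hB i) => -[].
apply: (@le_trans _ _ (\sum_(i < k) msum p 4 (B i))%E).
  rewrite -sumEFin; apply: lee_sum => i _.
  have [bB _] := hB i; have [pfin ->] := mp _ bB.
  rewrite [leRHS]/(msum p 4 (B i)) /msum.
  rewrite (eq_bigr (fun j : 'I_4 => (fine (p j (B i)))%:E)); last first.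
    by move=> j _; rewrite fineK// ge0_fin_numE.
  rewrite sumEFin lee_fin; apply: le_trans (normc_sum _ _) _.
  apply: ler_sum => j _; rewrite ComplexField.Normc.normcM normcR ger0_norm ?fine_ge0//.
  rewrite ler_piMl ?fine_ge0//.
  case: j => -[|[|[|[|j]]]] //= _; rewrite /jc /= /ComplexField.Normc.normc /=;
    by rewrite ?sqrrN ?oppr0 expr0n/= expr1n ?addr0 ?add0r sqrtr1.
have := @measure_bigsetU_ord _ _ _ (msum p 4) k xpredT B mB tB => <-.
apply: le_measure; rewrite ?inE//; first exact: bigsetU_measurable.
by rewrite -bigcup_seq => x [i _ Bx]; have [_] := hB i; apply.
Qed.

End JordanRepresentation.

Section SlowGrowing.
Context {R : realType}.
Implicit Types n d : nat.

Lemma rint_indic (dsp : measure_display) (T : measurableType dsp) (m : set T -> \bar R) (D : set T) (f : T -> R) :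
  rint m D f = rint m setT (fun x => \1_D x * f x).
Proof.
rewrite /rint /integral patch_setT.
rewrite (_ : (fun x => (f x)%:E) \_ D = (fun x => (\1_D x * f x)%:E))//.
apply/funext => x; rewrite /patch indicE; case: ifPn => _; first by rewrite mul1r.
by rewrite mul0r.
Qed.

Lemma cint_indic n (mu : set 'rV[R]_n -> R[i]) (A : set 'rV[R]_n) (f : 'rV[R]_n -> R[i]) :
  cint mu A f = cint mu setT (fun x => (\1_A x)%:C * f x).
Proof.
have er : (fun x => re ((\1_A x)%:C * f x)) = fun x => \1_A x * re (f x).
  by apply/funext => x; rewrite re_mul /= mul0r subr0.
have ei : (fun x => im ((\1_A x)%:C * f x)) = fun x => \1_A x * im (f x).
  by apply/funext => x; rewrite im_mul /= mul0r addr0.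
rewrite /cint er ei /sint.
by rewrite !(rint_indic _ A (fun x => re (f x))) !(rint_indic _ A (fun x => im (f x))).
Qed.

Lemma lint_indic (dsp : measure_display) (T : measurableType dsp) (m : {measure set T -> \bar R}) (A : set T) :
  measurable A -> lint m setT (fun x => (\1_A x)%:C) = (fine (m A))%:C.
Proof. by move=> mA; rewrite lint_real /rint integral_indic// setIT. Qed.

Lemma citg_indic_lty (dsp : measure_display) (T : measurableType dsp) (m : {measure set T -> \bar R}) (A : set T) :
  measurable A -> citg m (fun x => (\1_A x)%:C) -> (m A < +oo)%E.
Proof.
move=> mA [/integrableP[_ h] _]; rewrite -[A]setIT -integral_indic//.
apply: le_lt_trans h; apply: ge0_le_integral => //.
- by apply/measurable_EFinP; exact: measurable_indic.
- by apply/measurable_EFinP; apply: measurableT_comp => //; exact: measurable_indic.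
- by move=> x _; rewrite lee_fin; exact: ler_norm.
Qed.

Lemma citg_pw n (m : {measure set 'rV[R]_n -> \bar R}) N (f : 'rV[R]_n -> R[i]) (M : R) :
  itg m (pw N) -> cmeas f -> (forall x, normc (f x) <= M * pw N x) -> citg m f.
Proof. by move=> iN mf hM; exact: (citg_le mf (itgZ M iN)). Qed.

Lemma decay_pw n (f : 'rV[R]_n -> R[i]) : decay f ->
  forall N, exists2 M : R, 0 <= M & forall x, normc (f x) <= M * pw N x.
Proof. exact: decay_ge0. Qed.

Lemma decayM n (f g : 'rV[R]_n -> R[i]) : decay f -> poly_bounded g -> decay (fun x => f x * g x).
Proof.
move=> df [K [M hM]] N; have [C hC] := df (N + K)%N; exists (C * `|M|) => x.
have p0 k : 0 <= (1 + sqnorm x) ^+ k :> R by rewrite exprn_ge0// ltW// sqnormD1_gt0.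
have nf := normc_ge0 (f x).
rewrite ComplexField.Normc.normcM.
apply: (@le_trans _ _ ((1 + sqnorm x) ^+ N * (normc (f x) * (`|M| * (1 + sqnorm x) ^+ K)))).
  rewrite ler_wpM2l// ler_wpM2l//; apply: le_trans (hM x) _.
  by rewrite ler_wpM2r// ler_norm.
rewrite (_ : _ * _ = ((1 + sqnorm x) ^+ (N + K) * normc (f x)) * `|M|); last by rewrite exprD; ring.
by rewrite ler_wpM2r.
Qed.

(** On a bounded set the weight [pw N] is bounded below and [f] is bounded. The map [q] preserves
    the Euclidean norm and stands for the identity or a reflection. *)
Lemma citg_bounded_set n (m : {measure set 'rV[R]_n -> \bar R}) N (A : set 'rV[R]_n) (q : 'rV[R]_n -> 'rV[R]_n) (f : 'rV[R]_n -> R[i]) :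
  itg m (pw N) -> borel_bounded A -> measurable_fun setT q -> (forall x, sqnorm (q x) = sqnorm x) ->
  cmeas f -> poly_bounded f -> citg m (fun x => (\1_A (q x))%:C * f x).
Proof.
move=> iN /borel_boundedP[mA [B hB]] mq qs mf [K [M hM]].
pose S := 1 + n%:R * B ^+ 2.
have S0 : 0 <= S by rewrite addr_ge0// mulr_ge0// sqr_ge0.
apply: (@citg_pw _ m N _ (`|M| * S ^+ (K + N))) => //.
  apply: cmeasM => //; apply: cmeas_real.
  by apply: (measurableT_comp _ mq); exact: measurable_indic.
move=> x; rewrite ComplexField.Normc.normcM normcR ger0_norm// indicE.
have [|_] := boolP (q x \in A); last by rewrite mul0r !mulr_ge0// ?exprn_ge0// ltW// pw_gt0.
rewrite inE => Ax; rewrite mul1r.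
have sS : 1 + sqnorm x <= S.
  rewrite lerD2l -qs; apply: le_trans (sqnorm_le_norm _) _.
  rewrite ler_wpM2l// ler_sqr ?nnegrE//; first exact: hB.
  by apply: le_trans (hB _ Ax).
have p0 := sqnormD1_gt0 x.
have hS k : (1 + sqnorm x) ^+ k <= S ^+ k by apply: lerXn2r; rewrite ?nnegrE// ltW.
apply: le_trans (hM x) _; apply: (@le_trans _ _ (`|M| * S ^+ K)).
  apply: (@le_trans _ _ (`|M| * (1 + sqnorm x) ^+ K)); last by rewrite ler_wpM2l.
  by rewrite ler_wpM2r ?ler_norm// exprn_ge0// ltW.
rewrite exprD -!mulrA ler_wpM2l// ler_peMr ?exprn_ge0//.
by rewrite /pw ler_pdivlMr ?exprn_gt0// mul1r.
Qed.

(** On bounded sets [mmul f mu] has the values of the combination of positive measures that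
    [comb_measureC] builds from the densities [jc j * f], so [cint_jrep] applies to it directly. *)
Lemma cint_mmul n (mu : set 'rV[R]_n -> R[i]) (f psi : 'rV[R]_n -> R[i]) :
  slow_growing mu -> cmeas f -> poly_bounded f -> cmeas psi -> decay psi ->
  cint (mmul f mu) setT psi = cint mu setT (fun x => psi x * f x).
Proof.
move=> /slow_growing_jrep[p [N [mp ip]]] mf pf mpsi dpsi.
have [P hP] := @comb_measureC _ _ _ _ R id (@measurable_id _ 'rV[R]_n setT) 4 p (fun j x => jc j * f x)
   (fun j => cmeasM (@cmeas_cst _ _ R (jc j)) mf).
have iA A (bA : borel_bounded A) j : citg (p j) (fun x => (\1_A x)%:C * f x).
  exact: (@citg_bounded_set n (p j) N A id).
have mA A : borel_bounded A -> cmeas (fun x : 'rV[R]_n => (\1_A x)%:C : R[i]).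
  by case=> mA _; apply: cmeas_real; exact: measurable_indic.
have E (u : 'rV[R]_n -> R[i]) : (forall j, citg (p j) (fun x => u x * f x)) ->
    (forall j, citg (p j) (fun x => u x * (jc j * f x))) /\
    \sum_(j < 4) lint (p j) setT (fun x => u x * (jc j * f x)) = cint mu setT (fun x => u x * f x).
  move=> hu; have e j : (fun x => u x * (jc j * f x)) = (fun x => jc j * (u x * f x)).
    by apply/funext => x; exact: mulrCA.
  split=> [j|]; first by rewrite e; exact: citgZ.
  rewrite (cint_jrep mp hu); apply: eq_bigr => j _.
  by rewrite e lintZ.
have rP : jrep (mmul f mu) P.
  move=> A bA; have [h1 h2] := E _ (iA A bA); have [h3 h4] := hP _ (mA A bA) h1.
  split=> [k|]; first by apply: citg_indic_lty (h3 k); case: bA.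
  rewrite /mmul cint_indic -h2 -h4; apply: eq_bigr => k _.
  by rewrite lint_indic//; case: bA.
have hpf j : citg (p j) (fun x => psi x * f x).
  have [M _ hM] := decay_pw (decayM dpsi pf) N.
  by apply: (citg_pw (ip j) _ hM); exact: cmeasM.
have [h1 h2] := E _ hpf; have [h3 h4] := hP _ mpsi h1.
by rewrite (cint_jrep rP h3) h4.
Qed.

(** Serves for the two reflections that arise as squares of the full and of the spatial Fourier
    transform; the weight is invariant under them. *)
Lemma slow_growing_push n (mu : set 'rV[R]_n -> R[i]) (q : 'rV[R]_n -> 'rV[R]_n) :
  slow_growing mu -> measurable_fun setT q -> (forall x, sqnorm (q x) = sqnorm x) ->
  exists2 nu, slow_growing nu & forall psi, cmeas psi -> decay psi ->
    cint nu setT psi = cint mu setT (fun x => psi (q x)).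
Proof.
move=> /slow_growing_jrep[p [N [mp ip]]] mq qs.
have [P hP] := @comb_measureC _ _ _ _ R q mq 4 p (fun j x => jc j) (fun j => @cmeas_cst _ _ R (jc j)).
pose nu A := \sum_(k < 4) jc k * (fine (P k A))%:C.
have citgr j (u : 'rV[R]_n -> R[i]) (z : R[i]) : citg (p j) u -> citg (p j) (fun x => u x * z).
  by move=> hu; under eq_fun do rewrite mulrC; exact: citgZ.
have rP : jrep nu P.
  move=> A bA; split => // k.
  have [|j|h _] := hP (fun x => (\1_A x)%:C).
  - by apply: cmeas_real; apply: measurable_indic; case: bA.
  - apply: (citg_bounded_set (ip j) bA mq qs (@cmeas_cst _ _ R (jc j))).
    by exists 0%N, (normc (jc j)) => x; rewrite expr0 mulr1.
  - by apply: citg_indic_lty (h k); case: bA.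
exists nu.
  apply: (jrep_slow_growing (N := N) rP) => k.
  have [|j|h _] := hP (fun x => (pw N x)%:C).
  - by apply: cmeas_real; exact: measurable_pw.
  - apply: citgr; apply: citg_real.
    by rewrite (_ : (fun x => _) = pw N)//; apply/funext => x; rewrite /pw qs.
  - by have [] := h k.
move=> psi mpsi dpsi; have [M _ hM] := decay_pw dpsi N.
have mpq : cmeas (fun x => psi (q x)).
  by split; [exact: (measurableT_comp mpsi.1 mq)|exact: (measurableT_comp mpsi.2 mq)].
have iq j : citg (p j) (fun x => psi (q x)).
  by apply: (citg_pw (M := M) (ip j)) => // x; rewrite /pw -qs; exact: hM.
have [h1 h2] := hP psi mpsi (fun j => citgr j _ (jc j) (iq j)).
rewrite (cint_jrep rP h1) (cint_jrep mp iq) h2; apply: eq_bigr => j _.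
by under eq_fun do rewrite mulrC; rewrite lintZ.
Qed.

End SlowGrowing.

(** * The equations on the frequency side *)

Section MeasureOf.
Context {R : realType}.
Implicit Types n d : nat.

Lemma schwartz_decay n (f : 'rV[R]_n -> R[i]) : schwartz f -> cmeas f /\ decay f.
Proof. by move=> /schwartz_CFD hf; split; [exact: CFD_cmeas|exact: CFD_decay]. Qed.

Lemma measure_of_spec n (T : tempdist R n) (mu : set 'rV[R]_n -> R[i]) :
  slow_growing mu -> deq T (dist_of mu) ->
  slow_growing (measure_of T) /\ deq T (dist_of (measure_of T)).
Proof.
move=> smu Tmu.
by have := @xgetPex _ (fun=> 0) [set mu | slow_growing mu /\ deq T (dist_of mu)] (ex_intro _ mu (conj smu Tmu)).
Qed.

(** [T] is the transform of some [mu], hence the transform of [T] is the reflection of [mu].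
    Existence makes the choice in [measure_of] a genuine one rather than its default value. *)
Lemma Vdual_measure n (T : tempdist R n) : Vdual T ->
  slow_growing (measure_of (fourierD T)) /\
  forall psi, schwartz psi -> T (fourier psi) = cint (measure_of (fourierD T)) setT psi.
Proof.
move=> [mu smu Tmu].
have [nu snu hnu] : exists2 nu, slow_growing nu & forall psi, cmeas psi -> decay psi ->
    cint nu setT psi = cint mu setT (fun x => psi (- x)).
  apply: slow_growing_push => // [|x].
    apply: measurable_fun_row => i; under eq_fun do rewrite mxE.
    by apply: measurableT_comp => //; exact: measurable_coord.
  by apply: eq_bigr => i _; rewrite mxE sqrrN.
apply: (measure_of_spec snu) => psi hpsi.
have [m1 d1] := schwartz_decay hpsi.
rewrite /dist_of hnu// /fourierD Tmu; last exact: schwartz_fourier.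
rewrite /fourierD /dist_of; congr (cint _ _ _); apply/funext => x.
exact: fourier_fourier.
Qed.

Lemma VCdual_measure d (T : tempdist R (d + 1)) : VCdual T ->
  slow_growing (measure_of (fourierSD T)) /\
  forall psi, schwartz psi -> T (fourierS psi) = cint (measure_of (fourierSD T)) setT psi.
Proof.
move=> [mu smu Tmu].
have [nu snu hnu] : exists2 nu, slow_growing nu & forall psi, cmeas psi -> decay psi ->
    cint nu setT psi = cint mu setT (fun z => psi (reflS z)).
  apply: slow_growing_push => // [|z].
    apply: measurable_fun_row => i; rewrite /reflS; case: (splitP i) => [j ij|j ij].
      rewrite (_ : (fun z => _) = fun z => - space z 0 j).
        apply: measurableT_comp => //; under eq_fun do rewrite space_coord.
        exact: measurable_coord.
      by apply/funext => z; rewrite (_ : i = lshift 1 j) ?spacetime_l ?mxE//; exact: val_inj.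
    rewrite (_ : (fun z => _) = fun z => time z); first exact: measurable_time.
    apply/funext => z; rewrite (_ : i = time_index d) ?spacetime_r//; apply: val_inj => /=.
    by rewrite ij ord1.
  rewrite sqnorm_spacetime -[in RHS](spacetimeE z) sqnorm_spacetime; congr (_ + _).
  by apply: eq_bigr => i _; rewrite mxE sqrrN.
apply: (measure_of_spec snu) => psi hpsi.
have [m1 d1] := schwartz_decay hpsi.
rewrite /dist_of hnu// /fourierSD Tmu; last exact: schwartz_fourierS.
rewrite /fourierSD /dist_of; congr (cint _ _ _); apply/funext => x.
exact: fourierS_fourierS.
Qed.

End MeasureOf.

Section Equations.
Context {R : realType} (d : nat).
Variable g : 'rV[R]_d -> R[i].
Hypotheses (mg : cmeas g) (pg : poly_bounded g).
Implicit Types (X U : tempdist R (d + 1)) (psi : 'rV[R]_(d + 1) -> R[i]).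

Lemma sqnorm_space_le (z : 'rV[R]_(d + 1)) : sqnorm (space z) <= sqnorm z.
Proof. by rewrite -[in leRHS](spacetimeE z) sqnorm_spacetime lerDl sqr_ge0. Qed.

Lemma sqr_time_le (z : 'rV[R]_(d + 1)) : time z ^+ 2 <= sqnorm z.
Proof. by rewrite -[in leRHS](spacetimeE z) sqnorm_spacetime lerDr sqnorm_ge0. Qed.

Lemma cmeas_space (f : 'rV[R]_d -> R[i]) : cmeas f -> cmeas (fun z : 'rV[R]_(d + 1) => f (space z)).
Proof.
move=> [h1 h2]; split; [exact: (measurableT_comp h1 (measurable_space (d := d)))|].
exact: (measurableT_comp h2 (measurable_space (d := d))).
Qed.

Lemma poly_bounded_space (f : 'rV[R]_d -> R[i]) : poly_bounded f ->
  poly_bounded (fun z : 'rV[R]_(d + 1) => f (space z)).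
Proof.
move=> [N [M hM]]; exists N, `|M| => z; apply: le_trans (hM _) _.
have s0 : 0 <= 1 + sqnorm (space z) by exact/ltW/sqnormD1_gt0.
apply: (@le_trans _ _ (`|M| * (1 + sqnorm (space z)) ^+ N)).
  by rewrite ler_wpM2r ?exprn_ge0// ler_norm.
rewrite ler_wpM2l//; apply: lerXn2r; rewrite ?nnegrE// ?lerD2l ?sqnorm_space_le//.
exact/ltW/sqnormD1_gt0.
Qed.

Lemma poly_boundedD n (f h : 'rV[R]_n -> R[i]) : poly_bounded f -> poly_bounded h ->
  poly_bounded (fun z => f z + h z).
Proof.
move=> [N [M hM]] [K [L hL]]; exists (N + K)%N, (`|M| + `|L|) => z.
have s1 := sqnormD1_ge1 z; have s0 := ltW (sqnormD1_gt0 z).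
have e k l : (1 + sqnorm z) ^+ k <= (1 + sqnorm z) ^+ (k + l).
  by rewrite exprD ler_peMr ?exprn_ge0// exprn_ege1.
apply: le_trans (le_normcD _ _) _.
rewrite mulrDl; apply: lerD.
  apply: le_trans (hM z) _; apply: (@le_trans _ _ (`|M| * (1 + sqnorm z) ^+ N)).
    by rewrite ler_wpM2r ?exprn_ge0// ler_norm.
  by rewrite ler_wpM2l.
apply: le_trans (hL z) _; apply: (@le_trans _ _ (`|L| * (1 + sqnorm z) ^+ K)).
  by rewrite ler_wpM2r ?exprn_ge0// ler_norm.
by rewrite ler_wpM2l// addnC.
Qed.

Lemma poly_bounded_time : poly_bounded (fun z : 'rV[R]_(d + 1) => 0 +i* time z).
Proof.
exists 1%N, 1 => z; rewrite mul1r expr1; apply: le_trans (normc_le _) _.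
rewrite /= normr0 add0r; have := sqr_time_le z; rewrite -(real_normK (num_real (time z))).
by move: (normr_ge0 (time z)) (sqr_ge0 (`|time z| - 1)); nra.
Qed.

Let gs (z : 'rV[R]_(d + 1)) := g (space z).
Let symb (z : 'rV[R]_(d + 1)) := 0 +i* time z + g (space z).

(** The equation is tested on [fourier (pft 1 psi)], the transform of [psi] reversed in time only.
    Since [fourier] is [fourierS] after the transform in time, this equals [fourierS psi]: the side
    of [X] sees [psi], while on the side of [U] the inverse transform leaves [pft 1 psi]. *)
Lemma evolution_eq X U psi : VCdual X -> solves_evolution g X U -> schwartz psi ->
  cint (measure_of (fourierD U)) setT (fun z => pft 1 (time_index d) psi z * symb z) =
  cint (measure_of (fourierSD X)) setT psi.
Proof.
move=> /VCdual_measure[_ hX] [/Vdual_measure[sU _] hU] hpsi.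
have he : (1 : R) = 1 \/ (1 : R) = -1 by left.
have ht : schwartz (pft 1 (time_index d) psi) by exact: schwartz_pft.
have [mt dt] := schwartz_decay ht.
have := hU _ (schwartz_fourier ht).
rewrite /evolution_op /ifourierD /dist_of fourierK// fourier_fourierS// pftK// hX// => <-.
rewrite cint_mmul//.
- split; last first.
    under eq_fun do rewrite im_add /=.
    exact: measurable_funD (measurable_time (d := d)) (cmeas_space mg).2.
  under eq_fun do rewrite re_add /= add0r.
  exact: (cmeas_space mg).1.
- exact: (poly_boundedD poly_bounded_time (poly_bounded_space pg)).
Qed.

(** The same test function, read through the two measures attached to [U]. *)
Lemma evolution_link U psi : Vdual U -> VCdual U -> schwartz psi ->
  cint (measure_of (fourierD U)) setT (pft 1 (time_index d) psi) =
  cint (measure_of (fourierSD U)) setT psi.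
Proof.
move=> /Vdual_measure[_ hV] /VCdual_measure[_ hC] hpsi.
have he : (1 : R) = 1 \/ (1 : R) = -1 by left.
have ht : schwartz (pft 1 (time_index d) psi) by exact: schwartz_pft.
by rewrite -hV// fourier_fourierS// pftK// hC.
Qed.

(** A test function that vanishes for t <= 0 is admissible in the Cauchy problem and does not see
    the indicator of the future. *)
Lemma cauchy_eq X (U0 : tempdist R d) U Ut psi : VCdual X -> solves_cauchy g X U0 U Ut -> schwartz psi ->
  (forall z, time z <= 0 -> psi z = 0) ->
  - cint (measure_of (fourierSD U)) setT (dt psi) + cint (measure_of (fourierSD U)) setT (fun z => psi z * gs z) =
  cint (measure_of (fourierSD X)) setT psi.
Proof.
move=> /VCdual_measure[sX _] [_ [/VCdual_measure[sU hU] _ _] _ hC] hpsi psi0.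
have [m1 d1] := schwartz_decay hpsi.
have hS := schwartz_fourierS hpsi.
have tc : continuous (@time R d).
  by rewrite (_ : @time R d = fun z => z 0 (rshift d ord0)); [exact: coord_continuous|apply/funext => z; rewrite time_coord].
(* [fourierS] acts on space only, so the support in time stays in the closed half-line. *)
have supp : closure [set z | fourierS psi z != 0] `<=` future d.
  rewrite (_ : future d = closure (future d)).
    apply: closure_subset => z /=; apply: contraNT; rewrite -ltNge => /ltW tz.
    rewrite /fourierS /fourier (_ : (fun x => _) = fun=> 0) ?lebE ?lint0 ?mulr0//.
    by apply/funext => x; rewrite psi0 ?timeK// mulr0.
  rewrite -(iffLR (closure_id _))// (_ : future d = @time R d @^-1` [set t | 0 <= t])//.
  by apply: closed_comp => [z _|]; [exact: tc|exact: closed_ge].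
have := hC _ hS supp.
rewrite /dtD /Lop /restrict_future /ifourierSD /dist_of !fourierSK// dt_fourierS// hU; last exact: schwartz_dt.
rewrite (cint_mmul sU (cmeas_space mg) (poly_bounded_space pg) m1 d1) => ->.
rewrite cint_mmul//.
- congr (cint _ _ _); apply/funext => z; rewrite indicE.
  have [_|] := boolP (z \in future d); first by rewrite mulr1.
  by rewrite notin_setE /future /= => /negP; rewrite -ltNge => /ltW/psi0 ->; rewrite mul0r.
- apply: cmeas_real; apply: measurable_indic.
  rewrite (_ : future d = setT `&` @time R d @^-1` `[0, +oo[%classic); first exact: (measurable_time (d := d)).
  by rewrite setTI; apply/seteqP; split => z; rewrite /future /= in_itv/= andbT.
- exists 0%N, 1 => z; rewrite mul1r expr0 normcR indicE.
  by case: (_ \in _); rewrite ?normr1 ?normr0.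
Qed.

End Equations.

(** * Density of product bumps *)

Section Bumps.
Context {R : realType}.
Implicit Types (a b c s t : R) (k : nat).

(** The powers of 1/s make the family stable under derivation, and the parameter [c] will tend to 0
    to approximate indicators. *)
Definition flat c k s : R := if 0 < s then s^-1 ^+ k * expR (- (c / s)) else 0.

Lemma flat_ge0 c k s : 0 <= flat c k s.
Proof. by rewrite /flat; case: ifP => // s0; rewrite mulr_ge0 ?expR_ge0// exprn_ge0// invr_ge0 ltW. Qed.

Lemma flatS c k s : flat c k s = s * flat c k.+1 s.
Proof.
rewrite /flat; case: ifP => [s0|_]; last by rewrite mulr0.
by rewrite exprS !mulrA divff ?gt_eqF// mul1r.
Qed.

(** From exp(c/s) >= (c/s)^(k+1) / (k+1)!. *)
Lemma flat_le c k s : 0 < c -> flat c k s <= (k.+1)`!%:R / c ^+ k.+1 * `|s|.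
Proof.
move=> c0; rewrite /flat; case: ifPn => [s0|_]; last by rewrite mulr_ge0// divr_ge0// exprn_ge0// ltW.
rewrite (gtr0_norm s0) expRN ler_pdivrMr ?expR_gt0//.
have cs : 0 <= c / s by rewrite divr_ge0// ltW.
have h := expR_ge1Dxn k cs.
have h2 : (c / s) ^+ k.+1 / k.+1`!%:R <= expR (c / s) by apply: le_trans h; rewrite lerDr.
have f0 : 0 < k.+1`!%:R :> R by rewrite ltr0n fact_gt0.
apply: (@le_trans _ _ (k.+1`!%:R / c ^+ k.+1 * s * ((c / s) ^+ k.+1 / k.+1`!%:R))); last first.
  by rewrite ler_wpM2l// mulr_ge0 ?divr_ge0// ?exprn_ge0// ltW.
rewrite le_eqVlt; apply/orP; left; apply/eqP.
rewrite expr_div_n exprVn [s ^+ k.+1]exprS; field.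
by rewrite !gt_eqF ?exprn_gt0.
Qed.

Lemma is_derive_flat c k s : 0 < c -> is_derive s 1 (flat c k) (c * flat c k.+2 s - k%:R * flat c k.+1 s).
Proof.
move=> c0; have [s0|s0|->] := ltgtP s 0.
- have -> : c * flat c k.+2 s - k%:R * flat c k.+1 s = 0.
    by rewrite /flat ltNge (ltW s0) /= !mulr0 subrr.
  apply: (near_eq_is_derive (f := cst 0)).
  near=> t; rewrite /flat ltNge ifF//; apply/negbTE; rewrite negbK ltW//.
  by near: t; exact: lt_nbhsl.
- apply: (near_eq_is_derive (f := fun t => t^-1 ^+ k * expR (- (c / t)))).
    near=> t; rewrite /flat ifT//; near: t; exact: lt_nbhsr.
  have sn : s != 0 by rewrite gt_eqF.
  have dV : is_derive s 1 (fun t : R => t^-1) (- s ^- 2).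
    have -> : - s ^- 2 = - s ^- 2 *: (1 : R) by rewrite /GRing.scale /= mulr1.
    exact: (@is_deriveV R (@id R) s 1 1 sn (is_derive_id s 1)).
  have dk := is_deriveX k dV.
  have dc := is_deriveZ (- c) dV.
  have de : is_derive s 1 (fun t : R => expR (- (c / t))) (expR (- (c / s)) * (- c * - s ^- 2)).
    rewrite -mulNr; under eq_fun do rewrite -mulNr.
    exact: (@is_derive1_comp R expR (fun t : R => - c * t^-1) s _ _ (is_derive_expR _) dc).
  rewrite exprfctE in dk.
  have dM : is_derive s 1 (fun t : R => t^-1 ^+ k * expR (- (c / t))) _ := is_deriveM dk de.
  have [d1 d2] := dM; apply: DeriveDef => //; rewrite d2.
  rewrite /flat s0 /GRing.scale /=; case: k {dk dM d1 d2} => [|k].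
    by rewrite !mul0r /= !expr2 !exprVn; field.
  by rewrite /= !exprS expr0; field.
- rewrite /flat ltxx !mulr0 subrr.
  (* At 0 the difference quotient of [flat c k] is [flat c k.+1] by [flatS], and it tends to 0 by
     [flat_le]. *)
  have h : (fun h : R => h^-1 *: (flat c k (h *: 1 + 0) - flat c k 0)) @ 0^' --> (0 : R).
    apply/cvgr0Pnorm_le => e e0; near=> h.
    have h0 : h != 0 by near: h; exact: nbhs_dnbhs_neq.
    rewrite [flat c k 0]/flat ltxx subr0 addr0 [h *: 1]mulr1 /GRing.scale /=.
    rewrite flatS mulrA mulVf// mul1r ger0_norm ?flat_ge0//; apply: le_trans (flat_le _ _ c0) _.
    rewrite mulrC -ler_pdivlMr; last by rewrite divr_gt0 ?exprn_gt0// ltr0n fact_gt0.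
    near: h; apply: dnbhs0_le; rewrite divr_gt0// divr_gt0 ?exprn_gt0// ltr0n fact_gt0//.
  apply: DeriveDef; last exact: cvg_lim.
  by apply/cvg_ex; exists 0.
Unshelve. all: by end_near.
Qed.

(* Smooth functions supported in [[a, b]], in a form that is closed under
   derivation because [flat c k] has derivative [c flat c (k + 2) - k flat c (k + 1)]. *)
Definition bmp a b (f : R -> R) := exists c k (q : {poly R}),
  [/\ a < b, 0 < c & f = fun t => q.[t] * flat c k ((t - a) * (b - t))].

Lemma bmp_derive a b f : bmp a b f -> exists2 f', bmp a b f' & forall t : R, is_derive t 1 f (f' t).
Proof.
move=> [c [k [q [ab c0 ->]]]].
(* [flat c k] and [flat c k.+1] at S are S^2 and S times [flat c k.+2], so every term of the
   derivative has the same flat factor and a polynomial coefficient. *)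
pose S : {poly R} := ('X - a%:P) * (b%:P - 'X).
have SE t : S.[t] = (t - a) * (b - t) by rewrite /S !hornerE.
exists (fun t => (q^`() * S ^+ 2 + (c *: S^`() - k%:R *: (S^`() * S)) * q).[t] *
   flat c k.+2 ((t - a) * (b - t))).
  by exists c, k.+2, (q^`() * S ^+ 2 + (c *: S^`() - k%:R *: (S^`() * S)) * q).
move=> t; rewrite (_ : (fun t => _) = fun t => q.[t] * flat c k S.[t]); last first.
  by apply/funext => u; rewrite SE.
have d1 := is_derive1_comp (is_derive_flat k S.[t] c0) (is_derive_poly S t).
have dM : is_derive t 1 (fun t => q.[t] * flat c k S.[t]) _ := is_deriveM (is_derive_poly q t) d1.
have [e1 e2] := dM; apply: DeriveDef => //; rewrite e2 -SE.
by rewrite /= (flatS c k) (flatS c k.+1) !hornerE /GRing.scale /=; ring.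
Qed.

Lemma bmp_out a b f t : bmp a b f -> ~~ (a < t < b) -> f t = 0.
Proof.
move=> [c [k [q [ab c0 ->]]]]; rewrite negb_and -!leNgt => h.
rewrite /flat ifF ?mulr0//; apply/negbTE; rewrite -leNgt.
by case/orP: h => h; nra.
Qed.

Lemma bmp_continuous a b f : bmp a b f -> continuous f.
Proof. by move=> /bmp_derive[f' _ d] t; exact: is_derive_cont (d t). Qed.

Lemma bmp_bounded a b f : bmp a b f -> exists2 M, 0 <= M & forall t, `|f t| <= M.
Proof.
move=> hf; have ab : a <= b by case: hf => c [k [q [/ltW]]].
have cf : continuous (fun t => `|f t|).
  by move=> t; apply: (@continuous_comp _ _ _ f (fun x : R => `|x|)); [exact: (bmp_continuous hf)|exact: norm_continuous].
have [m _ hm] := EVT_max ab (continuous_subspaceT cf).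
exists `|f m| => // t; have [/andP[h1 h2]|h] := boolP (a < t < b).
  by apply: hm; rewrite in_itv/= !ltW.
by rewrite (bmp_out hf h) normr0.
Qed.

Lemma bmp_shift a b f T : bmp a b f -> bmp (a + T) (b + T) (fun t => f (t - T)).
Proof.
move=> [c [k [q [ab c0 ->]]]]; exists c, k, (q \Po ('X - T%:P)); split => //; first by rewrite ltrD2r.
apply/funext => t; rewrite horner_comp !hornerE; congr (_ * flat _ _ _); ring.
Qed.

Definition bump a b c : R -> R := fun t => flat c 0 ((t - a) * (b - t)).

Lemma bmp_bump a b c : a < b -> 0 < c -> bmp a b (bump a b c).
Proof.
move=> ab c0; exists c, 0%N, 1; split => //.
by apply/funext => t; rewrite hornerC mul1r.
Qed.

Lemma bumpE a b c t : a < b ->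
  bump a b c t = if a < t < b then expR (- (c / ((t - a) * (b - t)))) else 0.
Proof.
move=> ab; rewrite /bump /flat expr0 mul1r; congr (if _ then _ else _).
by apply/idP/idP => [h|/andP[h1 h2]]; [apply/andP; split|]; nra.
Qed.

End Bumps.

Section ProductBumps.
Context {R : realType}.
Implicit Types n d : nat.

Definition pbump n (a b : 'I_n -> R) (F : 'I_n -> R -> R) (x : 'rV[R]_n) : R := \prod_i F i (x 0 i).

(** A partial derivative replaces one factor by its derivative, again in the class [bmp], so product
    bumps are stable. *)
Lemma rs_pbump n (a b : 'I_n -> R) F : (forall i, bmp (a i) (b i) (F i)) -> rschwartz (pbump a b F).
Proof.
move=> hF.
apply: (@rs_coind _ _ (fun f => exists2 F, forall i, bmp (a i) (b i) (F i) & f = pbump a b F)); last by exists F.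
move=> {hF}f [{}F hF ->]; split.
- apply: continuous_prodr => i x.
  apply: (@continuous_comp _ _ _ (fun x : 'rV[R]_n => x 0 i) (F i)); first exact: coord_continuous.
  exact: bmp_continuous (hF i) _.
- have /choice[M hM] : forall i, exists M, 0 <= M /\ forall t, `|F i t| <= M.
    by move=> i; have [M h1 h2] := bmp_bounded (hF i); exists M.
  pose S := \sum_i (`|a i| + `|b i|) ^+ 2.
  have S0 : 0 <= S by apply: sumr_ge0 => i _; exact: sqr_ge0.
  move=> N; exists ((1 + S) ^+ N * \prod_i M i) => x.
  have p0 : 0 <= \prod_i M i by apply: prodr_ge0 => i _; case: (hM i).
  have [h|/forallPn[i hi]] := boolP [forall i, a i < x 0 i < b i]; last first.
    rewrite /pbump (bigD1 i)//= (bmp_out (hF i) hi) mul0r normr0 mulr0.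
    by rewrite mulr_ge0// exprn_ge0// addr_ge0.
  have sS : sqnorm x <= S.
    apply: ler_sum => i _; have /andP[h1 h2] := forallP h i.
    rewrite -[leLHS]real_normK ?num_real// ler_sqr ?nnegrE ?addr_ge0//.
    rewrite ler_norml; apply/andP; split.
      by have := ler_norm (- a i); rewrite normrN; have := normr_ge0 (b i); lra.
    by have := ler_norm (b i); have := normr_ge0 (a i); lra.
  apply: ler_pM => //.
  + by rewrite exprn_ge0// ltW// sqnormD1_gt0.
  + by apply: lerXn2r; rewrite ?nnegrE ?addr_ge0 ?sqnorm_ge0// lerD2l.
  by rewrite /pbump normr_prod; apply: ler_prod => i _; rewrite normr_ge0/=; case: (hM i).
- move=> i; have [f' hf' df'] := bmp_derive (hF i).
  pose F' j := if j == i then f' else F j.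
  exists (pbump a b F').
    exists F' => // j; rewrite /F'; case: eqVneq => [->|_]; [exact: hf'|exact: hF].
  move=> x; apply: is_derive_line.
  pose K := \prod_(j | j != i) F j (x 0 j).
  have E : (fun t : R => pbump a b F (t *: 'e_i + x)) = K \*: (F i \o (fun t : R => t + x 0 i)).
    apply/funext => t; rewrite /pbump (bigD1 i)//= e_coord eqxx mulrC; congr (_ * _).
    by apply: eq_bigr => j ji; rewrite e_coord (negbTE ji).
  rewrite E.
  have d1 : is_derive (0 : R) 1 (fun t : R => t + x 0 i) (1 : R).
    by apply: is_derive_eq; rewrite addr0.
  have d2 := @is_derive1_comp R (F i) (fun t : R => t + x 0 i) 0 _ _ (df' _) d1.
  have d3 := is_deriveZ K d2.
  have [e1 e2] := d3; apply: DeriveDef => //; rewrite e2 add0r mulr1 /pbump (bigD1 i)//= /F' eqxx /GRing.scale /= mulrC.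
  by congr (_ * _); apply: eq_bigr => j /negbTE ->.
Qed.

End ProductBumps.

Section Boxes.
Context {R : realType} (n : nat).

Definition box (a b : 'I_n -> R) : set 'rV[R]_n := [set x | forall i, a i < x 0 i < b i].

Definition boxes : set (set 'rV[R]_n) := [set A | exists a b, A = box a b].

Lemma measurable_box a b : measurable (box a b).
Proof.
have -> : box a b = \bigcap_(i : 'I_n) ((fun x : 'rV[R]_n => x 0 i) @^-1` `]a i, b i[%classic).
  by apply/seteqP; split => x h i => [_|]; have := h i; rewrite /= in_itv/=; apply.
apply: fin_bigcap_measurable => // i _.
by rewrite -[X in measurable X]setTI; exact: (measurable_coord i).
Qed.

Lemma setI_box a b a' b' : box a b `&` box a' b' =
  box (fun i => Num.max (a i) (a' i)) (fun i => Num.min (b i) (b' i)).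
Proof.
apply/seteqP; split => x => [[h h'] i|h].
  by rewrite gt_max lt_min; have /andP[-> ->] := h i; have /andP[-> ->] := h' i.
by split => i; have := h i; rewrite gt_max lt_min => /andP[/andP[h1 h2] /andP[h3 h4]]; apply/andP.
Qed.

Lemma bigcup_box : \bigcup_k (box (fun=> - k%:R) (fun=> k%:R)) = [set: 'rV[R]_n].
Proof.
apply/seteqP; split => // x _; exists (Num.truncn `|x|).+1 => //= i.
rewrite -ltr_norml; apply: le_lt_trans (truncnS_gt `|x|).
by rewrite [leRHS]mx_normrE; apply/bigmax_geP; right; exists (0, i).
Qed.

(** The identity is regarded as a map from the sigma-algebra generated by boxes, and its
    measurability is checked coordinate by coordinate. *)
Lemma measurable_sigma_boxes (A : set 'rV[R]_n) : measurable A -> <<s boxes >> A.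
Proof.
pose T := g_sigma_algebraType boxes.
suff h : measurable_fun setT (fun x : T => (x : 'rV[R]_n)).
  by move=> mA; have := h measurableT _ mA; rewrite setTI.
apply: measurable_fun_row => i.
apply: (measurability _ (RGenOpens.measurableE R)) => _ [_ [a [b ->] <-]].
rewrite setTI.
have -> : (fun x : T => (x : 'rV[R]_n) 0 i) @^-1` `]a, b[%classic =
    \bigcup_k (box (fun j => if j == i then Num.max a (- k%:R) else - k%:R) (fun j => if j == i then Num.min b k%:R else k%:R)).
  apply/seteqP; split => x.
    rewrite /= in_itv/= => /andP[h1 h2]; have [k _ hk] : (\bigcup_k (box (fun=> - k%:R) (fun=> k%:R))) x by rewrite bigcup_box.
    exists k => // j; have /andP[h3 h4] := hk j.
    by case: eqVneq => [ji|_]; rewrite ?gt_max ?lt_min ?h3 ?h4// ji h1 h2.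
  by move=> [k _ /(_ i)]; rewrite eqxx /= in_itv/= gt_max lt_min => /andP[/andP[-> _] /andP[-> _]].
apply: bigcup_measurable => k _; apply: sub_sigma_algebra.
by do 2 eexists.
Qed.

Variables P Q : {measure set 'rV[R]_n -> \bar R}.

(** As [c] decreases to 0 these functions increase to the indicator of the open box, so monotone
    convergence recovers the measures of boxes. *)
Definition bbump (a b : 'I_n -> R) (c : R) : 'rV[R]_n -> R := pbump a b (fun i => bump (a i) (b i) c).

Lemma bbump_ge0 a b c x : 0 <= bbump a b c x.
Proof. by apply: prodr_ge0 => i _; exact: flat_ge0. Qed.

Lemma measurable_bbump a b c : (forall i, a i < b i) -> 0 < c -> measurable_fun setT (bbump a b c).
Proof.
move=> ab c0; apply: continuous_measurable_row; apply: rs_cont; apply: rs_pbump => i.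
exact: bmp_bump.
Qed.

Lemma bbump_cvg a b x : (forall i, a i < b i) ->
  bbump a b (k.+1%:R^-1) x @[k --> \oo] --> (\1_(box a b) x : R).
Proof.
move=> ab; rewrite indicE; have [|] := boolP (x \in box a b).
  rewrite inE => hx.
  pose G (c : R) : R := \prod_i expR (- (c / ((x 0 i - a i) * (b i - x 0 i)))).
  have cG : continuous G.
    apply: continuous_prodr => i c.
    apply: (@continuous_comp _ _ _ (fun c : R => - (c / ((x 0 i - a i) * (b i - x 0 i)))) expR).
      by apply: cvgN; apply: cvgM; [exact: cvg_id|exact: cvg_cst].
    exact: continuous_expR.
  have G0 : G 0 = 1 by rewrite /G big1// => i _; rewrite mul0r oppr0 expR0.
  rewrite (_ : (fun k => _) = G \o (fun k : nat => k.+1%:R^-1)).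
    rewrite (_ : true%:R = G 0); last by rewrite G0.
    have ch : (fun k : nat => k.+1%:R^-1 : R) @ \oo --> (0 : R) by exact: cvg_harmonic.
    exact: (cvg_comp _ _ ch (cG 0)).
  by apply/funext => k; apply: eq_bigr => i _; rewrite bumpE// hx.
rewrite notin_setE => /existsNP[i /negP hi].
rewrite (_ : (fun k => _) = cst 0); first exact: cvg_cst.
apply/funext => k; rewrite /bbump /pbump (bigD1 i)//= bumpE// (negbTE hi) mul0r//.
Qed.

Lemma bbump_homo a b x c c' : (forall i, a i < b i) -> 0 < c -> c <= c' -> bbump a b c' x <= bbump a b c x.
Proof.
move=> ab c0 cc; apply: ler_prod => i _; rewrite flat_ge0 !bumpE//=; case: ifP => // /andP[h1 h2].
rewrite ler_expR lerN2 ler_wpM2r// invr_ge0 mulr_ge0// ltW// subr_gt0//.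
Qed.

Hypothesis PQ : forall a b c, (forall i, a i < b i) -> 0 < c ->
  [/\ itg P (bbump a b c), itg Q (bbump a b c) & rint P setT (bbump a b c) = rint Q setT (bbump a b c)].

Let boxE (m : {measure set 'rV[R]_n -> \bar R}) a b : (forall i, a i < b i) ->
  (\int[m]_x (bbump a b (k.+1%:R^-1) x)%:E @[k --> \oo] --> m (box a b))%E.
Proof.
move=> ab; have mb := measurable_box a b.
rewrite -[box a b]setIT -integral_indic//.
have c0 (k : nat) : 0 < k.+1%:R^-1 :> R by rewrite invr_gt0.
rewrite (eq_integral (fun x => limn (fun k => (bbump a b (k.+1%:R^-1) x)%:E))).
  apply: cvg_monotone_convergence => //.
  - by move=> k; apply/measurable_EFinP; exact: measurable_bbump.
  - by move=> k x _; rewrite lee_fin bbump_ge0.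
  - move=> x _ k l kl; rewrite lee_fin; apply: bbump_homo => //.
    by rewrite lef_pV2 ?posrE// ler_nat.
by move=> x _; apply/esym/cvg_lim => //; apply/cvg_EFin; [exact: nearW|exact: bbump_cvg].
Qed.

Let box0 a b i : b i <= a i -> box a b = set0.
Proof. by move=> h; apply/seteqP; split => // x /(_ i) /andP[h1 h2]; lra. Qed.

Let PQbox a b : P (box a b) = Q (box a b).
Proof.
have [/forallP ab|/forallPn[i hi]] := boolP [forall i, a i < b i]; last first.
  by rewrite (@box0 a b i) ?measure0// leNgt.
rewrite -(cvg_lim _ (@boxE P a b ab))// -(cvg_lim _ (@boxE Q a b ab))//.
apply: congr_lim; apply/funext => k; have c0 : 0 < k.+1%:R^-1 :> R by rewrite invr_gt0.
by have [h1 h2 h3] := PQ ab c0; rewrite !rintE// h3.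
Qed.

Lemma bbump_unique A : measurable A -> P A = Q A.
Proof.
apply: (measure_unique boxes (fun k => box (fun=> - k%:R) (fun=> k%:R))).
- apply/seteqP; split => B; first exact: measurable_sigma_boxes.
  by apply: smallest_sub => [|_ [a [b ->]]]; [exact: sigma_algebra_measurable|exact: measurable_box].
- by move=> _ _ [a [b ->]] [a' [b' ->]]; rewrite setI_box; do 2 eexists.
- by move=> k; do 2 eexists.
- exact: bigcup_box.
- by move=> _ [a [b ->]]; exact: PQbox.
- move=> k.
  (* Finiteness on the cube of half-width k comes from the bump with [c = 1] on half-width k + 1:
     inside the smaller cube (x - a) (b - x) >= 1, so each factor is at least exp(-1). *)
  pose a := fun _ : 'I_n => - (k.+1%:R : R); pose b := fun _ : 'I_n => k.+1%:R : R.
  have ab i : a i < b i by rewrite /a /b gtrN.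
  have [h _ _] := PQ ab ltr01.
  have e0 := expR_gt0 (- 1 : R).
  have iI : itg P (\1_(box (fun=> - k%:R) (fun=> k%:R)) : 'rV[R]_n -> R).
    apply: (itg_le _ (itgZ ((expR (-1))^-1 ^+ n) h)).
      by apply: measurable_indic; exact: measurable_box.
    move=> x; rewrite ger0_norm// indicE; have [|_] := boolP (_ \in _); last first.
      by rewrite mulr_ge0 ?bbump_ge0// exprn_ge0// invr_ge0 ltW.
    rewrite inE => hx; rewrite exprVn mulrC ler_pdivlMr ?exprn_gt0// mul1r.
    rewrite -{1}(card_ord n) -prodr_const; apply: ler_prod => i _; rewrite ltW//= bumpE//.
    have /andP[h1 h2] := hx i; rewrite /a /b -natr1.
    have k0 : 0 <= k%:R :> R by [].
    rewrite ifT; last by apply/andP; split; lra.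
    rewrite ler_expR lerN2 ler_pdivrMr; nra.
  move: iI => /integrableP[_]; apply: le_lt_trans.
  rewrite -[X in P X]setIT -integral_indic//; last exact: measurable_box.
  apply: ge0_le_integral => //.
  + by apply/measurable_EFinP; apply: measurable_indic; exact: measurable_box.
  + by apply/measurable_EFinP; apply: measurableT_comp => //; apply: measurable_indic; exact: measurable_box.
  + by move=> x _; rewrite lee_fin; exact: ler_norm.
Qed.

End Boxes.

(** * Decaying test functions and density in the space variable *)

Section Decaying.
Context {R : realType}.
Implicit Types n d : nat.

Definition dec n (f : 'rV[R]_n -> R[i]) := cmeas f /\ decay f.

Lemma decZ n (z : R[i]) (f : 'rV[R]_n -> R[i]) : dec f -> dec (fun x => z * f x).
Proof.
move=> [mf df]; split; first by apply: cmeasM => //; exact: cmeas_cst.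
under eq_fun do rewrite mulrC; apply: decayM => //; exists 0%N, (normc z) => x.
by rewrite expr0 mulr1.
Qed.

Lemma decD n (f h : 'rV[R]_n -> R[i]) : dec f -> dec h -> dec (fun x => f x + h x).
Proof.
move=> [mf df] [mh dh]; split; first exact: cmeasD.
move=> N; have [A hA] := df N; have [B hB] := dh N; exists (A + B) => x.
apply: le_trans (lerD (hA x) (hB x)); rewrite -mulrDr ler_wpM2l ?le_normcD//.
by rewrite exprn_ge0// ltW// sqnormD1_gt0.
Qed.

Lemma decM n (f h : 'rV[R]_n -> R[i]) : dec f -> cmeas h -> poly_bounded h -> dec (fun x => f x * h x).
Proof. by move=> [mf df] mh ph; split; [exact: cmeasM|exact: decayM]. Qed.

Lemma dec_citg n (m : {measure set 'rV[R]_n -> \bar R}) N (f : 'rV[R]_n -> R[i]) :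
  itg m (pw N) -> dec f -> citg m f.
Proof. by move=> iN [mf df]; have [M _ hM] := decay_pw df N; exact: citg_pw iN mf hM. Qed.

Variables (n : nat) (mu : set 'rV[R]_n -> R[i]).
Hypothesis smu : slow_growing mu.

Lemma cintD (f h : 'rV[R]_n -> R[i]) : dec f -> dec h ->
  cint mu setT (fun x => f x + h x) = cint mu setT f + cint mu setT h.
Proof.
move=> df dh; have [p [N [mp ip]]] := slow_growing_jrep smu.
rewrite !(cint_jrep mp); [|move=> j; exact: (dec_citg (ip j))..|by move=> j; exact: (dec_citg (ip j) (decD df dh))].
rewrite -big_split; apply: eq_bigr => j _ /=.
by rewrite lintD ?mulrDr//; exact: (dec_citg (ip j)).
Qed.

Lemma cintZ (z : R[i]) (f : 'rV[R]_n -> R[i]) : dec f ->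
  cint mu setT (fun x => z * f x) = z * cint mu setT f.
Proof.
move=> df; have [p [N [mp ip]]] := slow_growing_jrep smu.
rewrite !(cint_jrep mp); [|by move=> j; exact: (dec_citg (ip j))|by move=> j; exact: (dec_citg (ip j) (decZ z df))].
rewrite mulr_sumr; apply: eq_bigr => j _.
by rewrite lintZ 1?mulrCA//; exact: (dec_citg (ip j)).
Qed.

End Decaying.

Section BumpDensity.
Context (dsp : measure_display) (Z : measurableType dsp) {R : realType} (n : nat).
Variables (q : Z -> 'rV[R]_n) (mq : measurable_fun setT q).

(** The push-forward of the combination is P 0 - P 1 + i (P 2 - P 3). Bumps are real, so vanishing
    on them separates real and imaginary parts and forces P 0 = P 1 and P 2 = P 3. *)
Lemma bump_density (m : nat) (p : nat -> {measure set Z -> \bar R}) (F : nat -> Z -> R[i]) (chi : 'rV[R]_n -> R[i]) :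
  (forall j, cmeas (F j)) ->
  (forall a b c, (forall i, a i < b i) -> 0 < c ->
    (forall j, citg (p j) (fun z => (bbump a b c (q z))%:C * F j z)) /\
    \sum_(j < m) lint (p j) setT (fun z => (bbump a b c (q z))%:C * F j z) = 0) ->
  cmeas chi -> (forall j, citg (p j) (fun z => chi (q z) * F j z)) ->
  \sum_(j < m) lint (p j) setT (fun z => chi (q z) * F j z) = 0.
Proof.
move=> mF hF mchi hchi.
have [P hP] := comb_measureC mq m p mF.
have E a b c : (forall i, a i < b i) -> 0 < c ->
    (forall k, itg (P k) (bbump a b c)) /\ rint (P 0) setT (bbump a b c) = rint (P 1) setT (bbump a b c)
    /\ rint (P 2) setT (bbump a b c) = rint (P 3) setT (bbump a b c).
  move=> ab c0; have [h1 h2] := hF a b c ab c0.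
  have mb : cmeas (fun x => (bbump a b c x)%:C) by apply: cmeas_real; exact: measurable_bbump.
  have [h3 h4] := hP _ mb h1; split; first by move=> k; case: (h3 k).
  move: h4; rewrite h2 !big_ord_recl big_ord0 /jc /fintype.bump /= !lint_real => h4.
  have := congr1 (@complex.Re R) h4; have := congr1 (@complex.Im R) h4.
  by rewrite !reimE /=; split; lra.
have U1 : forall A, measurable A -> P 0 A = P 1 A.
  apply: bbump_unique => a b c ab c0; have [h1 [h2 h3]] := E a b c ab c0.
  by split; [exact: h1|exact: h1|].
have U2 : forall A, measurable A -> P 2 A = P 3 A.
  apply: bbump_unique => a b c ab c0; have [h1 [h2 h3]] := E a b c ab c0.
  by split; [exact: h1|exact: h1|].
have [_ <-] := hP _ mchi hchi.
have L (m1 m2 : {measure set 'rV[R]_n -> \bar R}) : (forall A, measurable A -> m1 A = m2 A) ->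
    lint m1 setT chi = lint m2 setT chi.
  move=> h; have r (f : 'rV[R]_n -> R) : rint m1 setT f = rint m2 setT f.
    by rewrite /rint; congr fine; apply: eq_measure_integral => A mA _; exact: h.
  by rewrite /lint !r.
rewrite !big_ord_recl big_ord0 /jc /fintype.bump /= (L _ _ U1) (L _ _ U2).
by rewrite mul1r mulN1r mulNr addr0 addrN addr0 subrr.
Qed.

End BumpDensity.

Section SpaceDensity.
Context {R : realType} (d : nat).
Implicit Types (mu nu : set 'rV[R]_(d + 1) -> R[i]) (F G : 'rV[R]_(d + 1) -> R[i]).

(** Decay in time is the task of [F], decay in space that of [chi]. [F] may grow in space, as the
    symbol does. *)
Definition space_tempered F := cmeas F /\ forall chi, dec chi -> dec (fun z => chi (space z) * F z).

Lemma dec_bbump (a b : 'I_d -> R) c : (forall i, a i < b i) -> 0 < c -> dec (fun x => (bbump a b c x)%:C).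
Proof.
move=> ab c0; have h : rschwartz (bbump a b c) by apply: rs_pbump => i; exact: bmp_bump.
split; first by apply: cmeas_real; exact: measurable_bbump.
move=> N; have [M hM] := rs_bound N h; exists M => x; rewrite normcR; exact: hM.
Qed.

(** Bumps in space are enough because the factors [F] and [G] are kept as densities while the
    measures are pushed forward to R^d. *)
Lemma space_density mu nu F G : slow_growing mu -> slow_growing nu ->
  space_tempered F -> space_tempered G ->
  (forall a b c, (forall i, a i < b i) -> 0 < c ->
    cint mu setT (fun z => (bbump a b c (space z))%:C * F z) =
    cint nu setT (fun z => (bbump a b c (space z))%:C * G z)) ->
  forall chi, dec chi ->
    cint mu setT (fun z => chi (space z) * F z) = cint nu setT (fun z => chi (space z) * G z).
Proof.
move=> smu snu [mF hF] [mG hG] H chi hchi.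
have [p [N [mp ip]]] := slow_growing_jrep smu.
have [r [L [mr ir]]] := slow_growing_jrep snu.
(* Eight measures: the four that represent [mu], then the four of [nu] with opposite coefficients,
   so that the identity reads as a vanishing sum. *)
pose P j := if (j < 4)%N then p j else r (j - 4)%N.
pose K j z := if (j < 4)%N then jc j * F z else - jc (j - 4)%N * G z.
have mK j : cmeas (K j).
  by rewrite /K; case: (j < 4)%N; apply: cmeasM => //; exact: cmeas_cst.
have e1 (u : 'rV[R]_d -> R[i]) (w : R[i]) (V : 'rV[R]_(d + 1) -> R[i]) :
    (fun x => u (space x) * (w * V x)) = (fun x => w * (u (space x) * V x)).
  by apply/funext => x; exact: mulrCA.
have S (u : 'rV[R]_d -> R[i]) : dec u ->
    (forall j, citg (P j) (fun z => u (space z) * K j z)) /\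
    \sum_(j < 8) lint (P j) setT (fun z => u (space z) * K j z) =
    cint mu setT (fun z => u (space z) * F z) - cint nu setT (fun z => u (space z) * G z).
  move=> hu; have iF j := dec_citg (ip j) (hF u hu); have iG j := dec_citg (ir j) (hG u hu).
  split=> [j|].
    by rewrite /P /K; case: (j < 4)%N; rewrite (e1 u); exact: citgZ.
  rewrite (cint_jrep mp iF) (cint_jrep mr iG).
  rewrite (@big_split_ord _ _ _ 4 4) /=; congr (_ + _).
    by apply: eq_bigr => j _; rewrite /P /K ltn_ord (e1 u) lintZ.
  rewrite -sumrN; apply: eq_bigr => j _.
  by rewrite /P /K ltnNge leq_addr /= addKn (e1 u) lintZ// mulNr.
have [h1 h2] := S chi hchi.
apply/eqP; rewrite -subr_eq0 -h2; apply/eqP.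
apply: (bump_density (measurable_space (d := d)) mK) => //; last by case: hchi.
move=> a b c ab c0; have [h3 h4] := S _ (dec_bbump ab c0).
by split => //; rewrite h4 H// subrr.
Qed.

End SpaceDensity.

Section TensorTests.
Context {R : realType} (d : nat).
Implicit Types (T : 'rV[R]_(d + 1) -> R[i]) (theta : R -> R) (z : 'rV[R]_(d + 1)).

Definition time_decay T := cmeas T /\
  forall N : nat, exists M : R, forall z, (1 + time z ^+ 2) ^+ N * normc (T z) <= M.

(** The weights multiply: 1 + |x|^2 + t^2 <= (1 + |x|^2) (1 + t^2). *)
Lemma time_decay_tempered T : time_decay T -> space_tempered T.
Proof.
move=> [mT dT]; split => // chi [mchi dchi]; split.
  by apply: cmeasM => //; exact: cmeas_space.
move=> N; have [A hA] := dchi N; have [B hB] := dT N; exists (A * B) => z.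
have p1 : 0 <= (1 + sqnorm (space z)) ^+ N by rewrite exprn_ge0// ltW// sqnormD1_gt0.
have p2 : 0 <= (1 + time z ^+ 2) ^+ N by rewrite exprn_ge0// addr_ge0// sqr_ge0.
have c1 := normc_ge0 (chi (space z)); have c2 := normc_ge0 (T z).
apply: (@le_trans _ _ (((1 + sqnorm (space z)) ^+ N * normc (chi (space z))) *
   ((1 + time z ^+ 2) ^+ N * normc (T z)))); last by apply: ler_pM; rewrite ?mulr_ge0.
rewrite ComplexField.Normc.normcM mulrACA ler_wpM2r ?mulr_ge0// -exprMn.
have s0 := sqnorm_ge0 (space z); have t0 := sqr_ge0 (time z).
apply: lerXn2r; rewrite ?nnegrE.
- exact/ltW/sqnormD1_gt0.
- by rewrite mulr_ge0// addr_ge0.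
- by rewrite -(spacetimeE z) sqnorm_spacetime spaceK timeK; nra.
Qed.

Definition tcst theta z : R[i] := (theta (time z))%:C.

Lemma time_decay_bmp a b theta : bmp a b theta -> time_decay (tcst theta).
Proof.
move=> ht; split.
  apply: cmeas_real; apply: (measurableT_comp _ (measurable_time (d := d))).
  by apply: continuous_measurable_fun; exact: bmp_continuous ht.
have [M M0 hM] := bmp_bounded ht => N; pose S := (`|a| + `|b|) ^+ 2.
have S0 : 0 <= S := sqr_ge0 _.
exists ((1 + S) ^+ N * M) => z; rewrite /tcst normcR.
have [/andP[h1 h2]|h] := boolP (a < time z < b); last first.
  by rewrite (bmp_out ht h) normr0 mulr0 mulr_ge0// exprn_ge0// addr_ge0.
have sS : time z ^+ 2 <= S.
  rewrite -[leLHS]real_normK ?num_real// ler_sqr ?nnegrE ?addr_ge0// ler_norml; apply/andP; split.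
    by have := ler_norm (- a); rewrite normrN; have := normr_ge0 b; lra.
  by have := ler_norm b; have := normr_ge0 a; lra.
apply: ler_pM => //; first by rewrite exprn_ge0// addr_ge0// sqr_ge0.
by apply: lerXn2r; rewrite ?nnegrE ?addr_ge0 ?sqr_ge0// lerD2l.
Qed.

Lemma rs0 n : rschwartz (fun _ : 'rV[R]_n => 0).
Proof.
apply: (@rs_coind _ _ (fun f => f = (fun=> 0))) => // f ->; split.
- exact: cst_continuous.
- by move=> N; exists 0 => x; rewrite normr0 mulr0.
- by move=> i; exists (fun=> 0) => // x; exact: is_derive_cst.
Qed.

Lemma schwartz_real n (f : 'rV[R]_n -> R) : rschwartz f -> schwartz (fun x => (f x)%:C).
Proof. by move=> hf; split => //; exact: rs0. Qed.

(** [tcst theta] has no decay in space, hence is not Schwartz on space-time. Its transform in time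
    is that of the one-dimensional Schwartz function [th1]. *)
Lemma time_decay_pft a b theta : bmp a b theta -> time_decay (pft 1 (time_index d) (tcst theta)).
Proof.
move=> ht; have he : (1 : R) = 1 \/ (1 : R) = -1 by left.
pose th1 (v : 'rV[R]_1) : R[i] := (pbump (fun=> a) (fun=> b) (fun=> theta) v)%:C.
have h1 : schwartz th1 by apply: schwartz_real; exact: rs_pbump.
have h2 := schwartz_pft ord0 he h1; have [m2 d2] := schwartz_decay h2.
have E z : pft 1 (time_index d) (tcst theta) z = pft 1 ord0 th1 ((time z)%:M).
  rewrite /pft time_coord mxE eqxx mulr1n.
  apply: (congr1 (fun h => c0%:C * ft1 1 h (z 0 (rshift d ord0)))); apply/funext => y.
  rewrite /tcst /th1 /pbump big_ord1 upd_coord eqxx.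
  by rewrite -(spacetimeE z) upd_spacetime_r timeK.
have mt : measurable_fun setT (fun z : 'rV[R]_(d + 1) => ((time z)%:M : 'rV[R]_1)).
  apply: measurable_fun_row => i; under eq_fun do rewrite ord1 mxE eqxx mulr1n.
  exact: measurable_time.
have -> : pft 1 (time_index d) (tcst theta) = fun z => pft 1 ord0 th1 ((time z)%:M) by exact/funext.
split; first by split; [exact: (measurableT_comp m2.1 mt)|exact: (measurableT_comp m2.2 mt)].
move=> N; have [M hM] := d2 N; exists M => z; apply: le_trans (hM (time z)%:M).
by rewrite /sqnorm big_ord1 mxE eqxx mulr1n.
Qed.

Variables (u : 'rV[R]_d -> R) (al be : 'I_d -> R) (F : 'I_d -> R -> R).
Hypotheses (hF : forall i, bmp (al i) (be i) (F i)) (uE : u = pbump al be F).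

Definition tens theta z : R[i] := (u (space z))%:C * tcst theta z.

Let tensR theta z : R := u (space z) * theta (time z).

Let tensE theta : tens theta = fun z => (tensR theta z)%:C.
Proof. by apply/funext => z; rewrite /tens /tcst /tensR; apply: eqC; rewrite !reimE /=; ring. Qed.

Lemma schwartz_tens a b theta : bmp a b theta -> schwartz (tens theta).
Proof.
move=> ht; rewrite tensE; apply: schwartz_real.
pose A (i : 'I_(d + 1)) := if fintype.split i is inl j then al j else a.
pose B (i : 'I_(d + 1)) := if fintype.split i is inl j then be j else b.
pose H (i : 'I_(d + 1)) := if fintype.split i is inl j then F j else theta.
have -> : tensR theta = pbump A B H.
  apply/funext => z; rewrite /tensR uE /pbump big_split_ord /= big_ord1 /H; congr (_ * _).
    by apply: eq_bigr => i _; rewrite space_coord (unsplitK (inl i) : fintype.split (lshift 1 i) = inl i).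
  by rewrite time_coord (unsplitK (inr ord0) : fintype.split (rshift d ord0) = inr ord0).
by apply: rs_pbump => i; rewrite /A /B /H; case: (fintype.split i) => j; [exact: hF|exact: ht].
Qed.

Lemma pft_tens a b theta z : bmp a b theta ->
  pft 1 (time_index d) (tens theta) z = (u (space z))%:C * pft 1 (time_index d) (tcst theta) z.
Proof.
move=> ht; rewrite /pft mulrCA; congr (_ * _).
have E1 y : tens theta (upd z (time_index d) y) = (u (space z))%:C * (theta y)%:C.
  by rewrite /tens /tcst -(spacetimeE z) upd_spacetime_r !spaceK timeK.
have E2 y : tcst theta (upd z (time_index d) y) = (theta y)%:C.
  by rewrite /tcst -(spacetimeE z) upd_spacetime_r timeK.
have e1 : (fun y => tens theta (upd z (time_index d) y)) = (fun y => (u (space z))%:C * (theta y)%:C) by exact/funext.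
have e2 : (fun y => tcst theta (upd z (time_index d) y)) = (fun y => (theta y)%:C) by exact/funext.
rewrite e1 e2 /ft1 -lintZ.
  by apply: (congr1 (lint _ _)); apply/funext => y; exact: mulrCA.
apply: citg_expi; apply: lone_citg; split => [||].
- exact: bmp_continuous ht.
- exact: cst_continuous.
- have [M M0 hM] := bmp_bounded ht; pose S := (`|a| + `|b|) ^+ 2.
  have S0 : 0 <= S := sqr_ge0 _.
  exists ((1 + S) * M) => [|y]; first by rewrite mulr_ge0// addr_ge0.
  have y0 : 0 < 1 + y ^+ 2 by rewrite ltr_pwDl// sqr_ge0.
  rewrite normcR ler_pdivlMr//.
  have [/andP[h1 h2]|h] := boolP (a < y < b); last first.
    by rewrite (bmp_out ht h) normr0 mul0r mulr_ge0// addr_ge0.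
  rewrite mulrC; apply: ler_pM => //; first exact: ltW.
  rewrite lerD2l -[leLHS]real_normK ?num_real// ler_sqr ?nnegrE ?addr_ge0// ler_norml; apply/andP; split.
    by have := ler_norm (- a); rewrite normrN; have := normr_ge0 b; lra.
  by have := ler_norm b; have := normr_ge0 a; lra.
Qed.

Lemma dt_tens a b theta theta' : bmp a b theta -> (forall t : R, is_derive t 1 theta (theta' t)) ->
  dt (tens theta) = tens theta'.
Proof.
move=> ht dth; apply/funext => z; rewrite dtE tensE.
have d1 : is_derive z 'e_(time_index d) (tensR theta) (tensR theta' z).
  apply: is_derive_line.
  have -> : (fun t : R => tensR theta (t *: 'e_(time_index d) + z)) = u (space z) \*: (theta \o (fun t : R => t + time z)).
    apply/funext => t; rewrite /tensR /GRing.scale /=; congr (u _ * theta _).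
      by apply/rowP => i; rewrite !space_coord e_coord lshift_neq_time_index.
    by rewrite !time_coord e_coord eqxx.
  have dD : is_derive (0 : R) 1 (fun t : R => t + time z) (1 : R).
    by apply: is_derive_eq; rewrite addr0.
  have d2 := @is_derive1_comp R theta (fun t : R => t + time z) 0 _ _ (dth _) dD.
  have [e1 e2] := is_deriveZ (u (space z)) d2; apply: DeriveDef => //.
  by rewrite e2 add0r mulr1.
have [_ ->] := d1; rewrite [X in _ +i* X](_ : _ = 0).
  by rewrite [RHS](congr1 (fun f => f z) (tensE theta')).
by have [] : is_derive z 'e_(time_index d) (fun _ : 'rV[R]_(d + 1) => 0 : R) 0 by exact: is_derive_cst.
Qed.

End TensorTests.

(** * Transport of the difference of the solutions *)

Section DifferenceEquation.
Context {R : realType} (d : nat).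
Variables (g : 'rV[R]_d -> R[i]) (X Uinf U : tempdist R (d + 1)) (U0 : tempdist R d) (Ut : R -> tempdist R d).
Hypotheses (mg : cmeas g) (pg : poly_bounded g) (hX : VCdual X).
Hypotheses (hUinf : solves_evolution g X Uinf) (hUinfC : VCdual Uinf) (hU : solves_cauchy g X U0 U Ut).

Local Notation MI := (measure_of (fourierSD Uinf)).
Local Notation MU := (measure_of (fourierSD U)).
Local Notation MX := (measure_of (fourierSD X)).

(** The transpose of d/dt + g, acting on a function of time. *)
Definition transport (theta theta' : R -> R) (z : 'rV[R]_(d + 1)) : R[i] :=
  - tcst theta' z + g (space z) * tcst theta z.

Lemma decN n (f : 'rV[R]_n -> R[i]) : dec f -> dec (fun x => - f x).
Proof. by move=> hf; under eq_fun do rewrite -mulN1r; exact: decZ. Qed.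

Lemma space_tempered_transport a b theta theta' : bmp a b theta -> bmp a b theta' ->
  space_tempered (transport theta theta').
Proof.
move=> ht ht'; have t1 := time_decay_tempered (time_decay_bmp d ht).
have t2 := time_decay_tempered (time_decay_bmp d ht'); split.
  by apply: cmeasD; [apply: cmeasN; case: t2|apply: cmeasM; [exact: cmeas_space|case: t1]].
move=> chi hchi.
rewrite (_ : (fun z => _) = fun z => - (chi (space z) * tcst theta' z) + (chi (space z) * g (space z)) * tcst theta z).
  by apply: decD; [apply: decN; exact: t2.2|exact: (t1.2 (fun x => chi x * g x) (decM hchi mg pg))].
by apply/funext => z; rewrite /transport mulrDr mulrN mulrA.
Qed.

Variables (a b : R) (theta theta' : R -> R).
Hypotheses (a0 : 0 <= a) (ht : bmp a b theta) (ht' : bmp a b theta').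
Hypothesis dth : forall t : R, is_derive t 1 theta (theta' t).

(** By density in space it is enough to take a bump there. The test function is then a product bump
    on space-time, hence Schwartz, and both sides equal its pairing with [X]. *)
Lemma transport_eq chi : dec chi ->
  cint MI setT (fun z => chi (space z) * transport theta theta' z) =
  cint MU setT (fun z => chi (space z) * transport theta theta' z).
Proof.
have [sI lI] := VCdual_measure hUinfC.
have [sF _] := Vdual_measure hUinf.1.
have sU : slow_growing MU by case: hU => _ [hUC _ _] _ _; case: (VCdual_measure hUC).
have hT := space_tempered_transport ht ht'.
apply: (space_density sI sU hT hT) => al be c ab c0.
pose u := bbump al be c.
have hF i : bmp (al i) (be i) (bump (al i) (be i) c) by exact: bmp_bump.
have ts := schwartz_tens hF (erefl : u = pbump al be _) ht.
have ts' := schwartz_tens hF (erefl : u = pbump al be _) ht'.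
have dts := schwartz_decay ts; have dts' := schwartz_decay ts'.
have dtt : dt (tens u theta) = tens u theta' := dt_tens u ht dth.
have du : dec (fun x => (u x)%:C) := dec_bbump ab c0.
have dug : dec (fun x => (u x)%:C * g x) := decM du mg pg.
have t1 := time_decay_tempered (time_decay_bmp d ht).
transitivity (cint MX setT (tens u theta)).
  rewrite -(evolution_eq mg pg hX hUinf ts).
  have he : (1 : R) = 1 \/ (1 : R) = -1 by left.
  have tP := time_decay_tempered (time_decay_pft d ht).
  have hpt' := schwartz_decay (schwartz_pft (time_index d) he ts').
  rewrite (_ : (fun z => pft 1 (time_index d) (tens u theta) z * _) = fun z =>
     -1 * pft 1 (time_index d) (tens u theta') z + ((u (space z))%:C * g (space z)) * pft 1 (time_index d) (tcst theta) z).
    rewrite (cintD sF); [|exact: decZ|exact: tP.2 dug].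
    rewrite (cintZ sF)// (evolution_link hUinf.1 hUinfC ts').
    (* The function [u g] is not smooth, so [evolution_link] does not apply to it. The link is known
       for bumps in space, and density carries it to [u g]. *)
    rewrite (space_density sF sI tP t1 _ dug); last first.
      move=> al' be' c' ab' c0'.
      have hF' i : bmp (al' i) (be' i) (bump (al' i) (be' i) c') by exact: bmp_bump.
      have ts2 := schwartz_tens hF' (erefl : bbump al' be' c' = pbump al' be' _) ht.
      rewrite -(evolution_link hUinf.1 hUinfC ts2); congr (cint _ _ _); apply/funext => z.
      by rewrite -(pft_tens (bbump al' be' c') z ht).
    rewrite -(cintZ sI)// -(cintD sI); [|exact: decZ|exact: t1.2 dug].
    congr (cint _ _ _); apply/funext => z; rewrite /transport /tens -/u.
    by rewrite mulN1r mulrDr mulrN mulrA.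
  apply/funext => z; rewrite -dtt pft_dt// (pft_tens u z ht) mulN1r opprK.
  by rewrite mulrDr; congr (_ + _); [rewrite mulrC|rewrite mulrAC].
rewrite -(cauchy_eq mg pg hX hU ts); last first.
  (* The support of [theta] lies in [a, b] with a >= 0, so the test function vanishes for t <= 0. *)
  move=> z tz; rewrite /tens /tcst (bmp_out ht) ?mulr0// negb_and -!leNgt.
  by rewrite (le_trans tz a0).
rewrite dtt -mulN1r -(cintZ sU)// -(cintD sU); [|exact: decZ|]; last first.
  exact: (decM dts (cmeas_space mg) (poly_bounded_space pg)).
congr (cint _ _ _); apply/funext => z; rewrite /transport /tens -/u mulN1r mulrDr mulrN.
by congr (_ + _); rewrite mulrA mulrAC.
Qed.

End DifferenceEquation.

(** * Second-order remainders and integration in time *)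

Section Taylor.
Context {R : realType}.

(** Two uses of the mean value theorem, which give [K h^2] in place of the sharp half of it. *)
Lemma taylor2 (v v1 v2 : R -> R) (K h : R) : 0 <= h ->
  (forall r : R, is_derive r 1 v (v1 r)) -> (forall r : R, is_derive r 1 v1 (v2 r)) ->
  (forall r, 0 <= r -> `|v2 r| <= K) -> `|v h - v 0 - h * v1 0| <= K * h ^+ 2.
Proof.
rewrite le_eqVlt => /orP[/eqP <-|h0] d1 d2 hK.
  by rewrite subrr mul0r subr0 normr0 expr0n mulr0.
have [c] := @MVT R v v1 0 h h0 (fun x _ => d1 x) (continuous_subspaceT (fun x => is_derive_cont (d1 x))).
rewrite in_itv/= => /andP[c0 ch] ->.
have [e] := @MVT R v1 v2 0 c c0 (fun x _ => d2 x) (continuous_subspaceT (fun x => is_derive_cont (d2 x))).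
rewrite in_itv/= => /andP[e0 ec] E.
rewrite subr0 [h * _]mulrC -mulrBl E subr0 !normrM (gtr0_norm h0) (gtr0_norm c0) expr2 mulrA.
by rewrite ler_wpM2r ?(ltW h0)//; apply: ler_pM => //; [exact: ltW|exact/hK/ltW|exact: ltW].
Qed.

Definition cexpN (s : R) (w : R[i]) : R[i] := (expR (- (s * re w)))%:C * expi (- (s * im w)).

Lemma normc_cexpN s w : normc (cexpN s w) = expR (- (s * re w)).
Proof. by rewrite ComplexField.Normc.normcM normcR normc_expi mulr1 ger0_norm ?expR_ge0. Qed.

Lemma normc_cexpN_le1 s w : 0 <= s -> 0 <= re w -> normc (cexpN s w) <= 1.
Proof. by move=> s0 w0; rewrite normc_cexpN -expR0 ler_expR oppr_le0 mulr_ge0. Qed.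

Lemma cexpND s t w : cexpN (s + t) w = cexpN s w * cexpN t w.
Proof.
rewrite /cexpN !mulrDl !opprD expRD expiD.
by apply: eqC; rewrite !reimE /=; ring.
Qed.

Lemma cexpN0 w : cexpN 0 w = 1.
Proof. by rewrite /cexpN !mul0r oppr0 expR0 expi0 mulr1. Qed.

(** With w = p + i q, the functions [v] and [z] are the real part of exp(- r w) and minus its
    imaginary part. Their second derivatives are combinations with coefficients p^2 - q^2 and 2 p q,
    up to signs, hence at most 2 |w|^2; the two parts together give 4. *)
Lemma cexpN_taylor (h : R) (w : R[i]) : 0 <= h -> 0 <= re w ->
  normc (cexpN h w - 1 + h%:C * w) <= 4 * normc w ^+ 2 * h ^+ 2.
Proof.
move=> h0; set p : R := re w; set q : R := im w => p0.
pose e (r : R) := expR (- p * r).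
pose v (r : R) := e r * cos (q * r); pose z (r : R) := e r * sin (q * r).
have dl (k r : R) : is_derive r 1 (fun r : R => k * r) k.
  have [e1 e2] := is_deriveZ k (is_derive_id r (1 : R)).
  by apply: DeriveDef => //; rewrite e2 /GRing.scale /= mulr1.
have de (r : R) : is_derive r 1 e (e r * - p) := @is_derive1_comp R expR (fun r : R => - p * r) r _ _ (is_derive_expR _) (dl _ r).
have dc (r : R) := @is_derive1_comp R cos (fun r : R => q * r) r _ _ (is_derive_cos _) (dl q r).
have ds (r : R) := @is_derive1_comp R sin (fun r : R => q * r) r _ _ (is_derive_sin _) (dl q r).
have dv (r : R) : is_derive r 1 v (- p * v r - q * z r).
  have [e1 e2] := is_deriveM (de r) (dc r); apply: DeriveDef => //.
  by rewrite e2 /v /z /GRing.scale /=; ring.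
have dz (r : R) : is_derive r 1 z (- p * z r + q * v r).
  have [e1 e2] := is_deriveM (de r) (ds r); apply: DeriveDef => //.
  by rewrite e2 /v /z /GRing.scale /=; ring.
have dv1 (r : R) : is_derive r 1 (fun r : R => - p * v r - q * z r) (- p * (- p * v r - q * z r) - q * (- p * z r + q * v r)).
  exact: is_deriveB (is_deriveZ (- p) (dv r)) (is_deriveZ q (dz r)).
have dz1 (r : R) : is_derive r 1 (fun r : R => - p * z r + q * v r) (- p * (- p * z r + q * v r) + q * (- p * v r - q * z r)).
  exact: is_deriveD (is_deriveZ (- p) (dz r)) (is_deriveZ q (dv r)).
have nw : normc w ^+ 2 = p ^+ 2 + q ^+ 2.
  by rewrite /p /q; case: w {p q p0 e v z de dc ds dv dz dv1 dz1} => p q /=; rewrite sqr_sqrtr// addr_ge0// sqr_ge0.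
have ee r : 0 <= r -> 0 <= e r <= 1.
  by move=> r0; rewrite expR_ge0/= -expR0 ler_expR mulNr oppr_le0 mulr_ge0.
have vb r : 0 <= r -> `|v r| <= 1.
  move=> /ee/andP[e0 e1]; rewrite normrM ger0_norm// mulr_ile1// ler_norml.
  by rewrite cos_geN1 cos_le1.
have zb r : 0 <= r -> `|z r| <= 1.
  move=> /ee/andP[e0 e1]; rewrite normrM ger0_norm// mulr_ile1// ler_norml.
  by rewrite sin_geN1 sin_le1.
have bd (x y : R) : `|x| <= 1 -> `|y| <= 1 -> `|(p ^+ 2 - q ^+ 2) * x + 2 * p * q * y| <= 2 * normc w ^+ 2.
  move=> hx hy; rewrite nw; apply: le_trans (ler_normD _ _) _.
  rewrite !normrM (ger0_norm (_ : (0 : R) <= 2))//.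
  have h1 : `|p ^+ 2 - q ^+ 2| <= p ^+ 2 + q ^+ 2.
    rewrite ler_norml; apply/andP; split; have := sqr_ge0 p; have := sqr_ge0 q; lra.
  have h2 : 2 * `|p| * `|q| <= p ^+ 2 + q ^+ 2.
    by have := sqr_ge0 (`|p| - `|q|); rewrite -(real_normK (num_real p)) -(real_normK (num_real q)); nra.
  have h3 := normr_ge0 (p ^+ 2 - q ^+ 2); have h4 : 0 <= 2 * `|p| * `|q| by rewrite !mulr_ge0.
  have := ler_pM h3 (normr_ge0 x) h1 hx; have := ler_pM h4 (normr_ge0 y) h2 hy; lra.
have e00 : e 0 = 1 by rewrite /e mulr0 expR0.
have v00 : v 0 = 1 by rewrite /v mulr0 cos0 e00 mul1r.
have z00 : z 0 = 0 by rewrite /z mulr0 sin0 mulr0.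
have T1 := @taylor2 v _ _ (2 * normc w ^+ 2) h h0 dv dv1.
have T2 := @taylor2 z _ _ (2 * normc w ^+ 2) h h0 dz dz1.
apply: le_trans (normc_le _) _.
rewrite (_ : 4 * normc w ^+ 2 * h ^+ 2 = 2 * normc w ^+ 2 * h ^+ 2 + 2 * normc w ^+ 2 * h ^+ 2); last by ring.
apply: lerD.
  rewrite (_ : re _ = v h - v 0 - h * (- p * v 0 - q * z 0)).
    apply: T1 => r r0; rewrite (_ : - p * _ - _ = (p ^+ 2 - q ^+ 2) * v r + 2 * p * q * z r); last by ring.
    by apply: bd; [exact: vb|exact: zb].
  rewrite v00 z00 /cexpN /v /e /expi !reimE /= -/p -/q mulNr [h * p]mulrC [h * q]mulrC cosN; ring.
rewrite (_ : im _ = - (z h - z 0 - h * (- p * z 0 + q * v 0))).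
  rewrite normrN; apply: T2 => r r0.
  rewrite (_ : - p * _ + _ = (p ^+ 2 - q ^+ 2) * z r + 2 * p * q * (- v r)); last by ring.
  by apply: bd; [exact: zb|rewrite normrN; exact: vb].
rewrite v00 z00 /cexpN /z /e /expi !reimE /= -/p -/q mulNr [h * p]mulrC [h * q]mulrC sinN; ring.
Qed.

(** Cutting [0, T] into m + 1 equal steps bounds the total increment by C T^2 / (m + 1). It replaces
    the statement that a null derivative makes [A] constant. *)
Lemma quadratic_increments (A : R -> R[i]) (T C : R) : 0 <= T ->
  (forall t h, 0 <= t -> 0 <= h -> t + h <= T -> normc (A (t + h) - A t) <= C * h ^+ 2) -> A T = A 0.
Proof.
move=> T0 hA.
have C0 : 0 <= C * T ^+ 2.
  by apply: le_trans (normc_ge0 _) (hA 0 T _ _ _); rewrite ?add0r.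
have S (m : nat) : normc (A T - A 0) <= (C * T ^+ 2) / m.+1%:R.
  pose h := T / m.+1%:R.
  have h0 : 0 <= h by rewrite divr_ge0.
  have hm : m.+1%:R * h = T by rewrite mulrC divfK// pnatr_eq0.
  have step k : (k <= m.+1)%N -> normc (A (k%:R * h) - A 0) <= k%:R * (C * h ^+ 2).
    elim: k => [_|k IH km]; first by rewrite !mul0r subrr ComplexField.Normc.normc0.
    rewrite -natr1 !mulrDl !mul1r -(subrK (A (k%:R * h)) (A (_ + _))) -addrA.
    apply: le_trans (le_normcD _ _) _; rewrite [leRHS]addrC; apply: lerD; last exact/IH/ltnW.
    apply: hA => //; first by rewrite mulr_ge0.
    by rewrite -[X in _ + X]mul1r -mulrDl natr1 -hm ler_wpM2r// ler_nat.
  have := step m.+1 (leqnn _); rewrite hm => /le_trans; apply.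
  rewrite le_eqVlt; apply/orP; left; apply/eqP; rewrite /h; field.
  by rewrite nat1r pnatr_eq0.
apply/eqP; rewrite -subr_eq0; apply/eqP; apply: ComplexField.Normc.eq0_normc.
apply/eqP; rewrite eq_le normc_ge0 andbT; apply/ler_addgt0Pr => e e0; rewrite add0r.
pose m := Num.truncn (C * T ^+ 2 / e).
apply: le_trans (S m) _; rewrite ler_pdivrMr// [leRHS]mulrC -ler_pdivrMr//.
by rewrite ltW// truncnS_gt.
Qed.

End Taylor.

Section Shift.
Context {R : realType}.

Lemma normc_jc (j : nat) : (j < 4)%N -> normc (jc j : R[i]) = 1.
Proof.
case: j => [|[|[|[|j]]]] //= _; rewrite /jc /= /ComplexField.Normc.normc /=;
  by rewrite ?sqrrN ?oppr0 expr0n/= expr1n ?addr0 ?add0r sqrtr1.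
Qed.

(** [N] and [C] depend on the measure only and the bound involves only the modulus of [f], which is
    the source of uniformity over translations. *)
Lemma cint_bound n (mu : set 'rV[R]_n -> R[i]) : slow_growing mu -> exists N C, 0 <= C /\
  forall f K, cmeas f -> (forall x, normc (f x) <= K * pw N x) -> normc (cint mu setT f) <= C * K.
Proof.
move=> /slow_growing_jrep[p [N [mp ip]]]; exists N, (\sum_(j < 4) 2 * rint (p j) setT (pw N)); split.
  by apply: sumr_ge0 => j _; rewrite mulr_ge0// rint_ge0// => x; exact/ltW/pw_gt0.
move=> f K mf hf; rewrite (cint_jrep mp); last by move=> j; exact: citg_pw (ip j) mf hf.
apply: le_trans (normc_sum _ _) _; rewrite mulr_suml; apply: ler_sum => j _.
rewrite ComplexField.Normc.normcM normc_jc// mul1r -mulrA [_ * K]mulrC -rintZ//.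
exact: (normc_lint_le mf (itgZ K (ip j)) hf).
Qed.

Variable d : nat.
Variables (g : 'rV[R]_d -> R[i]) (X Uinf U : tempdist R (d + 1)) (U0 : tempdist R d) (Ut : R -> tempdist R d).
Hypotheses (mg : cmeas g) (pg : poly_bounded g) (g0 : forall x, 0 <= re (g x)) (hX : VCdual X).
Hypotheses (hUinf : solves_evolution g X Uinf) (hUinfC : VCdual Uinf) (hU : solves_cauchy g X U0 U Ut).

Local Notation MI := (measure_of (fourierSD Uinf)).
Local Notation MU := (measure_of (fourierSD U)).

Lemma cmeas_cexpN s : cmeas (fun x => cexpN s (g x)).
Proof.
apply: cmeasM.
  apply: cmeas_real; apply: (measurableT_comp (measurable_expR (R := R))).
  by apply: measurableT_comp => //; apply: measurable_funM; [exact: measurable_cst|exact: mg.1].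
by apply: cmeas_expi; apply: measurableT_comp => //; apply: measurable_funM; [exact: measurable_cst|exact: mg.2].
Qed.

Lemma dec_cexpN chi s : 0 <= s -> dec chi -> dec (fun x => chi x * cexpN s (g x)).
Proof.
move=> s0 hchi; apply: decM => //; first exact: cmeas_cexpN.
by exists 0%N, 1 => x; rewrite expr0 mulr1 normc_cexpN_le1.
Qed.

Definition diffpair f : R[i] := cint MI setT f - cint MU setT f.

Variables (a b : R) (theta : R -> R).
Hypotheses (a0 : 0 <= a) (ht : bmp a b theta).

Let sI : slow_growing MI. Proof. by case: (VCdual_measure hUinfC). Qed.
Let sU : slow_growing MU. Proof. by case: hU => _ [hUC _ _] _ _; case: (VCdual_measure hUC). Qed.

(** [A] interpolates between the two sides, its formal derivative at [t] being the pairing with a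
    [transport] expression, which vanishes by [transport_eq]. Subtracting [h] times that expression
    from an increment therefore changes nothing and leaves a second-order remainder. *)
Lemma shift_eq chi T : dec chi -> 0 <= T ->
  diffpair (fun z => chi (space z) * tcst (fun s => theta (s - T)) z) =
  diffpair (fun z => chi (space z) * cexpN T (g (space z)) * tcst theta z).
Proof.
move=> hchi T0.
have [th1 hth1 dth] := bmp_derive ht; have [th2 hth2 dth1] := bmp_derive hth1.
have [M M0 hM] := bmp_bounded ht; have [K2 K20 hK2] := bmp_bounded hth2.
pose tht t := fun s => theta (s - t); pose tht1 t := fun s => th1 (s - t).
have bt t : bmp (a + t) (b + t) (tht t) by exact: bmp_shift.
have bt1 t : bmp (a + t) (b + t) (tht1 t) by exact: bmp_shift.
have dsh (f f1 : R -> R) (t s : R) : (forall r : R, is_derive r 1 f (f1 r)) -> is_derive s 1 (fun s : R => f (s - t)) (f1 (s - t)).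
  move=> df; have dD : is_derive s 1 (fun s : R => s - t) (1 : R) by apply: is_derive_eq; rewrite subr0.
  have [e1 e2] := @is_derive1_comp R f (fun s : R => s - t) s _ _ (df _) dD.
  by apply: DeriveDef => //; rewrite e2 mulr1.
pose A t := diffpair (fun z => chi (space z) * cexpN (T - t) (g (space z)) * tcst (tht t) z).
have EA0 : A 0 = diffpair (fun z => chi (space z) * cexpN T (g (space z)) * tcst theta z).
  rewrite /A subr0; congr (diffpair _); apply/funext => z; congr (_ * _).
  by rewrite /tcst /tht subr0.
have EAT : A T = diffpair (fun z => chi (space z) * tcst (fun s => theta (s - T)) z).
  by rewrite /A subrr; congr (diffpair _); apply/funext => z; rewrite cexpN0 mulr1.
rewrite -EA0 -EAT.
have ST t := time_decay_tempered (time_decay_bmp d (bt t)).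
have [N1 [C1 [C10 hC1]]] := cint_bound sI; have [N2 [C2 [C20 hC2]]] := cint_bound sU.
(* The remainder of the exponential is O(|g|^2 h^2), so [chi g^2] has to decay as well; polynomial
   growth of [g] provides this. *)
have dgg : dec (fun x => chi x * g x * g x) by apply: decM => //; exact: decM.
pose B := b + T.
have Kex N : exists K : R, forall t h : R, 0 <= t -> 0 <= h -> t + h <= T -> forall z : 'rV[R]_(d + 1),
    normc (chi (space z) * cexpN (T - t - h) (g (space z)) *
      ((theta (time z - (t + h)))%:C - cexpN h (g (space z)) * (theta (time z - t))%:C
       - h%:C * (- (th1 (time z - t))%:C + g (space z) * (theta (time z - t))%:C))) <= K * h ^+ 2 * pw N z.
  have [L1 L10 hL1] := decay_pw hchi.2 N; have [L2 L20 hL2] := decay_pw dgg.2 N.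
  (* [S] pays for the missing time variable: for times in (0, B), [pw N] at the space component is
     at most [S] times [pw N] at the space-time point. *)
  pose S := (1 + B ^+ 2) ^+ N.
  have S0 : 0 <= S by rewrite exprn_ge0// addr_ge0// sqr_ge0.
  exists ((L1 * K2 + 4 * L2 * M) * S) => t h t0 h0 thT z.
  set x := space z; set s := time z - t.
  have K0 : 0 <= (L1 * K2 + 4 * L2 * M) * S * h ^+ 2 * pw N z.
    by rewrite !mulr_ge0 ?sqr_ge0 ?addr_ge0 ?mulr_ge0// ltW// pw_gt0.
  have sE : time z - (t + h) = s - h by rewrite opprD addrA.
  rewrite sE.
  (* Shifts by at most T keep all supports inside (0, b + T), so outside of it the remainder is
     zero. *)
  have [tz|tz] := boolP (0 < time z < B); last first.
    have z1 (t' : R) (f : R -> R) : 0 <= t' -> t' <= T -> bmp a b f -> f (time z - t') = 0.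
      move=> t'0 t'T hf; apply: (bmp_out hf); apply: contra tz; rewrite ltrBrDr ltrBlDr /B => /andP[h1 h2].
      by rewrite (le_lt_trans _ h1) ?addr_ge0//= (lt_le_trans h2)// lerD2l.
    rewrite -sE !(z1 _ _ _ _ ht) ?addr_ge0//; try lra.
    by rewrite (z1 _ _ _ _ hth1)//; [rewrite !(mulr0, oppr0, addr0, subr0) ComplexField.Normc.normc0|lra].
  have pwS : pw N x <= S * pw N z.
    have p1 := sqnormD1_gt0 x; have p2 := sqnormD1_gt0 z.
    rewrite /pw ler_pdivlMr ?exprn_gt0// mulrC ler_pdivrMr ?exprn_gt0// /S -exprMn.
    have /andP[tz1 tz2] := tz.
    apply: lerXn2r; rewrite ?nnegrE ?mulr_ge0 ?(ltW p1) ?(ltW p2) ?addr_ge0 ?sqr_ge0//.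
    have tB : time z ^+ 2 <= B ^+ 2 by rewrite ler_sqr ?nnegrE; lra.
    rewrite -[in leLHS](spacetimeE z) sqnorm_spacetime -/x.
    by have := sqnorm_ge0 x; have := sqr_ge0 B; nra.
  (* Regrouping separates the Taylor remainder of [theta] in time from that of the exponential; the
     mixed first-order terms cancel. *)
  have E : (theta (s - h))%:C - cexpN h (g x) * (theta s)%:C - h%:C * (- (th1 s)%:C + g x * (theta s)%:C) =
      (theta (s - h) - theta s + h * th1 s)%:C - (cexpN h (g x) - 1 + h%:C * g x) * (theta s)%:C.
    by apply: eqC; rewrite !reimE /=; ring.
  rewrite E; have r1 : `|theta (s - h) - theta s + h * th1 s| <= K2 * h ^+ 2.
    have dD (r : R) : is_derive r 1 (fun r : R => s - r) (- 1 : R).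
      have [e1 e2] := is_deriveB (is_derive_cst (s : R) r (1 : R)) (is_derive_id r (1 : R)).
      by apply: DeriveDef => //; rewrite e2 sub0r.
    have dv (r : R) : is_derive r 1 (fun r : R => theta (s - r)) (- th1 (s - r)).
      have [e1 e2] := @is_derive1_comp R theta (fun r : R => s - r) r _ _ (dth _) (dD r).
      by apply: DeriveDef => //; rewrite e2 mulrN1.
    have dv1 (r : R) : is_derive r 1 (fun r : R => - th1 (s - r)) (th2 (s - r)).
      have [e1 e2] := is_deriveN (@is_derive1_comp R th1 (fun r : R => s - r) r _ _ (dth1 _) (dD r)).
      by apply: DeriveDef => //; rewrite e2 mulrN1 opprK.
    have := @taylor2 R _ _ _ K2 h h0 dv dv1 (fun r _ => hK2 _).
    by rewrite subr0 mulrN opprK.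
  have r2 := cexpN_taylor h0 (g0 x).
  have e1 : normc (cexpN (T - t - h) (g x)) <= 1 by apply: normc_cexpN_le1 => //; lra.
  apply: (@le_trans _ _ (normc (chi x) * (K2 * h ^+ 2 + 4 * normc (g x) ^+ 2 * h ^+ 2 * M))).
    rewrite (ComplexField.Normc.normcM (chi x * _)) (ComplexField.Normc.normcM (chi x)) -mulrA.
    rewrite ler_wpM2l ?normc_ge0// -[leRHS]mul1r; apply: ler_pM => //; [exact: normc_ge0|exact: normc_ge0|].
    apply: le_trans (le_normcD _ _) _.
    rewrite normcN (ComplexField.Normc.normcM _ (theta s)%:C) !normcR.
    by apply: lerD => //; apply: ler_pM => //; exact: normc_ge0.
  have := hL1 x; have := hL2 x; rewrite !ComplexField.Normc.normcM => l2 l1.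
  rewrite (_ : normc (chi x) * _ = normc (chi x) * (K2 * h ^+ 2) + normc (chi x) * normc (g x) * normc (g x) * (4 * M * h ^+ 2)); last by ring.
  apply: (@le_trans _ _ (L1 * pw N x * (K2 * h ^+ 2) + L2 * pw N x * (4 * M * h ^+ 2))).
    by apply: lerD; apply: ler_wpM2r => //; rewrite !mulr_ge0 ?sqr_ge0.
  rewrite (_ : _ + _ = (L1 * K2 + 4 * L2 * M) * h ^+ 2 * pw N x); last by ring.
  rewrite (_ : _ * S * _ * _ = (L1 * K2 + 4 * L2 * M) * h ^+ 2 * (S * pw N z)); last by ring.
  by rewrite ler_wpM2l// mulr_ge0 ?sqr_ge0// addr_ge0// !mulr_ge0.
have [K1 hK1] := Kex N1; have [K3 hK3] := Kex N2.
apply: (@quadratic_increments R A T (C1 * K1 + C2 * K3)) => // t h t0 h0 thT.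
pose eta x := chi x * cexpN (T - t - h) (g x).
have heta : dec eta by apply: dec_cexpN => //; lra.
have hetaE : dec (fun x => eta x * cexpN h (g x)) by exact: dec_cexpN.
have at0 : 0 <= a + t by exact: addr_ge0.
have tr := transport_eq mg pg hX hUinf hUinfC hU at0 (bt t) (bt1 t) (fun s => dsh theta th1 t s dth) heta.
have hTr := (space_tempered_transport mg pg (bt t) (bt1 t)).2 _ heta.
pose f1 (z : 'rV[R]_(d + 1)) := eta (space z) * tcst (tht (t + h)) z.
pose f2 (z : 'rV[R]_(d + 1)) := eta (space z) * cexpN h (g (space z)) * tcst (tht t) z.
pose f3 (z : 'rV[R]_(d + 1)) := eta (space z) * transport g (tht t) (tht1 t) z.
pose f z := f1 z + (-1 * f2 z + - h%:C * f3 z).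
have d1 : dec f1 := (ST _).2 _ heta.
have d2 : dec f2 := (ST t).2 _ hetaE.
have d23 : dec (fun z => -1 * f2 z + - h%:C * f3 z) by apply: decD; exact: decZ.
have lin mu : slow_growing mu -> cint mu setT f = cint mu setT f1 + (-1 * cint mu setT f2 + - h%:C * cint mu setT f3).
  move=> smu; rewrite (cintD smu d1 d23) (cintD smu); [|exact: decZ|exact: decZ].
  by rewrite (cintZ smu)// (cintZ smu).
have EAt : A (t + h) - A t = cint MI setT f - cint MU setT f.
  (* [tr] rewrites the pairing of [f3] with the first measure into that with the second, so the
     added term cancels in the difference. *)
  rewrite (lin _ sI) (lin _ sU) [cint MI setT f3]tr /A /diffpair.
  have -> : (fun z => chi (space z) * cexpN (T - (t + h)) (g (space z)) * tcst (tht (t + h)) z) = f1.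
    by apply/funext => z; rewrite /f1 /eta opprD addrA.
  have -> : (fun z => chi (space z) * cexpN (T - t) (g (space z)) * tcst (tht t) z) = f2.
    apply/funext => z.
    transitivity (chi (space z) * (cexpN (T - t - h) (g (space z)) * cexpN h (g (space z))) * tcst (tht t) z).
      by rewrite -cexpND subrK.
    by rewrite /f2 /eta mulrA.
  by move: (cint MI setT f1) (cint MI setT f2) (cint MU setT f1) (cint MU setT f2) (cint MU setT f3) => ? ? ? ? ?; ring.
have df : dec f by exact: decD.
have fE z : f z = chi (space z) * cexpN (T - t - h) (g (space z)) *
      ((theta (time z - (t + h)))%:C - cexpN h (g (space z)) * (theta (time z - t))%:C
       - h%:C * (- (th1 (time z - t))%:C + g (space z) * (theta (time z - t))%:C)).
  rewrite /f /f1 /f2 /f3 /eta /transport /tcst /tht /tht1.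
  by move: (theta (time z - (t + h)))%:C (theta (time z - t))%:C (th1 (time z - t))%:C (chi (space z)) (cexpN (T - t - h) (g (space z))) (cexpN h (g (space z))) (g (space z)) => ? ? ? ? ? ? ?; ring.
rewrite EAt mulrDl -!mulrA; apply: le_trans (le_normcD _ _) _; rewrite normcN.
apply: lerD; [apply: hC1|apply: hC2]; first exact: df.1.
- by move=> z; rewrite fE; exact: hK1.
- exact: df.1.
- by move=> z; rewrite fE; exact: hK3.
Qed.

End Shift.

(** * Evaluation at a fixed time *)

Section Mollifiers.
Context {R : realType}.
Local Notation lam := (@lebesgue_measure R).

(* The integral is a difference of suprema over simple functions. *)
Lemma le_integral_any (dsp : measure_display) (T : measurableType dsp) (mu : {measure set T -> \bar R}) (f1 f2 : T -> R) :
  (forall x, f1 x <= f2 x) -> (\int[mu]_x (f1 x)%:E <= \int[mu]_x (f2 x)%:E)%E.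
Proof.
move=> h; rewrite /integral !patch_setT; apply: leeB.
  apply: ereal_sup_le => _ [k hk <-]; exists k => // x; apply: le_trans (hk x) _.
  by rewrite !funeposE ge_max !le_max lee_fin h lexx orbT.
apply: ereal_sup_le => _ [k hk <-]; exists k => // x; apply: le_trans (hk x) _.
by rewrite !funenegE -!EFinN ge_max !le_max !lee_fin lerN2 h lexx orbT.
Qed.

(** [f] is not assumed measurable: its integral lies between two finite values, hence is finite, and
    [fine] loses nothing. *)
Lemma rint_squeeze (dsp : measure_display) (T : measurableType dsp) (mu : {measure set T -> \bar R}) (f f1 f2 : T -> R) :
  itg mu f1 -> itg mu f2 -> (forall x, f1 x <= f x <= f2 x) ->
  rint mu setT f1 <= rint mu setT f <= rint mu setT f2.
Proof.
move=> i1 i2 h; have h1 := le_integral_any mu (fun x => proj1 (andP (h x))).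
have h2 := le_integral_any mu (fun x => proj2 (andP (h x))).
move: h1 h2; rewrite (rintE i1) (rintE i2) /rint.
by case: (\int[mu]_x (f x)%:E)%E => [r| |] //=; rewrite !lee_fin => -> ->.
Qed.

(** Only the right limit of [w] at [T] is used. Since [del] works for every [rho] supported in (T, T
    + del), several functions can later share one bump. *)
Lemma mollify (w : R -> R) (T : R) (D : set R) (e : R) : 0 < e -> (forall s, T < s -> D s) ->
  w s @[s --> T^'+] --> w T ->
  exists2 del, 0 < del & forall rho : R -> R, itg lam rho -> (forall s, 0 <= rho s) ->
    (forall s, rho s != 0 -> T < s < T + del) ->
    `|rint lam D (fun t => w t * rho t) - w T * rint lam setT rho| <= e * rint lam setT rho.
Proof.
move=> e0 TD /cvgrPdist_le/(_ e e0); rewrite near_withinE => /nbhs_ballP[del /= d0 hd].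
exists del => // rho ir r0 supp.
rewrite rint_indic.
have E : (fun t => \1_D t * (w t * rho t)) = (fun t => w t * rho t).
  apply/funext => t; rewrite indicE; have [->|/supp/andP[h1 h2]] := eqVneq (rho t) 0; first by rewrite !mulr0.
  by rewrite mem_set ?mul1r//; exact: TD.
rewrite E.
have i1 := itgZ (w T - e) ir; have i2 := itgZ (w T + e) ir.
have /andP[] : rint lam setT (fun t => (w T - e) * rho t) <= rint lam setT (fun t => w t * rho t)
    <= rint lam setT (fun t => (w T + e) * rho t).
  apply: (@rint_squeeze _ _ lam _ _ _ i1 i2) => t; have [->|/supp/andP[h1 h2]] := eqVneq (rho t) 0; first by rewrite !mulr0 lexx.
  have : `|w T - w t| <= e.
    by apply: hd => //; rewrite /ball /= distrC ger0_norm ?subr_ge0 ?(ltW h1)// ltrBlDl.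
  by rewrite ler_distlC => /andP[h3 h4]; apply/andP; split; apply: ler_wpM2r => //; lra.
rewrite (@rintZ _ _ R lam (w T - e) rho ir) (@rintZ _ _ R lam (w T + e) rho ir) => h1 h2.
by rewrite ler_distl; apply/andP; split; lra.
Qed.

Lemma itg_bmp a b f : bmp a b f -> itg lam f.
Proof.
move=> hf; have [M M0 hM] := bmp_bounded hf; pose S := (`|a| + `|b|) ^+ 2.
have S0 : 0 <= S := sqr_ge0 _.
apply: (itg_le _ (itgZ ((1 + S) * M) itg_oneDsqrV)).
  by apply: continuous_measurable_fun; exact: bmp_continuous hf.
move=> y; have y0 : 0 < 1 + y ^+ 2 by rewrite ltr_pwDl// sqr_ge0.
rewrite ler_pdivlMr//; have [/andP[h1 h2]|h] := boolP (a < y < b); last first.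
  by rewrite (bmp_out hf h) normr0 mul0r mulr_ge0// addr_ge0.
rewrite mulrC; apply: ler_pM => //; first exact: ltW.
rewrite lerD2l -[leLHS]real_normK ?num_real// ler_sqr ?nnegrE ?addr_ge0// ler_norml; apply/andP; split.
  by have := ler_norm (- a); rewrite normrN; have := normr_ge0 b; lra.
by have := ler_norm b; have := normr_ge0 a; lra.
Qed.

Lemma rint_bump_gt0 a b : a < b -> 0 < rint lam setT (bump a b 1).
Proof.
move=> ab; have ib := itg_bmp (bmp_bump ab ltr01).
(* On the middle half [a', b'] both distances to the ends are at least (b - a) / 4, so (x - a) (b -
   x) >= s0 and the bump is at least [m] there. *)
pose a' := (3 * a + b) / 4; pose b' := (a + 3 * b) / 4.
have ab' : a' < b' by rewrite /a' /b'; lra.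
pose s0 := (b - a) ^+ 2 / 16; pose m := expR (- (1 / s0)).
have s0p : 0 < s0 by rewrite divr_gt0// exprn_gt0// subr_gt0.
have mI : measurable_fun setT (\1_(`[a', b']%classic) : R -> R) by apply: measurable_indic.
have lE x : m * \1_(`[a', b']%classic) x <= bump a b 1 x.
  rewrite indicE; have [|_] := boolP (x \in `[a', b']%classic); last by rewrite mulr0 flat_ge0.
  rewrite inE /= in_itv /= => /andP[h1 h2]; rewrite mulr1 bumpE//.
  have ha : a < x by move: h1; rewrite /a'; lra.
  have hb : x < b by move: h2; rewrite /b'; lra.
  rewrite ha hb /= ler_expR lerN2 !div1r lef_pV2 ?posrE//; last by rewrite mulr_gt0 ?subr_gt0.
  rewrite /s0 ler_pdivrMr//; move: h1 h2; rewrite /a' /b' => h1 h2.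
  have h3 : (b - a) / 4 <= x - a by lra.
  have h4 : (b - a) / 4 <= b - x by lra.
  have p0 : 0 <= x - a - (b - a) / 4 by lra.
  have q0 : 0 <= b - x - (b - a) / 4 by lra.
  have D0 : 0 <= (b - a) / 4 by lra.
  by have := mulr_ge0 p0 q0; have := mulr_ge0 D0 (addr_ge0 p0 q0); nra.
have iI : itg lam (fun x => m * \1_(`[a', b']%classic) x).
  apply: (itg_le _ ib); first by apply: measurable_funM => //; exact: measurable_cst.
  by move=> x; rewrite ger0_norm// mulr_ge0// expR_ge0.
apply: lt_le_trans (@ler_rint _ _ R lam _ _ iI ib lE).
have iI1 : itg lam (fun x => \1_(`[a', b']%classic) x : R).
  have := @itgZ _ _ R lam m^-1 _ iI; under eq_fun do rewrite mulrA mulVf ?gt_eqF ?expR_gt0// mul1r.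
  exact.
have L : lam `[a', b']%classic = (b' - a')%:E by rewrite lebesgue_measure_itv/= lte_fin ab' EFinB.
rewrite (@rintZ _ _ R lam m _ iI1) mulr_gt0 ?expR_gt0//.
have -> : rint lam setT (fun x => \1_(`[a', b']%classic) x : R) = b' - a'.
  by rewrite /rint integral_indic// setIT; exact: (congr1 fine L).
by rewrite subr_gt0.
Qed.

Lemma rint_shift (f : R -> R) (T : R) : continuous f -> (forall x, 0 <= f x) ->
  rint lam setT (fun s => f (s - T)) = rint lam setT f.
Proof.
move=> cf f0; rewrite /rint; congr fine.
have dF (x : R) : is_derive x 1 (fun s : R => s - T) (1 : R) by apply: is_derive_eq; rewrite subr0.
have F1 : derive1 (fun s : R => s - T) = cst 1.
  by apply/funext => x; rewrite derive1E; have [_ ->] := dF x.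
rewrite [RHS](@increasing_ge0_integration_by_substitutionT R (fun s => s - T) f)//.
- by apply: eq_integral => x _; rewrite F1 /= [in RHS]/GRing.mul /= mulr1.
- by move=> x y xy; rewrite ltrD2r.
- by rewrite F1; exact: cst_continuous.
- by rewrite F1; exact: is_cvg_cst.
- by rewrite F1; exact: is_cvg_cst.
- apply/cvgrNyPle => A; near=> x; rewrite lerBlDr; near: x; apply: nbhs_ninfty_le; exact: num_real.
- apply/cvgryPge => A; near=> x; rewrite lerBrDr; near: x; apply: nbhs_pinfty_ge; exact: num_real.
Unshelve. all: by end_near.
Qed.

End Mollifiers.

Section Pairing.
Context {R : realType}.
Local Notation lam := (@lebesgue_measure R).

Lemma Vifourier_fourier n (chi : 'rV[R]_n -> R[i]) : CFD chi -> Vifourier (fourier chi) = chi.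
Proof.
move=> hc.
have [h1 h2] := @xgetPex _ (fun=> 0) [set psi | CFD psi /\ fourier psi = fourier chi] (ex_intro _ chi (conj hc erefl)).
exact: fourier_inj h1 hc h2.
Qed.

Lemma CFD_dec n (chi : 'rV[R]_n -> R[i]) : CFD chi -> dec chi.
Proof. by move=> hc; split; [exact: CFD_cmeas|exact: CFD_decay]. Qed.

Lemma fourier_translation n (chi : 'rV[R]_n -> R[i]) h :
  (fun x => fourier chi (x - h)) = fourier (fun x => expi (1 * dotv h x) * chi x).
Proof.
apply/funext => y; rewrite /fourier; congr (_ * lint _ _ _); apply/funext => x.
rewrite mulrA -expiD mul1r; congr (expi _ * _).
rewrite /dotv -!sumrN -big_split; apply: eq_bigr => i _ /=.
by rewrite !mxE mulrBl opprB addrC.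
Qed.

Lemma mollifyC (w : R -> R[i]) (T : R) (D : set R) (e : R) : 0 < e -> (forall s, T < s -> D s) ->
  re (w s) @[s --> T^'+] --> re (w T) -> im (w s) @[s --> T^'+] --> im (w T) ->
  exists2 del, 0 < del & forall rho : R -> R, itg lam rho -> (forall s, 0 <= rho s) ->
    (forall s, rho s != 0 -> T < s < T + del) ->
    normc (lint lam D (fun t => w t * (rho t)%:C) - w T * (rint lam setT rho)%:C) <= 2 * e * rint lam setT rho.
Proof.
move=> e0 TD wr wi.
have [d1 d10 h1] := mollify e0 TD wr; have [d2 d20 h2] := mollify e0 TD wi.
exists (Num.min d1 d2) => [|rho ir r0 supp]; first by rewrite lt_min d10 d20.
have s1 s : rho s != 0 -> T < s < T + d1.
  by move=> /supp/andP[-> h] /=; apply: lt_le_trans h _; rewrite lerD2l ge_min lexx.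
have s2 s : rho s != 0 -> T < s < T + d2.
  by move=> /supp/andP[-> h] /=; apply: lt_le_trans h _; rewrite lerD2l ge_min lexx orbT.
have b1 := h1 rho ir r0 s1; have b2 := h2 rho ir r0 s2.
apply: le_trans (normc_le _) _; rewrite -mulrA mulrDl mul1r.
have E1 : (fun t => re (w t * (rho t)%:C)) = (fun t => re (w t) * rho t).
  by apply/funext => t; rewrite re_mul /= mulr0 subr0.
have E2 : (fun t => im (w t * (rho t)%:C)) = (fun t => im (w t) * rho t).
  by apply/funext => t; rewrite im_mul /= mulr0 add0r.
apply: lerD.
  by apply: le_trans b1; rewrite !reimE /lint /= E1 mulr0 subr0.
by apply: le_trans b2; rewrite !reimE /lint /= E2 mulr0 add0r.
Qed.

Lemma CFD1_bmp a b (theta : R -> R) : bmp a b theta -> CFD1 (fun t => (theta t)%:C).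
Proof.
move=> ht; have h : schwartz (fun v : 'rV[R]_1 => (pbump (fun=> a) (fun=> b) (fun=> theta) v)%:C).
  by apply: schwartz_real; apply: rs_pbump.
have := schwartz_CFD h; rewrite /CFD1 (_ : (fun v => _) = (fun v : 'rV[R]_1 => (theta (v 0 0))%:C))//.
by apply/funext => v; rewrite /pbump big_ord1.
Qed.

Lemma cadlag_pairing d (D : set R) (V : tempdist R (d + 1)) (Vt : R -> tempdist R d) chi a b theta :
  cadlag_representation D V Vt -> CFD chi -> bmp a b theta ->
  cint (measure_of (fourierSD V)) setT (fun z => chi (space z) * tcst theta z) =
  lint lam D (fun t => Vpair (Vt t) (fourier chi) * (theta t)%:C).
Proof.
move=> [_ _ hV] hc ht; have [|_ _ h] := hV (fourier chi); first by exists chi.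
by rewrite -(h _ (CFD1_bmp ht)) /VCpair Vifourier_fourier.
Qed.

Variable d : nat.
Variables (g : 'rV[R]_d -> R[i]) (X Uinf U : tempdist R (d + 1)) (U0 : tempdist R d).
Variables (Uinft Ut : R -> tempdist R d).
Hypotheses (mg : cmeas g) (pg : poly_bounded g) (cg : ccontinuous g) (g0 : forall x, 0 <= re (g x)) (hX : VCdual X).
Hypotheses (hUinf : solves_evolution g X Uinf) (hUinft : cadlag_representation setT Uinf Uinft).
Hypothesis (hU : solves_cauchy g X U0 U Ut).

(** Continuity of [g] enters here: exp(- s g) chi has to lie in C_FD for its Fourier transform to be
    an argument of [Vpair]. *)
Lemma CFD_cexpN chi s : 0 <= s -> CFD chi -> CFD (fun x => chi x * cexpN s (g x)).
Proof.
move=> s0 hc; apply: (CFD_le hc); last first.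
  move=> x; rewrite (ComplexField.Normc.normcM (chi x)) ler_piMr ?normc_ge0//.
  exact: normc_cexpN_le1.
apply: ccontinuousM; first by case: hc.
have [c1 c2] := cg.
have ce : continuous (fun x => expR (- (s * re (g x)))).
  move=> x; apply: (@continuous_comp _ _ _ (fun x => re (g x)) (fun r : R => expR (- (s * r)))); first exact: c1.
  apply: (@continuous_comp _ _ _ (fun r : R => - (s * r)) expR); last exact: continuous_expR.
  by apply: cvgN; apply: cvgM; [exact: cvg_cst|exact: cvg_id].
have ci : continuous (fun x => - (s * im (g x))).
  move=> x; apply: (@continuous_comp _ _ _ (fun x => im (g x)) (fun r : R => - (s * r))); first exact: c2.
  by apply: cvgN; apply: cvgM; [exact: cvg_cst|exact: cvg_id].
split.
  rewrite (_ : (fun x => _) = fun x => expR (- (s * re (g x))) * cos (- (s * im (g x)))).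
    apply: continuous_mulr => // x.
    by apply: (@continuous_comp _ _ _ (fun x => - (s * im (g x))) cos); [exact: ci|exact: continuous_cos].
  by apply/funext => x; rewrite /cexpN /expi re_mul /= mul0r subr0.
rewrite (_ : (fun x => _) = fun x => expR (- (s * re (g x))) * sin (- (s * im (g x)))).
  apply: continuous_mulr => // x.
  by apply: (@continuous_comp _ _ _ (fun x => - (s * im (g x))) sin); [exact: ci|exact: continuous_sin].
by apply/funext => x; rewrite /cexpN /expi im_mul /= mul0r addr0.
Qed.

(** Each of the four pairings at a fixed time is approximated by a smeared one, for which [shift_eq]
    is an exact identity. *)
Lemma pairing_shift chi T : CFD chi -> 0 <= T ->
  Vpair (Uinft T) (fourier chi) - Vpair (Ut T) (fourier chi) =
  Vpair (Uinft 0) (fourier (fun x => chi x * cexpN T (g x))) -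
  Vpair (Ut 0) (fourier (fun x => chi x * cexpN T (g x))).
Proof.
move=> hc T0; pose chi' x := chi x * cexpN T (g x).
have hc' : CFD chi' by exact: CFD_cexpN.
have hUr : cadlag_representation [set t | 0 <= t] U Ut by case: hU.
have hUC : VCdual Uinf by case: hUinft.
apply/eqP; rewrite -subr_eq0; apply/eqP; apply: ComplexField.Normc.eq0_normc.
set dif := _ - _; apply/eqP; rewrite eq_le normc_ge0 andbT; apply/ler_addgt0Pr => e e0; rewrite add0r.
(* Four errors, each 2 (e / 8) times the mass of the bump, add up to [e] times that mass. *)
have e8 : 0 < e / 8 by rewrite divr_gt0.
have m1 psi S (hpsi : CFD psi) : 0 <= S -> exists2 del, 0 < del & forall rho : R -> R, itg lam rho -> (forall s, 0 <= rho s) ->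
    (forall s, rho s != 0 -> S < s < S + del) ->
    normc (lint lam setT (fun t => Vpair (Uinft t) (fourier psi) * (rho t)%:C) - Vpair (Uinft S) (fourier psi) * (rint lam setT rho)%:C) <= 2 * (e / 8) * rint lam setT rho.
  move=> S0; have [_ _ h] := hUinft; have [|[h1 h2] _ _] := h (fourier psi); first by exists psi.
  apply: (@mollifyC (fun t => Vpair (Uinft t) (fourier psi)) S setT) => //.
    by have [] := h1 S.
  by have [] := h2 S.
have m2 psi S (hpsi : CFD psi) : 0 <= S -> exists2 del, 0 < del & forall rho : R -> R, itg lam rho -> (forall s, 0 <= rho s) ->
    (forall s, rho s != 0 -> S < s < S + del) ->
    normc (lint lam [set t | 0 <= t] (fun t => Vpair (Ut t) (fourier psi) * (rho t)%:C) - Vpair (Ut S) (fourier psi) * (rint lam setT rho)%:C) <= 2 * (e / 8) * rint lam setT rho.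
  move=> S0; have [_ _ h] := hUr; have [|[h1 h2] _ _] := h (fourier psi); first by exists psi.
  apply: (@mollifyC (fun t => Vpair (Ut t) (fourier psi)) S) => //.
  - by move=> s /ltW; exact: le_trans.
  - by have [] := h1 S S0.
  - by have [] := h2 S S0.
have [d1 d10 H1] := m1 chi T hc T0; have [d2 d20 H2] := m2 chi T hc T0.
have [d3 d30 H3] := m1 chi' 0 hc' (lexx _); have [d4 d40 H4] := m2 chi' 0 hc' (lexx _).
(* The smallest of the four radii lets one bump serve at time 0 and, shifted, at time T. *)
pose del := Num.min (Num.min d1 d2) (Num.min d3 d4).
have del0 : 0 < del by rewrite !lt_min d10 d20 d30 d40.
pose rho := bump 0 del 1.
have hr : bmp 0 del rho := bmp_bump del0 ltr01.
have hrT : bmp (0 + T) (del + T) (fun s => rho (s - T)) := bmp_shift T hr.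
have r0 s : 0 <= rho s by exact: flat_ge0.
pose m := rint lam setT rho; have mp : 0 < m := rint_bump_gt0 del0.
have mT : rint lam setT (fun s => rho (s - T)) = m := rint_shift T (bmp_continuous hr) r0.
have supp s dd : del <= dd -> rho s != 0 -> 0 < s < 0 + dd.
  move=> dd1 h; have : 0 < s < del by apply/negPn/negP => h'; rewrite (bmp_out hr h') eqxx in h.
  by move=> /andP[-> h2] /=; rewrite add0r (lt_le_trans h2).
have suppT s dd : del <= dd -> rho (s - T) != 0 -> T < s < T + dd.
  by move=> dd1 /(supp _ _ dd1); rewrite add0r subr_gt0 ltrBlDl.
have [l1 l2 l3 l4] : [/\ del <= d1, del <= d2, del <= d3 & del <= d4].
  by split; rewrite /del !ge_min lexx ?orbT.
have B1 := H1 _ (itg_bmp hrT) (fun s => r0 _) (fun s => suppT s _ l1).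
have B2 := H2 _ (itg_bmp hrT) (fun s => r0 _) (fun s => suppT s _ l2).
have B3 := H3 _ (itg_bmp hr) r0 (fun s => supp s _ l3).
have B4 := H4 _ (itg_bmp hr) r0 (fun s => supp s _ l4).
rewrite mT in B1 B2; rewrite -/m in B3 B4.
have := shift_eq mg pg g0 hX hUinf hUC hU (lexx 0) hr (CFD_dec hc) T0; rewrite /diffpair.
rewrite (cadlag_pairing hUinft hc hrT) (cadlag_pairing hUr hc hrT).
have -> : (fun z => chi (space z) * cexpN T (g (space z)) * tcst rho z) = (fun z => chi' (space z) * tcst rho z) by [].
rewrite (cadlag_pairing hUinft hc' hr) (cadlag_pairing hUr hc' hr).
have dE : dif = Vpair (Uinft T) (fourier chi) - Vpair (Ut T) (fourier chi) -
   (Vpair (Uinft 0) (fourier chi') - Vpair (Ut 0) (fourier chi')) by [].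
move: B1 B2 B3 B4 dE.
move: (lint _ _ _) (lint _ _ _) (lint _ _ _) (lint _ _ _) (Vpair (Uinft T) _) (Vpair (Ut T) _)
  (Vpair (Uinft 0) _) (Vpair (Ut 0) _) => A4 A3 A2 A1 w1 w2 w3 w4 B1 B2 B3 B4 dE E.
have : normc (dif * m%:C) <= e * m.
  have -> : dif * m%:C = - (A1 - w1 * m%:C) + (A2 - w2 * m%:C) + ((A3 - w3 * m%:C) + - (A4 - w4 * m%:C)).
    have -> : A1 = A3 - A4 + A2 by rewrite -E subrK.
    by rewrite dE; ring.
  apply: le_trans (le_normcD _ _) _; apply: (@le_trans _ _ (2 * (e / 8) * m + 2 * (e / 8) * m + (2 * (e / 8) * m + 2 * (e / 8) * m))).
    by apply: lerD; (apply: le_trans (le_normcD _ _) _; apply: lerD); rewrite ?normcN.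
  lra.
by rewrite ComplexField.Normc.normcM normcR (gtr0_norm mp) ler_pM2r.
Qed.

End Pairing.

(** * Exponential decay of the difference, uniformly over translations *)

Theorem theorem5p1 (R : realType) (d : nat) (hd : (1 <= d)%N)
  (g : 'rV[R]_d -> R[i]) (hg : symbol_function g) (hgc : ccontinuous g)
  (kappa : R) (hkappa : 0 < kappa)
  (hgk : forall xi, kappa <= complex.Re (g xi))
  (X : tempdist R (d + 1)) (hXV : Vdual X) (hXC : VCdual X)
  (U0 : tempdist R d) (hU0 : Vdual U0)
  (Uinf : tempdist R (d + 1)) (Uinft : R -> tempdist R d)
  (hUinf : solves_evolution g X Uinf)
  (hUinft : cadlag_representation setT Uinf Uinft)
  (U : tempdist R (d + 1)) (Ut : R -> tempdist R d)
  (hU : solves_cauchy g X U0 U Ut) :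
  forall (eps : R) (phi : 'rV[R]_d -> R[i]), 0 < eps -> Vspace phi ->
  exists t0 : R, 0 <= t0 /\
    forall (t : R) (phi' : 'rV[R]_d -> R[i]), t0 <= t ->
      Vspace phi' -> translation_of phi phi' ->
      ComplexField.Normc.normc (Vpair (Uinft t) phi' - Vpair (Ut t) phi') < eps.
Proof.
move=> eps phi eps0 [chi hc ->].
have [mg pg _] := hg.
have g0 x : 0 <= re (g x) by apply: le_trans (hgk x); exact: ltW.
(* Growth bounds are needed for the two distributions at time 0 only, so their constants do not
   depend on [t]. *)
have [_ hV _] := hUinft; have [sI _] := Vdual_measure (hV 0 I).
have [_ [_ hW _] _ _] := hU; have [sU _] := Vdual_measure (hW 0 (lexx _)).
have [N1 [C1 [C10 H1]]] := cint_bound sI; have [N2 [C2 [C20 H2]]] := cint_bound sU.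
have [L1 L10 hL1] := decay_pw (CFD_dec hc).2 N1; have [L2 L20 hL2] := decay_pw (CFD_dec hc).2 N2.
pose K := C1 * L1 + C2 * L2.
have K0 : 0 <= K by rewrite addr_ge0// mulr_ge0.
have ek : 0 < eps * kappa by exact: mulr_gt0.
(* The difference is at most K exp(- kappa t). As exp(kappa t) >= 1 + kappa t, it suffices that K <
   eps (1 + kappa t), and t >= K / (eps kappa) even gives K <= eps kappa t. *)
exists (K / (eps * kappa)); split=> [|t phi' ht _ [h ->]]; first by rewrite divr_ge0// ltW.
have t0 : 0 <= t by apply: le_trans ht; rewrite divr_ge0// ltW.
rewrite fourier_translation.
pose psi x := expi (1 * dotv h x) * chi x.
have hp : CFD psi by exact: CFD_expi.
rewrite (pairing_shift mg pg hgc g0 hXC hUinf hUinft hU hp t0).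
have hp' := CFD_cexpN hgc g0 t0 hp.
rewrite /Vpair (Vifourier_fourier hp').
have bound N L : (forall x, normc (chi x) <= L * pw N x) -> forall x,
    normc (psi x * cexpN t (g x)) <= expR (- (kappa * t)) * L * pw N x.
  move=> hL x; rewrite (ComplexField.Normc.normcM (psi x)) normc_cexpN /psi ComplexField.Normc.normcM normc_expi mul1r.
  rewrite mulrC -mulrA; apply: ler_pM; rewrite ?expR_ge0 ?normc_ge0//.
  by rewrite ler_expR lerN2 mulrC ler_wpM2l.
have mp' : cmeas (fun x => psi x * cexpN t (g x)) by case: (CFD_dec hp').
have b1 := H1 _ _ mp' (bound _ _ hL1); have b2 := H2 _ _ mp' (bound _ _ hL2).
apply: le_lt_trans (le_normcD _ _) _; rewrite normcN.
apply: le_lt_trans (lerD b1 b2) _.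
rewrite (_ : _ + _ = K * expR (- (kappa * t))); last by rewrite /K; ring.
rewrite expRN ltr_pdivrMr ?expR_gt0//.
apply: (@lt_le_trans _ _ (eps * (1 + kappa * t))); last by rewrite ler_pM2l// expR_ge1Dx.
move: ht; rewrite ler_pdivrMr// => ht; lra.
Qed.
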